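(* Consider two obliquely reflected backward schemes $({}^\ell\widetilde{\mathcal Y}^{\Re,\pi},{}^\ell\mathcal Y^{\Re,\pi},{}^\ell\mathcal Z^{\Re,\pi})$, $\ell\in\{1,2\}$, on the same grid $\pi$ with the same reflection grid $\Re$ and the same weights, with terminal conditions ${}^\ell\xi$, generators ${}^\ell F$ and cost processes ${}^\ell C$, and assume that for some given $p\ge2$ the assumptions listed in the context hold for both sets of data. Then there are constants $C$ and $C_p$, not depending on $\pi$ and $\Re$, such that for any $i\in\{0,\dots,n\}$, $$\sup_{i\le k\le n}\mathbb E\left[|\delta\mathcal Y^{\Re,\pi}_k|^2+|\delta\widetilde{\mathcal Y}^{\Re,\pi}_k|^2\right]+\frac1\kappa\mathbb E\left[\sum_{k=i}^{n-1}h_k|\delta\mathcal Z^{\Re,\pi}_k|^2\right]\le C\,\mathbb E\left[\sum_{k=i}^{n-1}|\delta F_k|_\infty^2h_k+|\delta\xi|^2\right]+C_p\kappa^{4/p}\,\mathbb E\left[\sup_{0\le k\le n,\,t_k\in\Re}|\delta C_{t_k}|_\infty^p\right]^{2/p},$$ where $\delta\mathcal Y^{\Re,\pi}={}^1\mathcal Y^{\Re,\pi}-{}^2\mathcal Y^{\Re,\pi}$, $\delta\widetilde{\mathcal Y}^{\Re,\pi}={}^1\widetilde{\mathcal Y}^{\Re,\pi}-{}^2\widetilde{\mathcal Y}^{\Re,\pi}$, $\delta\mathcal Z^{\Re,\pi}={}^1\mathcal Z^{\Re,\pi}-{}^2\mathcal Z^{\Re,\pi}$, $\delta\xi={}^1\xi-{}^2\xi$,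 $|\delta C_t|_\infty=\max_{i,j\in\mathcal I}|{}^1C^{ij}_t-{}^2C^{ij}_t|$ and $|\delta F_k|_\infty=\max_{i\in\mathcal I}\sup_{z\in\mathcal M^{d,d}}|{}^1F^i_k(z)-{}^2F^i_k(z)|$.
   Context: Fix $T>0$, $d\ge1$, $\mathcal I=\{1,\dots,d\}$, and a probability space with a $d$-dimensional Brownian motion and its filtration $(\mathcal F_t)_{t\le T}$; $\mathbb E_t[\cdot]=\mathbb E[\cdot|\mathcal F_t]$. $\mathcal M^{n,m}$ denotes real $n\times m$ matrices; $z^{j\cdot}$ is the $j$th row of $z$. Grids: $\pi=\{0=t_0<\dots<t_n=T\}$, $h_i=t_{i+1}-t_i$, and $\Re=\{0=r_0<\dots<r_\kappa=T\}\subset\pi$. Data of a scheme: a matrix-valued adapted càdlàg cost process $C=(C^{ij})_{i,j\in\mathcal I}$, with $\mathcal Q_t=\{y\in\mathbb R^d:y^i\ge\max_{j}(y^j-C_t^{ij}),\ 1\le i\le d\}$ and $\mathcal P_t(y)=(\max_{j\in\mathcal I}\{y^j-C_t^{ij}\})_{1\le i\le d}$; a square integrable $\mathcal F_T$-measurable $\xi$ with values in $\mathcal Q_T$; random generators $F_i$, $0\le i\le n-1$; weights $(H_i)_{0\le i<n}$, independent random row vectors in $\mathbb R^{1\times d}$, $H_i$ $\mathcal F_{t_{i+1}}$-measurable, $\mathbb E_{t_i}[H_i]=0$, $\lambda_iI_{d\times d}=h_i\mathbb E[H_i^\top H_i]=h_i\mathbb E_{t_i}[H_i^\top H_i]$ with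 $\lambda/d\le\lambda_i\le\Lambda/d$ for positive constants $\lambda,\Lambda$. (All data may depend on $\pi$.) Assumptions (for the given $p\ge2$): (i) $F_i:\Omega\times\mathcal M^{d,d}\to\mathbb R^d$ is $\mathcal F_{t_i}\otimes\mathcal B(\mathcal M^{d,d})$-measurable; (ii) $C^{ii}=0$, $\inf_tC^{ij}_t\ge\varepsilon>0$ for $i\ne j$, $\inf_t\{C^{ij}_t+C^{jl}_t-C^{il}_t\}>0$ for $i\ne j$, $j\ne l$; (iii) $F^j_i(z)=F^j_i(z^{j\cdot})$; (iv) $|F_i(z)-F_i(z')|\le L^Z|z-z'|$; (v) $\mathbb E[|\xi|^2+\sum_{i=0}^{n-1}|F_i(0)|^2h_i+\sup_{t_i\in\Re}|C_{t_i}|^p]\le C_p$ with $C_p$ independent of the grids; (vi) $\sup_{0\le i\le n-1}h_i|H_i|L^Z\le1$. Obliquely reflected backward scheme: $\mathcal Y^{\Re,\pi}_n=\widetilde{\mathcal Y}^{\Re,\pi}_n=\xi$ and for $0\le i<n$: $\mathcal Z^{\Re,\pi}_i=\mathbb E[\mathcal Y^{\Re,\pi}_{i+1}H_i|\mathcal F_{t_i}]$, $\widetilde{\mathcal Y}^{\Re,\pi}_i=\mathbb E[\mathcal Y^{\Re,\pi}_{i+1}|\mathcal F_{t_i}]+h_iF_i(\mathcal Z^{\Re,\pi}_i)$, $\mathcal Y^{\Re,\pi}_i=\widetilde{\mathcal Y}^{\Re,\pi}_i\mathbf 1_{\{t_i\notin\Re\}}+\mathcal P_{t_i}(\widetilde{\mathcal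 Y}^{\Re,\pi}_i)\mathbf 1_{\{t_i\in\Re\}}$. Constants may depend on the constants appearing in the assumptions ($T,d,L^Z,\lambda,\Lambda,\varepsilon$, the bound in (v)) but not on $\pi,\Re$. *)

(* Defs.v *)
From HB Require Import structures.
From mathcomp Require Import all_boot all_order all_algebra.
From mathcomp Require Import all_classical all_reals all_analysis.
Set Implicit Arguments.
Unset Strict Implicit.
Unset Printing Implicit Defensive.
Import Order.TTheory GRing.Theory Num.Theory.
Import numFieldNormedType.Exports.
Local Open Scope classical_set_scope.
Local Open Scope ring_scope.

(* Euclidean (Frobenius) norm; the library norm of a matrix is the max norm. *)
Definition enorm (R : realType) (m n : nat) (A : 'M[R]_(m, n)) : R :=
  Num.sqrt (\sum_i \sum_j A i j ^+ 2).

Definition borel_mx (R : realType) (m n : nat) : set_system 'M[R]_(m, n) :=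
  <<s [set U | open U] >>.

(* [G] is the sigma-algebra of the source, given as a set of sets; [measurable]
   is the ambient one. *)
Definition mx_measurable (R : realType) (Omega : Type) (m n : nat)
    (G : set_system Omega) (X : Omega -> 'M[R]_(m, n)) : Prop :=
  preimage_set_system [set: Omega] X (@borel_mx R m n) `<=` G.

(* Joint measurability of f : Omega x M^{a,b} -> M^{m,n} for G (x) Borel. *)
Definition mx_field_measurable (R : realType) (Omega : Type) (a b m n : nat)
    (G : set_system Omega) (f : Omega -> 'M[R]_(a, b) -> 'M[R]_(m, n)) : Prop :=
  preimage_set_system [set: Omega * 'M[R]_(a, b)] (fun u => f u.1 u.2)
      (@borel_mx R m n)
    `<=` <<s [set S | exists A B,
                [/\ G A, @borel_mx R a b B & S = A `*` B] ] >>.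

(* Y is a version of E[X | G], componentwise. *)
Definition is_condexp (R : realType) (disp : measure_display)
    (Omega : measurableType disp) (P : probability Omega R) (m n : nat)
    (G : set_system Omega) (X Y : Omega -> 'M[R]_(m, n)) : Prop :=
  mx_measurable G Y /\
  forall i j,
    [/\ P.-integrable setT (fun w => (X w i j)%:E),
        P.-integrable setT (fun w => (Y w i j)%:E) &
        forall A, G A ->
          (\int[P]_(w in A) (Y w i j)%:E = \int[P]_(w in A) (X w i j)%:E)%E].

Definition natural_filtration (R : realType) (Omega : Type) (d : nat)
    (W : R -> Omega -> 'rV[R]_d) (t : R) : set_system Omega :=
  <<s \bigcup_(s in `[0, t]) preimage_set_system setT (W s) (@borel_mx R 1 d) >>.

(* Augmentation by the P-null measurable sets. *)
Definition brownian_filtration (R : realType) (disp : measure_display)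
    (Omega : measurableType disp) (P : probability Omega R) (d : nat)
    (W : R -> Omega -> 'rV[R]_d) (t : R) : set_system Omega :=
  <<s natural_filtration W t `|` [set N | measurable N /\ P N = 0%E] >>.

Record brownian_motion (R : realType) (disp : measure_display)
    (Omega : measurableType disp) (P : probability Omega R) (d : nat) (T : R)
    (W : R -> Omega -> 'rV[R]_d) : Prop := BrownianMotion {
  bm_measurable : forall t : R, 0 <= t <= T -> mx_measurable measurable (W t);
  bm_start : {ae P, forall w, W 0 w = 0};
  bm_continuous : {ae P, forall w, {within `[0, T], continuous (W ^~ w)}};
  bm_independent : forall s t : R, 0 <= s -> s < t -> t <= T ->
    forall A B, natural_filtration W s A -> @borel_mx R 1 d B ->
      P (A `&` [set w | B (W t w - W s w)%R]) =
      (P A * P [set w | B (W t w - W s w)%R])%E;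
  bm_gaussian : forall s t : R, 0 <= s -> s < t -> t <= T ->
    forall B : 'I_d -> set R, (forall j, measurable (B j)) ->
      P [set w | forall j, B j (W t w 0 j - W s w 0 j)%R] =
      (\prod_(j < d) normal_prob 0 (Num.sqrt (t - s)) (B j))%E
}.

(* 0 = t_0 < ... < t_n = T; the values of t above n are irrelevant, and so are
   those of the families indexed by the grid below. *)
Definition is_grid (R : realType) (T : R) (n : nat) (t : nat -> R) : Prop :=
  [/\ t 0%N = 0, t n = T & forall i, (i < n)%N -> t i < t i.+1].

Definition grid_points (R : realType) (n : nat) (t : nat -> R) : seq R :=
  mkseq t n.+1.

Definition step (R : realType) (t : nat -> R) (i : nat) : R := t i.+1 - t i.

Definition cadlag (R : realType) (T : R) (m n : nat) (f : R -> 'M[R]_(m, n)) :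
    Prop :=
  (forall t : R, 0 <= t < T -> f s @[s --> t^'+] --> f t) /\
  (forall t : R, 0 < t <= T -> exists l : 'M[R]_(m, n), f s @[s --> t^'-] --> l).

(* The initial value of the iterated maximum is the term j = i. *)
Definition obl_proj (R : realType) (d : nat) (C : 'M[R]_d) (y : 'cV[R]_d) :
    'cV[R]_d :=
  \col_i \big[Num.max/y i 0 - C i i]_(j < d) (y j 0 - C i j).

Definition obl_dom (R : realType) (d : nat) (C : 'M[R]_d) : set 'cV[R]_d :=
  [set y | forall i, obl_proj C y i 0 <= y i 0].

Record is_weights (R : realType) (disp : measure_display)
    (Omega : measurableType disp) (P : probability Omega R) (d : nat)
    (Ft : R -> set_system Omega) (lambda Lambda : R) (n : nat) (t : nat -> R)
    (H : nat -> Omega -> 'rV[R]_d) : Prop := IsWeights {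
  weights_adapted : forall i, (i < n)%N -> mx_measurable (Ft (t i.+1)) (H i);
  weights_independent : forall B : nat -> set 'rV[R]_d,
    (forall i, (i < n)%N -> @borel_mx R 1 d (B i)) ->
    P [set w | forall i, (i < n)%N -> B i (H i w)] =
    (\prod_(i < n) P (H i @^-1` B i))%E;
  weights_centered : forall i, (i < n)%N ->
    is_condexp P (Ft (t i)) (H i) (fun=> 0);
  weights_covariance : forall i, (i < n)%N -> exists l : R,
    [/\ lambda / d%:R <= l <= Lambda / d%:R,
        forall a b, 'E_P[fun w => (step t i * ((H i w)^T *m H i w) a b)%R]%E =
                    ((l%:M : 'M[R]_d) a b)%:E &
        is_condexp P (Ft (t i)) (fun w => step t i *: ((H i w)^T *m H i w))
          (fun=> l%:M)]
}.

Record scheme_assumptions (R : realType) (disp : measure_display)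
    (Omega : measurableType disp) (P : probability Omega R) (d : nat)
    (Ft : R -> set_system Omega) (T LZ eps p K : R)
    (n : nat) (t : nat -> R) (kappa : nat) (r : nat -> R)
    (H : nat -> Omega -> 'rV[R]_d) (C : R -> Omega -> 'M[R]_d)
    (xi : Omega -> 'cV[R]_d) (F : nat -> Omega -> 'M[R]_d -> 'cV[R]_d) : Prop :=
  SchemeAssumptions {
  cost_adapted : forall s : R, 0 <= s <= T -> mx_measurable (Ft s) (C s);
  cost_cadlag : {ae P, forall w, cadlag T (C ^~ w)};
  xi_measurable : mx_measurable (Ft T) xi;
  xi_square_integrable : ('E_P[fun w => (enorm (xi w) ^+ 2)%R] < +oo)%E;
  xi_dom : {ae P, forall w, obl_dom (C T w) (xi w)};
  gen_measurable : forall i, (i < n)%N -> mx_field_measurable (Ft (t i)) (F i);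
  cost_diag : {ae P, forall w, forall (s : R) i, 0 <= s <= T -> C s w i i = 0};
  cost_lower : {ae P, forall w, forall i j : 'I_d, i != j ->
    (eps%:E <= ereal_inf [set (C s w i j)%:E | s in `[0%R, T]])%E};
  cost_triangle : {ae P, forall w, forall i j l : 'I_d, i != j -> j != l ->
    (0 < ereal_inf [set (C s w i j + C s w j l - C s w i l)%R%:E
                   | s in `[0%R, T]])%E};
  gen_row : forall k, (k < n)%N ->
    {ae P, forall w, forall j (z z' : 'M[R]_d), row j z = row j z' ->
      F k w z j 0 = F k w z' j 0};
  gen_lipschitz : forall k, (k < n)%N ->
    {ae P, forall w, forall z z' : 'M[R]_d,
      enorm (F k w z - F k w z') <= LZ * enorm (z - z')};
  data_bound :
    ('E_P[fun w => (enorm (xi w) ^+ 2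
            + \sum_(k < n) enorm (F k w 0) ^+ 2 * step t k
            + \big[Num.max/0]_(k < n.+1 | t k \in grid_points kappa r)
                (enorm (C (t k) w) `^ p))%R] <= K%:E)%E;
  weights_bound : {ae P, forall w, forall k, (k < n)%N ->
    step t k * enorm (H k w) * LZ <= 1}
}.

(* The second field reads Yt_i = E[Y_{i+1} | F_{t_i}] + h_i F_i(Z_i). *)
Record reflected_scheme (R : realType) (disp : measure_display)
    (Omega : measurableType disp) (P : probability Omega R) (d : nat)
    (Ft : R -> set_system Omega)
    (n : nat) (t : nat -> R) (kappa : nat) (r : nat -> R)
    (H : nat -> Omega -> 'rV[R]_d) (C : R -> Omega -> 'M[R]_d)
    (xi : Omega -> 'cV[R]_d) (F : nat -> Omega -> 'M[R]_d -> 'cV[R]_d)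
    (Yt Y : nat -> Omega -> 'cV[R]_d) (Z : nat -> Omega -> 'M[R]_d) : Prop :=
  ReflectedScheme {
  scheme_terminal : forall w, Y n w = xi w /\ Yt n w = xi w;
  scheme_Yt : forall i, (i < n)%N ->
    is_condexp P (Ft (t i)) (Y i.+1)
      (fun w => Yt i w - step t i *: F i w (Z i w));
  scheme_Z : forall i, (i < n)%N ->
    is_condexp P (Ft (t i)) (fun w => Y i.+1 w *m H i w) (Z i);
  scheme_Y : forall i, (i < n)%N -> forall w,
    Y i w = if t i \in grid_points kappa r then obl_proj (C (t i) w) (Yt i w)
            else Yt i w
}.

Definition cost_dist (R : realType) (d : nat) (C1 C2 : 'M[R]_d) : R :=
  \big[Num.max/0]_(i < d) \big[Num.max/0]_(j < d) `|C1 i j - C2 i j|.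

(* Extended-real valued: the supremum over z may be infinite. *)
Definition gen_dist (R : realType) (d : nat) (F1 F2 : 'M[R]_d -> 'cV[R]_d) :
    \bar R :=
  (\big[maxe/0]_(i < d)
     ereal_sup [set `|F1 z i 0%R - F2 z i 0%R|%:E | z in [set: 'M[R]_d]])%E.

(* Main.v *)
Require Import Defs.
From HB Require Import structures.
From mathcomp Require Import all_boot all_order all_algebra.
From mathcomp Require Import all_classical all_reals all_analysis.
From mathcomp Require Import measurable_realfun zify lra ring.
Set Implicit Arguments.
Unset Strict Implicit.
Unset Printing Implicit Defensive.
Import Order.TTheory GRing.Theory Num.Theory.
Import numFieldNormedType.Exports.
Local Open Scope classical_set_scope.
Local Open Scope ring_scope.

(** Projecting obliquely amounts to switching: at a reflection date the component
    i takes the largest of the values y^j - C^ij, that is, it moves to the best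
    component j and pays the cost. The scheme is therefore followed along an
    optimal switching route, where it is a scalar backward path from which the
    costs paid are subtracted.

    Comparison. The bound h |H| L <= 1 on the weights makes a backward step
    monotone ([step_ge0]): the conditional mean of a nonnegative variable exceeds
    what a Lipschitz generator can take back through its Z-component. Hence
    schemes are ordered like their data ([comparison]). Two arbitrary schemes are
    both dominated by the one with the larger generator, the larger terminal value
    and the smaller costs. Since (a - b)^2 <= (c - a)^2 + (c - b)^2 whenever c is an
    upper bound of a and b, it is enough to compare ordered schemes ([one_side]).

    Ordered schemes. Both are followed along the optimal route of the larger one
    ([route_difference]). Their difference is a nonnegative path, driven by the
    distance psi of the generators, and its reflecting process increases at the
    switches only, by the difference of the costs. Since the conditional covariance
    of the weights is proportional to the identity, Bessel's inequality controls
    the Z-component by the change of the energy in one step ([bessel],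
    [one_step]), and
    Gronwall's inequality gives the estimate [energy_bound], where the reflecting
    process enters through the second moment of its total B alone.

    The power of kappa. One has B <= N S, where N is the number of switches and S
    the largest cost difference over the reflection dates. Each switch costs at
    least eps, so that eps N is at most the total cost paid; by an argument of
    Garsia this total is bounded in L2 by the data, independently of the grids
    ([cost_bound], [route_cost_bound]). Besides, N <= 2 kappa everywhere. As only a
    moment of order p of S is controlled, E[N^2 S^2] is split at the level
    S = kappa^(2/p) |S|_p: below it the bound in L2 on N is used, above it the
    uniform one, and both parts are of order kappa^(4/p) |S|_p^2
    ([switching_moment]).

    The Z-component. Summing the energy inequality of one step over time
    telescopes except at the reflection dates, where the energy may jump; there are
    at most 2 kappa of them, whence the factor 1/kappa ([z_bound]).

    The estimates are proved for families of real variables ([stability]). The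
    passage from matrices to coordinates uses that the j-th component of the
    generator depends on the j-th row only, and rests on a countable base of the
    Borel sets of matrices. The distance of the generators is a supremum over all
    matrices and may fail to be measurable; the integral of a nonnegative function
    being a supremum over simple functions, it still bounds the expectation of
    every measurable function below the integrand ([mean_le_integral]). *)

(** * Square-integrable random variables *)

Section Moments.
Context (disp : measure_display) (T : measurableType disp) (R : realType)
  (P : probability T R).
Implicit Types (X Y : T -> R).

Definition summ X := P.-integrable setT (EFin \o X).

Definition sqsumm X := measurable_fun setT X /\ summ (fun w => X w ^+ 2).

(** Expectations are taken as real numbers, so that all the estimates below take
    place in an ordered field; summability is proved beforehand each time. *)
Definition mean X : R := \int[P]_w X w.

Lemma summ_meas X : summ X -> measurable_fun setT X.
Proof. by move=> /measurable_int/measurable_EFinP. Qed.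

Lemma summD X Y : summ X -> summ Y -> summ (fun w => X w + Y w).
Proof. by move=> ? ?; exact: (@integrableD _ _ _ P setT measurableT (EFin \o X) (EFin \o Y)). Qed.

Lemma summB X Y : summ X -> summ Y -> summ (fun w => X w - Y w).
Proof. by move=> ? ?; exact: (@integrableB _ _ _ P setT measurableT (EFin \o X) (EFin \o Y)). Qed.

Lemma summZ (a : R) X : summ X -> summ (fun w => a * X w).
Proof. by move=> ?; exact: (@integrableZl _ _ _ P setT measurableT a (EFin \o X)). Qed.

Lemma summ_cst (a : R) : summ (fun=> a).
Proof. exact: (@finite_measure_integrable_cst _ _ _ P). Qed.

Lemma summ_sum (I : Type) (s : seq I) (Q : pred I) (X : I -> T -> R) :
  (forall i, Q i -> summ (X i)) -> summ (fun w => \sum_(i <- s | Q i) X i w).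
Proof.
move=> sX; rewrite /summ.
have -> : EFin \o (fun w => \sum_(i <- s | Q i) X i w) =
          (fun w => \sum_(i <- s | Q i) (X i w)%:E)%E.
  by apply/funext => w /=; rewrite sumEFin.
exact: (@integrable_sum _ _ _ P setT measurableT _ s Q (fun i => EFin \o X i)).
Qed.

Lemma summ_ae_dom X Y : measurable_fun setT X -> summ Y ->
  {ae P, forall w, `|X w| <= Y w} -> summ X.
Proof.
move=> mX sY XY; apply/integrableP; split; first exact/measurable_EFinP.
have mY := summ_meas sY.
have /integrableP[_ Yoo] := sY.
apply: le_lt_trans Yoo.
apply: ae_ge0_le_integral => //.
- by apply/measurable_EFinP; exact: measurableT_comp.
- by apply/measurable_EFinP; exact: measurableT_comp.
- apply: filterS XY => w XYw _; rewrite lee_fin.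
  exact: (le_trans XYw (ler_norm _)).
Qed.

Lemma summ_dom X Y : measurable_fun setT X -> summ Y ->
  (forall w, `|X w| <= Y w) -> summ X.
Proof. by move=> mX sY XY; apply: (summ_ae_dom mX sY); exact: aeW. Qed.

Lemma summ_norm X : summ X -> summ (fun w => `|X w|).
Proof. exact: integrable_norm. Qed.

Lemma sqsumm_meas X : sqsumm X -> measurable_fun setT X.
Proof. by case. Qed.

Lemma sqsumm_sqr X : sqsumm X -> summ (fun w => X w ^+ 2).
Proof. by case. Qed.

Lemma sqsummM X Y : sqsumm X -> sqsumm Y -> summ (fun w => X w * Y w).
Proof.
move=> [mX sX] [mY sY]; apply: (summ_dom _ (summD sX sY)).
  exact: measurable_funM.
move=> w; rewrite ler_norml; apply/andP; split; nra.
Qed.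

Lemma sqsumm_ae_dom X Y : measurable_fun setT X -> sqsumm Y ->
  {ae P, forall w, `|X w| <= Y w} -> sqsumm X.
Proof.
move=> mX [mY sY] XY; split=> //; apply: (summ_ae_dom _ sY).
  exact: measurable_funX.
apply: filterS XY => w XYw; rewrite normrX lerXn2r// ?nnegrE//.
exact: le_trans XYw.
Qed.

Lemma sqsumm_dom X Y : measurable_fun setT X -> sqsumm Y ->
  (forall w, `|X w| <= Y w) -> sqsumm X.
Proof. by move=> mX sY XY; apply: (sqsumm_ae_dom mX sY); exact: aeW. Qed.

Lemma sqsummD X Y : sqsumm X -> sqsumm Y -> sqsumm (fun w => X w + Y w).
Proof.
move=> qX qY; have [mX sX] := qX; have [mY sY] := qY; split.
  exact: measurable_funD.
have -> : (fun w => (X w + Y w) ^+ 2) =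
          (fun w => X w ^+ 2 + (2 * (X w * Y w) + Y w ^+ 2)).
  by apply/funext => w; ring.
by apply: summD => //; apply: summD => //; apply: summZ; exact: sqsummM.
Qed.

Lemma sqsummZ (a : R) X : sqsumm X -> sqsumm (fun w => a * X w).
Proof.
move=> [mX sX]; split; first exact: measurable_funM.
have -> : (fun w => (a * X w) ^+ 2) = (fun w => a ^+ 2 * X w ^+ 2).
  by apply/funext => w; ring.
exact: summZ.
Qed.

Lemma sqsummB X Y : sqsumm X -> sqsumm Y -> sqsumm (fun w => X w - Y w).
Proof.
move=> qX qY; have -> : (fun w => X w - Y w) = (fun w => X w + (- 1) * Y w).
  by apply/funext => w; ring.
by apply: sqsummD => //; exact: sqsummZ.
Qed.

Lemma sqsumm_cst (a : R) : sqsumm (fun=> a).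
Proof. by split => //; exact: summ_cst. Qed.

Lemma sqsumm_norm X : sqsumm X -> sqsumm (fun w => `|X w|).
Proof.
move=> [mX sX]; split; first exact: measurableT_comp.
have -> : (fun w => `|X w| ^+ 2) = (fun w => X w ^+ 2); last by [].
by apply/funext => w; exact: real_normK (num_real _).
Qed.

Lemma sqsumm_sum (I : Type) (s : seq I) (Q : pred I) (X : I -> T -> R) :
  (forall i, Q i -> sqsumm (X i)) ->
  sqsumm (fun w => \sum_(i <- s | Q i) X i w).
Proof.
move=> sX; elim: s => [|i s IH].
  have -> : (fun w => \sum_(i <- [::] | Q i) X i w) = (fun=> 0).
    by apply/funext => w; rewrite big_nil.
  exact: sqsumm_cst.
have -> : (fun w => \sum_(j <- i :: s | Q j) X j w) =
   (fun w => (if Q i then X i w else 0) + \sum_(j <- s | Q j) X j w).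
  by apply/funext => w; rewrite big_cons; case: ifP => // _; rewrite add0r.
by apply: sqsummD => //; case: (Q i) (sX i) => [sXi|_]; [exact: sXi|exact: sqsumm_cst].
Qed.

Lemma sqsumm_summ X : sqsumm X -> summ X.
Proof.
move=> qX; have -> : X = (fun w => 1 * X w) by apply/funext => w; rewrite mul1r.
by apply: sqsummM => //; exact: sqsumm_cst.
Qed.

Lemma meanD X Y : summ X -> summ Y ->
  mean (fun w => X w + Y w) = mean X + mean Y.
Proof. by move=> sX sY; rewrite /mean RintegralD. Qed.

Lemma meanB X Y : summ X -> summ Y ->
  mean (fun w => X w - Y w) = mean X - mean Y.
Proof. by move=> sX sY; rewrite /mean RintegralB. Qed.

Lemma meanZ (a : R) X : summ X -> mean (fun w => a * X w) = a * mean X.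
Proof. by move=> sX; rewrite /mean RintegralZl. Qed.

Lemma mean_cst (a : R) : mean (fun=> a) = a.
Proof.
rewrite /mean Rintegral_cst// -[RHS]mulr1 -[in RHS]/(fine 1%E).
by congr (_ * fine _); exact: probability_setT.
Qed.

Lemma mean_sum (I : Type) (s : seq I) (Q : pred I) (X : I -> T -> R) :
  (forall i, Q i -> summ (X i)) ->
  mean (fun w => \sum_(i <- s | Q i) X i w) = \sum_(i <- s | Q i) mean (X i).
Proof.
move=> sX; elim: s => [|i s IH].
  rewrite big_nil -[RHS](mean_cst 0); congr mean.
  by apply/funext => w; rewrite big_nil.
rewrite big_cons; case: ifP => Qi; last first.
  rewrite -IH; congr mean; apply/funext => w.
  by rewrite big_cons Qi.
rewrite -IH -meanD; [|exact: sX|exact: summ_sum].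
by congr mean; apply/funext => w; rewrite big_cons Qi.
Qed.

Lemma big_nat_guard (k n : nat) (x : nat -> R) :
  \sum_(k <= m < n) x m = \sum_(k <= m < n | (k <= m < n)%N) x m.
Proof. by rewrite big_nat_cond; under eq_bigl do rewrite andbT. Qed.

Lemma summ_sum_nat k n (X : nat -> T -> R) :
  (forall m, (k <= m < n)%N -> summ (X m)) ->
  summ (fun w => \sum_(k <= m < n) X m w).
Proof. by move=> sX; under eq_fun do rewrite big_nat_guard; exact: summ_sum. Qed.

Lemma sqsumm_sum_nat k n (X : nat -> T -> R) :
  (forall m, (k <= m < n)%N -> sqsumm (X m)) ->
  sqsumm (fun w => \sum_(k <= m < n) X m w).
Proof. by move=> sX; under eq_fun do rewrite big_nat_guard; exact: sqsumm_sum. Qed.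

Lemma mean_sum_nat k n (X : nat -> T -> R) :
  (forall m, (k <= m < n)%N -> summ (X m)) ->
  mean (fun w => \sum_(k <= m < n) X m w) = \sum_(k <= m < n) mean (X m).
Proof.
move=> sX; rewrite [RHS]big_nat_guard -mean_sum//; congr mean; apply/funext => w.
exact: big_nat_guard.
Qed.

Lemma mean_ge0 X : (forall w, 0 <= X w) -> 0 <= mean X.
Proof. by move=> X0; apply: Rintegral_ge0 => w _. Qed.

Lemma mean_ae_ge0 X : summ X -> {ae P, forall w, 0 <= X w} -> 0 <= mean X.
Proof.
move=> sX X0; have mX := summ_meas sX.
have -> : mean X = mean (fun w => `|X w|).
  congr fine; apply: ae_eq_integral => //.
  - exact/measurable_EFinP.
  - by apply/measurable_EFinP; exact: measurableT_comp.
  - by apply: filterS X0 => w X0 _ /=; rewrite ger0_norm.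
by apply: mean_ge0.
Qed.

Lemma ler_mean X Y : summ X -> summ Y -> {ae P, forall w, X w <= Y w} ->
  mean X <= mean Y.
Proof.
move=> sX sY XY; rewrite -subr_ge0 -meanB//; apply: mean_ae_ge0.
  exact: summB.
by apply: filterS XY => w; rewrite subr_ge0.
Qed.

Lemma eq_mean X Y : summ X -> summ Y -> {ae P, forall w, X w = Y w} ->
  mean X = mean Y.
Proof.
move=> sX sY XY; apply/eqP; rewrite eq_le; apply/andP; split;
  by apply: ler_mean => //; apply: filterS XY => w ->.
Qed.

Lemma mean_expectation X : summ X -> ('E_P[X] = (mean X)%:E)%E.
Proof.
move=> sX; rewrite unlock /mean /Rintegral fineK//.
exact: (@integrable_fin_num _ _ _ P setT _ (EFin \o X)).
Qed.

Lemma mean_integral X : summ X -> (\int[P]_w (X w)%:E = (mean X)%:E)%E.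
Proof. by move=> sX; rewrite -mean_expectation// unlock. Qed.

End Moments.

(** * Conditional expectation *)

Section ConditionalExpectation.
Context (disp : measure_display) (T : measurableType disp) (R : realType)
  (P : probability T R).
Implicit Types (X Y e g : T -> R) (G : set_system T).

Definition subalg G := sigma_algebra [set: T] G /\ G `<=` @measurable _ T.

(** Measurability is stated on the type carrying the smaller sigma-algebra, so
    that the closure properties of measurable functions apply to it. *)
Definition adapted G X :=
  measurable_fun [set: g_sigma_algebraType G] (X : g_sigma_algebraType G -> R).

Definition condexp G X e :=
  [/\ adapted G e, summ P X, summ P e &
      forall A, G A -> mean P (fun w => \1_A w * e w) =
                       mean P (fun w => \1_A w * X w)].

Lemma subalgE G : subalg G -> <<s G >> = G.
Proof. by case=> sG _; exact: sigma_algebra_id. Qed.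

Lemma subalg_meas G : subalg G ->
  measurable_fun [set: T] (id : T -> g_sigma_algebraType G).
Proof.
move=> sG _ A mA; rewrite setTI preimage_id; apply: sG.2.
by rewrite -(subalgE sG).
Qed.

Lemma adapted_meas G X : subalg G -> adapted G X -> measurable_fun setT X.
Proof.
by move=> sG aX; exact: (measurableT_comp aX (subalg_meas sG)).
Qed.

Lemma adapted_pre G X (B : set R) : subalg G -> adapted G X -> measurable B ->
  G (X @^-1` B).
Proof.
move=> sG aX mB; have H : <<s G >> (X @^-1` B).
  by rewrite -[X @^-1` B]setTI; exact: aX.
by rewrite (subalgE sG) in H.
Qed.

Lemma adapted_sub G G' X : G `<=` G' -> adapted G X -> adapted G' X.
Proof.
move=> GG' aX _ B mB; have := aX measurableT B mB.
exact: (sub_sigma_algebra2 (D := setT) GG').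
Qed.

Lemma adapted_indic G (A : set T) : subalg G -> G A ->
  adapted G (\1_A : T -> R).
Proof.
move=> sG GA; apply: (@measurable_indic _ (g_sigma_algebraType G)).
exact: sub_sigma_algebra.
Qed.

Lemma summ_indic (A : set T) X : measurable A -> summ P X ->
  summ P (fun w => \1_A w * X w).
Proof.
move=> mA sX; apply: (summ_dom _ (summ_norm sX)).
  by apply: measurable_funM => //; exact: summ_meas sX.
move=> w; rewrite normrM ger0_norm// ler_piMl// indicE.
Qed.

(** The conditional expectation is the Radon-Nikodym derivative, on the smaller
    sigma-algebra, of the charge A |-> E[1_A X]. *)
Lemma condexp_exists G X : subalg G -> summ P X -> exists e, condexp G X e.
Proof.
move=> sG sX.
pose GT := g_sigma_algebraType G.
have mid : measurable_fun [set: T] (id : T -> GT) := subalg_meas sG.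
pose idm : {mfun T >-> GT} := HB.pack (id : T -> GT)
  (isMeasurableFun.Build _ _ _ _ _ mid).
pose mu : probability GT R := distribution P idm.
have GTm (A : set GT) : measurable A -> measurable (A : set T).
  by move=> mA; apply: sG.2; rewrite -(subalgE sG).
pose nuf : set GT -> \bar R := fun A => induced_charge sX A.
have nu0 : nuf set0 = 0%E by exact: charge0.
have nufin A : measurable A -> nuf A \is a fin_num.
  by move=> /GTm mA; exact: fin_num_measure.
have nusig : semi_sigma_additive nuf.
  move=> F mF tF mUF.
  apply: (@charge_semi_sigma_additive _ _ _ (induced_charge sX)) => //.
  - by move=> i; exact: GTm.
  - exact: GTm.
pose nu : {charge set GT -> \bar R} :=
  HB.pack nuf (isCharge.Build _ GT R nuf nu0 nufin nusig).
have numu : nu `<< mu.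
  apply/null_content_dominatesP => A mA muA.
  apply: null_set_integral => //; first exact: GTm.
  by apply: measurable_funTS; exact: measurable_int sX.
have sD := @Radon_Nikodym_integrable _ _ _ nu mu numu.
pose e0 := Radon_Nikodym nu mu.
have me0 : measurable_fun setT e0 := measurable_int _ sD.
pose e := fun w : GT => fine (e0 w).
have eE w : ((e w)%:E = e0 w)%E by rewrite fineK// Radon_Nikodym_fin_num.
have ae : adapted G e.
  apply/measurable_EFinP; rewrite (_ : EFin \o e = e0)//.
  by apply/funext => w /=; exact: eE.
have se : summ P e.
  apply/integrableP; split.
    exact/measurable_EFinP/(adapted_meas sG ae).
  have /integrableP[_] := sD; rewrite ge0_integral_distribution//; last first.
    exact: measurableT_comp.
  move=> soo; apply: (le_lt_trans _ soo); rewrite le_eqVlt; apply/orP; left.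
  by apply/eqP; apply: eq_integral => w _ /=; rewrite /idm/= -/(e0 w) -eE.
exists e; split => // A GA.
have mA : measurable A by exact: sG.2.
have mA' : measurable (A : set GT) by exact: sub_sigma_algebra.
congr fine.
transitivity (nu A); last first.
  rewrite /nu/= /nuf /induced_charge integral_mkcond; apply: eq_integral => w _.
  by rewrite epatch_indic /= EFinM muleC.
rewrite (Radon_Nikodym_integral numu mA') [RHS]integral_mkcond.
have eA : (fun w => (\1_A w * e w)%:E) = ((e0 \_ A) \o idm)%E.
  by apply/funext => w /=; rewrite epatch_indic /= EFinM muleC eE.
transitivity (\int[P]_w ((e0 \_ A) \o idm) w)%E; first by rewrite -eA.
apply/esym/integral_distribution.
- apply/(measurable_restrictT _ _).1 => //. by apply: measurable_funTS; exact: me0.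
- by rewrite -eA; exact: (summ_indic mA se).
Qed.

End ConditionalExpectation.

Section ConditionalExpectationTheory.
Import HBNNSimple.
Context (disp : measure_display) (T : measurableType disp) (R : realType)
  (P : probability T R).
Implicit Types (X Y e g : T -> R) (G : set_system T).
Local Notation mean := (mean P).
Local Notation summ := (summ P).
Local Notation condexp := (condexp P).

Lemma summ_bddM (M : R) g X : measurable_fun setT g ->
  (forall w, `|g w| <= M) -> summ X -> summ (fun w => g w * X w).
Proof.
move=> mg gM sX; have mX := summ_meas sX.
apply: (summ_dom (Y := fun w => M * `|X w|)).
- exact: measurable_funM.
- by apply: summZ; exact: summ_norm.
- by move=> w; rewrite normrM ler_wpM2r.
Qed.

Lemma mean_simple_eq0 G X (g : {nnsfun g_sigma_algebraType G >-> R}) :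
  subalg G -> summ X ->
  (forall A, G A -> mean (fun w => \1_A w * X w) = 0) ->
  mean (fun w => g w * X w) = 0.
Proof.
move=> sG sX X0.
pose s := finmap.enum_fset (fset_set (range g)).
have Gs (i : nat) : G (g @^-1` [set s`_i]).
  apply: (adapted_pre sG); last exact: measurable_set1.
  exact: (measurable_funPT g).
have -> : (fun w => g w * X w) = (fun w =>
   \sum_(i < size s) s`_i * (\1_(g @^-1` [set s`_i]) w * X w)).
  apply/funext => w; rewrite fimfunEord mulr_suml; apply: eq_bigr => i _.
  by rewrite mulrA.
rewrite mean_sum => [|i _]; last first.
  by apply: summZ; apply: summ_indic => //; apply: sG.2.
rewrite big1// => i _; rewrite meanZ ?X0 ?mulr0//.
by apply: summ_indic => //; apply: sG.2.
Qed.

(** Nonnegative test variables are increasing limits of simple ones; the limit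
    passes under the expectation by dominated convergence. *)
Lemma mean_ge0_adapted_eq0 G X g : subalg G -> summ X ->
  (forall A, G A -> mean (fun w => \1_A w * X w) = 0) ->
  adapted G g -> (forall w, 0 <= g w) -> summ (fun w => g w * X w) ->
  mean (fun w => g w * X w) = 0.
Proof.
move=> sG sX X0 ag g0 sgX.
have mf : measurable_fun [set: g_sigma_algebraType G] (EFin \o g).
  exact/measurable_EFinP.
pose f_ := nnsfun_approx measurableT mf.
have f0 (x : g_sigma_algebraType G) : setT x -> (0 <= (EFin \o g) x)%E.
  by rewrite /= lee_fin.
have f_le k w : f_ k w <= g w.
  by rewrite -lee_fin /f_ nnsfun_approxE; exact: (le_approx k f0).
have mfk k : measurable_fun [set: T] (f_ k : T -> R).
  by apply: (adapted_meas sG); exact: (measurable_funPT (f_ k)).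
have mX := summ_meas sX.
have cv : (\int[P]_w (f_ n w * X w)%:E @[n --> \oo] -->
          \int[P]_w (g w * X w)%:E)%E.
  apply: (@dominated_cvg _ _ _ P setT measurableT _ _
     (fun w => `|g w * X w|%:E)) => //.
  - by move=> k; apply/measurable_EFinP; exact: measurable_funM.
  - move=> w _; under eq_fun do rewrite EFinM.
    rewrite EFinM; apply: cvgeZr => //. exact: (cvg_nnsfun_approx measurableT mf f0).
  - exact: summ_norm.
  - move=> k w _; rewrite lee_fin !normrM ler_wpM2r//.
    by rewrite !ger0_norm.
have z0 : (fun n => \int[P]_w (f_ n w * X w)%:E)%E = (fun=> 0%E).
  apply/funext => k.
  have sk : summ (fun w => f_ k w * X w).
    apply: (summ_dom _ (summ_norm sgX)); first exact: measurable_funM.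
    by move=> w; rewrite !normrM ler_wpM2r// !ger0_norm.
  by rewrite mean_integral// mean_simple_eq0.
rewrite z0 in cv; rewrite /mean /Rintegral.
have := cvg_unique _ cv (cvg_cst 0%E) => ->//.
Qed.

(** The defining identity extends from indicators to every adapted test variable
    for which both products are summable, through its positive and negative
    parts. *)
Lemma condexp_pull G X e g : subalg G -> condexp G X e -> adapted G g ->
  summ (fun w => g w * X w) -> summ (fun w => g w * e w) ->
  mean (fun w => g w * e w) = mean (fun w => g w * X w).
Proof.
move=> sG [ae sX se eX] ag sgX sge.
have mg := adapted_meas sG ag.
pose D w := X w - e w; have sD : summ D by exact: summB.
have D0 A : G A -> mean (fun w => \1_A w * D w) = 0.
  move=> GA; have mA := sG.2 _ GA.
  have -> : (fun w => \1_A w * D w) =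
            (fun w => \1_A w * X w - \1_A w * e w).
    by apply/funext => w; rewrite /D mulrBr.
  by rewrite meanB ?eX ?subrr//; exact: summ_indic.
have sgD : summ (fun w => g w * D w).
  have -> : (fun w => g w * D w) = (fun w => g w * X w - g w * e w).
    by apply/funext => w; rewrite /D mulrBr.
  exact: summB.
have part u : adapted G u -> (forall w, 0 <= u w <= `|g w|) ->
    summ (fun w => u w * D w) /\ mean (fun w => u w * D w) = 0.
  move=> au u0; have su : summ (fun w => u w * D w).
    apply: (summ_dom _ (summ_norm sgD)).
      apply: measurable_funM; first exact: adapted_meas au.
      exact: summ_meas sD.
    move=> w; have /andP[u0w ugw] := u0 w.
    by rewrite !normrM ler_wpM2r// ger0_norm.
  split => //; apply: (mean_ge0_adapted_eq0 sG sD D0 au) => // w.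
  by have /andP[] := u0 w.
have [sp mp] : summ (fun w => Num.max (g w) 0 * D w) /\
               mean (fun w => Num.max (g w) 0 * D w) = 0.
  apply: part => [|w]; first exact: measurable_maxr.
  rewrite le_max lexx orbT/= ge_max normr_ge0 andbT; exact: ler_norm.
have [sn mn] : summ (fun w => Num.max (- g w) 0 * D w) /\
               mean (fun w => Num.max (- g w) 0 * D w) = 0.
  apply: part => [|w].
    by apply: measurable_maxr => //; exact: measurable_funN.
  rewrite le_max lexx orbT/= ge_max normr_ge0 andbT -normrN; exact: ler_norm.
apply/eqP; rewrite eq_sym -subr_eq0 -meanB//; apply/eqP.
have -> : (fun w => g w * X w - g w * e w) =
  (fun w => Num.max (g w) 0 * D w - Num.max (- g w) 0 * D w).
  apply/funext => w; rewrite -mulrBr -mulrBl -/(D w); congr (_ * _).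
  by rewrite /Num.max; do 2 case: ifPn; rewrite -?leNgt; lra.
by rewrite meanB// mp mn subrr.
Qed.

Lemma ge0_mean0_ae X : summ X -> (forall w, 0 <= X w) -> mean X <= 0 ->
  {ae P, forall w, X w = 0}.
Proof.
move=> sX X0 m0; have mX := summ_meas sX.
have i0 : (\int[P]_(w in setT) `|(X w)%:E| = 0)%E.
  have -> : (fun w => `|(X w)%:E|)%E = (fun w => (X w)%:E).
    by apply/funext => w; rewrite gee0_abs// lee_fin.
  rewrite mean_integral//; congr EFin; apply/eqP; rewrite eq_le m0/=.
  exact: mean_ge0.
have /measurable_EFinP mX' := mX.
have := (ae_eq_integral_abs P measurableT mX').1 i0.
by apply: filterS => w /= /(_ I) [].
Qed.

(** It suffices to test on the event where u is positive. *)
Lemma adapted_le0_ae G u : subalg G -> adapted G u -> summ u ->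
  (forall A, G A -> mean (fun w => \1_A w * u w) <= 0) ->
  {ae P, forall w, u w <= 0}.
Proof.
move=> sG au su u0.
pose A := u @^-1` `]0, +oo[.
have GA : G A by exact: (adapted_pre sG au).
have mA := sG.2 _ GA.
have H : {ae P, forall w, \1_A w * u w = 0}.
  apply: ge0_mean0_ae; [exact: summ_indic| |exact: u0].
  move=> w; rewrite indicE; case: (boolP (w \in A)) => [|_]; last by rewrite mul0r.
  by rewrite inE /A/= in_itv/= andbT mul1r => /ltW.
apply: filterS H => w; rewrite indicE; case: (boolP (w \in A)) => [_|].
  by rewrite mul1r => ->.
by rewrite notin_setE /A/= in_itv/= andbT => /negP; rewrite -leNgt.
Qed.

Lemma condexp_lin G (a : R) X Y e e' : subalg G ->
  condexp G X e -> condexp G Y e' ->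
  condexp G (fun w => X w + a * Y w) (fun w => e w + a * e' w).
Proof.
move=> sG [ae sX se eX] [ae' sY se' eY]; split.
- by apply: measurable_funD => //; exact: measurable_funM.
- by apply: summD => //; exact: summZ.
- by apply: summD => //; exact: summZ.
- move=> A GA; have mA := sG.2 _ GA.
  have E (Z1 Z2 : T -> R) : (fun w => \1_A w * (Z1 w + a * Z2 w)) =
      (fun w => \1_A w * Z1 w + a * (\1_A w * Z2 w)).
    by apply/funext => w; ring.
  rewrite !E !meanD ?meanZ ?eX ?eY//; try exact: summ_indic;
    by apply: summZ; exact: summ_indic.
Qed.

Lemma condexp0 G : subalg G -> condexp G (fun=> 0) (fun=> 0).
Proof.
move=> sG; have s0 : summ (fun=> 0) by exact: summ_cst.
by split => //; exact: measurable_cst.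
Qed.

Lemma condexp_sum G (I : Type) (s : seq I) (X e : I -> T -> R) : subalg G ->
  (forall i, condexp G (X i) (e i)) ->
  condexp G (fun w => \sum_(i <- s) X i w) (fun w => \sum_(i <- s) e i w).
Proof.
move=> sG Xe; elim: s => [|i s IH].
  rewrite (_ : (fun w => _) = (fun=> 0)); last first.
    by apply/funext => w; rewrite big_nil.
  rewrite [X in condexp _ _ X](_ : _ = (fun=> 0)); last first.
    by apply/funext => w; rewrite big_nil.
  exact: condexp0.
have E (Z : I -> T -> R) : (fun w => \sum_(j <- i :: s) Z j w) =
    (fun w => Z i w + 1 * \sum_(j <- s) Z j w).
  by apply/funext => w; rewrite big_cons mul1r.
by rewrite !E; exact: condexp_lin.
Qed.

Lemma condexp_indic G (A : set T) X e : subalg G -> G A -> condexp G X e ->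
  condexp G (fun w => \1_A w * X w) (fun w => \1_A w * e w).
Proof.
move=> sG GA [ae sX se eX]; have mA := sG.2 _ GA; split.
- by apply: measurable_funM => //; exact: adapted_indic.
- exact: summ_indic.
- exact: summ_indic.
- move=> B GB; have GAB : G (B `&` A).
    have := @measurableI _ (g_sigma_algebraType G) B A.
    by rewrite -[G in X in _ -> X](subalgE sG); apply; exact: sub_sigma_algebra.
  have E (Z : T -> R) : (fun w => \1_B w * (\1_A w * Z w)) =
                        (fun w => \1_(B `&` A) w * Z w).
    by apply/funext => w; rewrite mulrA indicI.
  by rewrite !E; exact: eX.
Qed.

Lemma glueE (d : nat) (s : T -> 'I_d) (X : 'I_d -> T -> R) :
  (fun w => X (s w) w) = (fun w => \sum_l \1_[set w | s w = l] w * X l w).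
Proof.
apply/funext => w; rewrite (bigD1 (s w))//= indicE mem_set// mul1r big1 ?addr0//.
by move=> l ls; rewrite indicE memNset ?mul0r// => /= sl; rewrite sl eqxx in ls.
Qed.

(** Conditional expectations may be glued along an index known at the time of
    the conditioning. *)
Lemma condexp_glue G (d : nat) (s : T -> 'I_d) (X e : 'I_d -> T -> R) :
  subalg G -> (forall l, G [set w | s w = l]) ->
  (forall l, condexp G (X l) (e l)) ->
  condexp G (fun w => X (s w) w) (fun w => e (s w) w).
Proof.
by move=> sG Gs Xe; rewrite !glueE; apply: condexp_sum => // l; exact: condexp_indic.
Qed.

End ConditionalExpectationTheory.

(** * Weights and Bessel's inequality *)

Section Weights.
Context (disp : measure_display) (T : measurableType disp) (R : realType)
  (P : probability T R).
Implicit Types (X Y e g : T -> R) (G : set_system T).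
Local Notation mean := (mean P).
Local Notation summ := (summ P).
Local Notation sqsumm := (sqsumm P).
Local Notation condexp := (condexp P).

(** Monotone convergence along an exhausting sequence of events, in a form that
    yields summability as well as the bound. *)
Lemma summ_exhaust (c : R) (A : nat -> set T) X :
  measurable_fun setT X -> (forall w, 0 <= X w) ->
  (forall k, measurable (A k)) -> (forall k l, (k <= l)%N -> A k `<=` A l) ->
  (forall w, exists k, A k w) ->
  (forall k, summ (fun w => \1_(A k) w * X w)) ->
  (forall k, mean (fun w => \1_(A k) w * X w) <= c) ->
  summ X /\ mean X <= c.
Proof.
move=> mX X0 mA ndA covA sA leA.
pose g k w := (\1_(A k) w * X w)%:E.
have mg k : measurable_fun setT (g k).
  by apply/measurable_EFinP; exact: summ_meas (sA k).
have g0 k w : setT w -> (0 <= g k w)%E by rewrite lee_fin mulr_ge0.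
have ndg w : setT w -> {homo g^~ w : k l / (k <= l)%N >-> (k <= l)%E}.
  move=> _ k l kl; rewrite lee_fin ler_wpM2r// !indicE ler_nat.
  case: (boolP (w \in A k)) => [|//]; rewrite inE => /(ndA _ _ kl) Al.
  by rewrite mem_set.
have limE : (fun w => limn (g^~ w)) = (fun w => (X w)%:E).
  apply/funext => w; have [k Ak] := covA w.
  apply: cvg_lim => //; apply: cvg_near_cst; exists k => // l /= kl.
  by rewrite /g indicE mem_set ?mul1r//; exact: ndA Ak.
have cv : (\int[P]_w g k w @[k --> \oo] --> \int[P]_w (X w)%:E)%E.
  by rewrite -limE; exact: cvg_monotone_convergence.
have le : (\int[P]_w (X w)%:E <= c%:E)%E.
  rewrite -(cvg_lim _ cv)//; apply: lime_le; first by apply/cvg_ex; eexists; exact: cv.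
  by apply: nearW => k; rewrite /g mean_integral// lee_fin.
have sX : summ X.
  apply/integrableP; split; first exact/measurable_EFinP.
  apply: (@le_lt_trans _ _ c%:E); last exact: ltry.
  by under eq_integral do rewrite gee0_abs ?lee_fin//.
by split => //; rewrite -lee_fin -mean_integral.
Qed.

Record is_weight (d : nat) G (v : R) (H : 'I_d -> T -> R) : Prop := IsWeight {
  weight_sq : forall a, sqsumm (H a);
  weight_centered : forall a, condexp G (H a) (fun=> 0);
  weight_cov : forall a b,
    condexp G (fun w => H a w * H b w) (fun=> v * (a == b)%:R)
}.

(** One backward step: e and z stand for E[X | G] and E[X H | G]. *)
Definition step_condexp (d : nat) G (H : 'I_d -> T -> R) X e
    (z : 'I_d -> T -> R) :=
  [/\ sqsumm X, condexp G X e &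
      forall a, condexp G (fun w => X w * H a w) (z a)].

Section Bessel.
Context (d : nat) (G : set_system T) (v : R) (H : 'I_d -> T -> R).
Hypotheses (sG : subalg G) (v0 : 0 < v) (wH : is_weight G v H).

(* Where e and z are bounded all products below are summable, and the claim is
   that X minus x + v^-1 u.H has a nonnegative second moment. *)
Let bessel_bdd (M : R) (A : set T) X e z : step_condexp G H X e z -> G A ->
  (forall w, A w -> `|e w| <= M) -> (forall w a, A w -> `|z a w| <= M) ->
  summ (fun w => \1_A w * (e w ^+ 2 + v^-1 * \sum_a z a w ^+ 2)) /\
  mean (fun w => \1_A w * (e w ^+ 2 + v^-1 * \sum_a z a w ^+ 2)) <=
  mean (fun w => X w ^+ 2).
Proof.
move=> [qX Xe Xz] GA eM zM; have mA := sG.2 _ GA.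
have [qH cH covH] := wH.
pose x w := \1_A w * e w; pose u a w := \1_A w * z a w.
have ax : adapted G x.
  by case: Xe => ae _ _ _; apply: measurable_funM => //; exact: adapted_indic.
have au a : adapted G (u a).
  by case: (Xz a) => ae _ _ _; apply: measurable_funM => //; exact: adapted_indic.
have mx := adapted_meas sG ax; have mu a := adapted_meas sG (au a).
have xM w : `|x w| <= `|M|.
  rewrite /x indicE; case: (boolP (w \in A)) => [|_].
    by rewrite inE mul1r => /eM/le_trans; apply; exact: ler_norm.
  by rewrite mul0r normr0.
have uM a w : `|u a w| <= `|M|.
  rewrite /u indicE; case: (boolP (w \in A)) => [|_].
    by rewrite inE mul1r => /zM/le_trans; apply; exact: ler_norm.
  by rewrite mul0r normr0.
have axx : adapted G (fun w => x w * x w) by exact: measurable_funM.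
have auu a b : adapted G (fun w => u a w * u b w).
  exact: (measurable_funM (au a) (au b)).
have axu a : adapted G (fun w => x w * u a w).
  exact: (measurable_funM ax (au a)).
have bM (f g : T -> R) : (forall w, `|f w| <= `|M|) -> (forall w, `|g w| <= `|M|) ->
    forall w, `|f w * g w| <= `|M| * `|M|.
  by move=> fM gM w; rewrite normrM ler_pM.
have sX := sqsumm_summ qX.
have mxu a := adapted_meas sG (axu a).
have muu a b := adapted_meas sG (auu a b).
have pX : mean (fun w => x w * X w) = mean (fun w => x w * x w).
  have se : summ e by case: Xe.
  rewrite -(condexp_pull sG Xe ax); [|exact: (summ_bddM mx xM)..].
  congr mean; apply/funext => w; rewrite /x indicE.
  by case: (_ \in _); rewrite ?mul1r ?mul0r.
have pXH a : mean (fun w => u a w * (X w * H a w)) =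
             mean (fun w => u a w * u a w).
  have [_ s1 s2 _] := Xz a.
  rewrite -(condexp_pull sG (Xz a) (au a)); [|exact: (summ_bddM (mu a) (uM a))..].
  congr mean; apply/funext => w; rewrite /u indicE.
  by case: (_ \in _); rewrite ?mul1r ?mul0r.
have pH a : mean (fun w => (x w * u a w) * H a w) = 0.
  have [_ s1 s2 _] := cH a.
  rewrite -(condexp_pull sG (cH a) (axu a)).
  - under [X in mean X]eq_fun do rewrite mulr0; exact: mean_cst.
  - exact: (summ_bddM (mxu a) (bM _ _ xM (uM a))).
  - exact: (summ_bddM (mxu a) (bM _ _ xM (uM a))).
have pHH a b : mean (fun w => (u a w * u b w) * (H a w * H b w)) =
    v * (a == b)%:R * mean (fun w => u a w * u b w).
  have [_ s1 s2 _] := covH a b.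
  rewrite -(condexp_pull sG (covH a b) (auu a b)).
  - rewrite -meanZ.
      by congr mean; apply/funext => w; rewrite mulrC.
    rewrite (_ : (fun w => _) = (fun w => (u a w * u b w) * 1)); last first.
      by apply/funext => w; rewrite mulr1.
    by apply: (summ_bddM (muu a b) (bM _ _ (uM a) (uM b))); exact: summ_cst.
  - exact: (summ_bddM (muu a b) (bM _ _ (uM a) (uM b))).
  - exact: (summ_bddM (muu a b) (bM _ _ (uM a) (uM b))).
have s1 (f : T -> R) : measurable_fun setT f -> (forall w, `|f w| <= `|M|) ->
    summ (fun w => f w * f w).
  move=> mf fM; rewrite (_ : (fun w => _) = (fun w => (f w * f w) * 1)); last first.
    by apply/funext => w; rewrite mulr1.
  apply: (summ_bddM _ (bM _ _ fM fM)); last exact: summ_cst.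
  exact: measurable_funM.
have sxX : summ (fun w => x w * X w) by exact: (summ_bddM mx xM).
have suXH a : summ (fun w => u a w * (X w * H a w)).
  by have [_ ? _ _] := Xz a; exact: (summ_bddM (mu a) (uM a)).
have sxuH a : summ (fun w => (x w * u a w) * H a w).
  by have [_ ? _ _] := cH a; exact: (summ_bddM (mxu a) (bM _ _ xM (uM a))).
have suuHH a b : summ (fun w => (u a w * u b w) * (H a w * H b w)).
  by have [_ ? _ _] := covH a b; exact: (summ_bddM (muu a b) (bM _ _ (uM a) (uM b))).
have E1 : (fun w => \1_A w * (e w ^+ 2 + v^-1 * \sum_a z a w ^+ 2)) =
    (fun w => x w * x w + v^-1 * \sum_a u a w * u a w).
  apply/funext => w; rewrite mulrDr (mulrCA _ v^-1); congr (_ + _ * _).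
    by rewrite /x indicE; case: (_ \in _) => /=; ring.
  rewrite mulr_sumr; apply: eq_bigr => a _.
  by rewrite /u indicE; case: (_ \in _) => /=; ring.
have sxx := s1 _ mx xM; have suu a := s1 _ (mu a) (uM a).
have sW : summ (fun w => x w * x w + v^-1 * \sum_a u a w * u a w).
  by apply: summD => //; apply: summZ; exact: summ_sum.
rewrite E1; split => //.
pose Q w := x w * X w + v^-1 * \sum_a u a w * (X w * H a w).
pose S w := x w * x w + ((2 * v^-1) * (\sum_a (x w * u a w) * H a w) +
  v^-1 ^+ 2 * \sum_a \sum_b (u a w * u b w) * (H a w * H b w)).
have sQ : summ Q by apply: summD => //; apply: summZ; exact: summ_sum.
have sS : summ S.
  apply: summD => //; apply: summD; apply: summZ; apply: summ_sum => a _ //.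
  by apply: summ_sum => b _.
have mQ : mean Q = mean (fun w => x w * x w) + v^-1 * \sum_a mean (fun w => u a w * u a w).
  have sum1 : summ (fun w => \sum_a u a w * (X w * H a w)) by exact: summ_sum.
  rewrite meanD//; last exact: summZ.
  rewrite pX meanZ// mean_sum//; congr (_ + _ * _).
  by apply: eq_bigr => a _; exact: pXH.
have mS : mean S = mean (fun w => x w * x w) + v^-1 * \sum_a mean (fun w => u a w * u a w).
  have sum1 : summ (fun w => \sum_a (x w * u a w) * H a w) by exact: summ_sum.
  have sum2 : summ (fun w => \sum_a \sum_b (u a w * u b w) * (H a w * H b w)).
    by apply: summ_sum => a _; exact: summ_sum.
  rewrite meanD//; last by apply: summD; exact: summZ.
  congr (_ + _); rewrite meanD; [|exact: summZ..].
  rewrite !meanZ// !mean_sum//; last by move=> a _; exact: summ_sum.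
  rewrite big1 ?mulr0 ?add0r; last by move=> a _; rewrite pH.
  under eq_bigr => a _.
    rewrite mean_sum// (bigD1 a)//= pHH eqxx mulr1 big1 ?addr0; last first.
      by move=> b ba; rewrite pHH eq_sym (negbTE ba) mulr0 mul0r.
    over.
  by rewrite -mulr_sumr mulrA; congr (_ * _); field; rewrite gt_eqF.
have mW : mean (fun w => x w * x w + v^-1 * \sum_a u a w * u a w) =
   mean (fun w => x w * x w) + v^-1 * \sum_a mean (fun w => u a w * u a w).
  have sum1 : summ (fun w => \sum_a u a w * u a w) by exact: summ_sum.
  by rewrite meanD//; [rewrite meanZ// mean_sum|exact: summZ].
rewrite mW; set W := (X in X <= _).
have : 0 <= mean (fun w => X w ^+ 2 - (2 * Q w - S w)).
  apply: mean_ge0 => w.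
  rewrite (_ : _ - _ = (X w - (x w + v^-1 * \sum_a u a w * H a w)) ^+ 2) ?sqr_ge0//.
  rewrite /Q /S.
  have -> : \sum_a u a w * (X w * H a w) = X w * \sum_a u a w * H a w.
    by rewrite mulr_sumr; apply: eq_bigr => a _; ring.
  have -> : \sum_a x w * u a w * H a w = x w * \sum_a u a w * H a w.
    by rewrite mulr_sumr; apply: eq_bigr => a _; ring.
  have -> : \sum_a \sum_b u a w * u b w * (H a w * H b w) =
            (\sum_a u a w * H a w) * (\sum_a u a w * H a w).
    rewrite mulr_suml; apply: eq_bigr => a _; rewrite mulr_sumr.
    by apply: eq_bigr => b _; ring.
  ring.
have sX2 := sqsumm_sqr qX.
rewrite meanB//; last by apply: summB => //; exact: summZ.
rewrite meanB ?meanZ//; last exact: summZ.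
by rewrite mQ mS -/W; lra.
Qed.

(** Since 1 and the entries of H are conditionally orthogonal, e + v^-1 z.H is the
    orthogonal projection of X on their adapted combinations, so its second moment
    is at most that of X. At first e and z are only known to be summable; they are
    truncated on the events A k, and the bound survives the exhaustion. *)
Lemma bessel X e z : step_condexp G H X e z ->
  [/\ sqsumm e, forall a, sqsumm (z a) &
      mean (fun w => e w ^+ 2) + v^-1 * mean (fun w => \sum_a z a w ^+ 2) <=
      mean (fun w => X w ^+ 2)].
Proof.
move=> sXez; have [qX Xe Xz] := sXez.
pose W w := e w ^+ 2 + v^-1 * \sum_a z a w ^+ 2.
have ae : adapted G e by case: Xe.
have az a : adapted G (z a) by case: (Xz a).
have aW : adapted G W.
  apply: measurable_funD; first exact: (measurable_funX 2 ae).
  apply: measurable_funM => //; apply: measurable_sum => a.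
  exact: (measurable_funX 2 (az a)).
pose N w := `|e w| + \sum_a `|z a w|.
have aN : adapted G N.
  apply: measurable_funD; first exact: measurableT_comp.
  by apply: measurable_sum => a; exact: (measurableT_comp _ (az a)).
pose A k := N @^-1` `]-oo, k%:R].
have GA k : G (A k) by exact: (adapted_pre sG aN).
have N0 w : 0 <= \sum_a `|z a w| by exact: sumr_ge0.
have Ae k w : A k w -> `|e w| <= k%:R.
  by rewrite /A/= in_itv/= /N; have := N0 w; lra.
have Az k w a : A k w -> `|z a w| <= k%:R.
  rewrite /A/= in_itv/= /N; apply: le_trans; rewrite (bigD1 a)//=.
  have : 0 <= \sum_(i < d | i != a) `|z i w| by exact: sumr_ge0.
  by have := normr_ge0 (e w); lra.
have W0 w : 0 <= W w.
  rewrite addr_ge0 ?sqr_ge0// mulr_ge0 ?invr_ge0 ?(ltW v0)//.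
  by apply: sumr_ge0 => a _; exact: sqr_ge0.
have [|||||sW leW] := @summ_exhaust (mean (fun w => X w ^+ 2)) A W
   (adapted_meas sG aW) W0.
- by move=> k; exact: sG.2.
- by move=> k l kl w; rewrite /A/= !in_itv/= => /le_trans; apply; rewrite ler_nat.
- move=> w; exists (Num.bound (N w)); rewrite /A/= in_itv/=.
  by apply/ltW/archi_boundP; rewrite addr_ge0.
- by move=> k; have [] := bessel_bdd sXez (GA k) (@Ae k) (@Az k).
- by move=> k; have [] := bessel_bdd sXez (GA k) (@Ae k) (@Az k).
have z2W w : v^-1 * \sum_a z a w ^+ 2 <= W w by rewrite lerDr sqr_ge0.
have vi : 0 < v^-1 by rewrite invr_gt0.
have qe : sqsumm e.
  split; first exact: adapted_meas ae.
  apply: (summ_dom _ sW); first exact: (measurable_funX 2 (adapted_meas sG ae)).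
  move=> w; rewrite ger0_norm ?sqr_ge0// lerDl mulr_ge0 ?(ltW vi)//.
  by apply: sumr_ge0 => a _; exact: sqr_ge0.
have qz a : sqsumm (z a).
  split; first exact: adapted_meas (az a).
  apply: (summ_dom _ (summZ v sW)).
    exact: (measurable_funX 2 (adapted_meas sG (az a))).
  move=> w; rewrite ger0_norm ?sqr_ge0// -ler_pdivrMl//.
  apply: le_trans (z2W w); rewrite ler_wpM2l ?(ltW vi)// (bigD1 a)//= lerDl.
  by apply: sumr_ge0 => b _; exact: sqr_ge0.
split => //; rewrite -meanZ; last first.
  by apply: summ_sum => a _; exact: sqsumm_sqr.
rewrite -meanD//; first by case: qe.
by apply: summZ; apply: summ_sum => a _; exact: sqsumm_sqr.
Qed.

End Bessel.
End Weights.

(** * The Euclidean norm of finite families *)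

Section EuclideanNorm.
Context (R : realType) (d : nat).
Implicit Types x y : 'I_d -> R.

Definition nrm x : R := Num.sqrt (\sum_a x a ^+ 2).

Lemma nrm_ge0 x : 0 <= nrm x.
Proof. exact: sqrtr_ge0. Qed.

Lemma nrm_sqr x : nrm x ^+ 2 = \sum_a x a ^+ 2.
Proof. by rewrite sqr_sqrtr// sumr_ge0// => a _; exact: sqr_ge0. Qed.

Lemma nrm_cs x y : \sum_a x a * y a <= nrm x * nrm y.
Proof.
have [x0|x0] := eqVneq (nrm x) 0.
  rewrite x0 mul0r big1// => a _.
  have /eqP : \sum_a x a ^+ 2 = 0 by rewrite -nrm_sqr x0 expr0n.
  rewrite psumr_eq0 => [/allP/(_ a (mem_index_enum _))|b _]; last exact: sqr_ge0.
  by rewrite sqrf_eq0 => /eqP ->; rewrite mul0r.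
have [y0|y0] := eqVneq (nrm y) 0.
  rewrite y0 mulr0 big1// => a _.
  have /eqP : \sum_a y a ^+ 2 = 0 by rewrite -nrm_sqr y0 expr0n.
  rewrite psumr_eq0 => [/allP/(_ a (mem_index_enum _))|b _]; last exact: sqr_ge0.
  by rewrite sqrf_eq0 => /eqP ->; rewrite mulr0.
have xp : 0 < nrm x by rewrite lt0r x0 nrm_ge0.
have yp : 0 < nrm y by rewrite lt0r y0 nrm_ge0.
have key a : x a * y a <= (nrm y / nrm x * x a ^+ 2 + nrm x / nrm y * y a ^+ 2) / 2.
  rewrite -subr_ge0.
  rewrite (_ : _ - _ = (nrm y * x a - nrm x * y a) ^+ 2 / (2 * nrm x * nrm y)).
    by rewrite divr_ge0 ?sqr_ge0// !mulr_ge0// ltW.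
  by field; rewrite x0 y0.
apply: le_trans (ler_sum _ (fun a _ => key a)) _.
rewrite -mulr_suml big_split/= -!mulr_sumr -!nrm_sqr.
rewrite le_eqVlt; apply/orP; left; apply/eqP; field.
by rewrite x0 y0.
Qed.

Lemma nrm_triangle x y : nrm (fun a => x a + y a) <= nrm x + nrm y.
Proof.
rewrite -(@ler_pXn2r _ 2)// ?nnegrE ?addr_ge0 ?nrm_ge0//.
rewrite sqrrD !nrm_sqr (_ : \sum_a (x a + y a) ^+ 2 =
  \sum_a x a ^+ 2 + (\sum_a x a * y a) *+ 2 + \sum_a y a ^+ 2).
  by rewrite lerD2r lerD2l ler_pMn2r// nrm_cs.
by rewrite -sumrMnl -!big_split/=; apply: eq_bigr => a _; rewrite sqrrD.
Qed.

Lemma nrmZ (k : R) x : 0 <= k -> nrm (fun a => x a * k) = nrm x * k.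
Proof.
move=> k0; rewrite /nrm; under eq_bigr do rewrite exprMn.
rewrite -mulr_suml sqrtrM; last by apply: sumr_ge0 => a _; exact: sqr_ge0.
by rewrite sqrtr_sqr ger0_norm.
Qed.

End EuclideanNorm.

(** * One backward step *)

Section Step.
Context (disp : measure_display) (T : measurableType disp) (R : realType)
  (P : probability T R).
Implicit Types (X Y e g : T -> R) (G : set_system T).
Local Notation mean := (mean P).
Local Notation summ := (summ P).
Local Notation sqsumm := (sqsumm P).
Local Notation condexp := (condexp P).
Local Notation step_condexp := (step_condexp P).

Lemma measurable_nrm (disp' : measure_display) (U : measurableType disp')
    (d : nat) (z : 'I_d -> U -> R) :
  (forall a, measurable_fun setT (z a)) ->
  measurable_fun setT (fun w => nrm (fun a => z a w)).
Proof.
move=> mz.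
have ms : measurable_fun [set: R] (@Num.sqrt R).
  by apply: continuous_measurable_fun; exact: sqrt_continuous.
apply: (measurableT_comp ms); apply: measurable_sum => a.
exact: (measurable_funX 2 (mz a)).
Qed.

Lemma adapted_nrm G (d : nat) (z : 'I_d -> T -> R) :
  (forall a, adapted G (z a)) -> adapted G (fun w => nrm (fun a => z a w)).
Proof. exact: (@measurable_nrm _ (g_sigma_algebraType G)). Qed.

Lemma sqsumm_nrm (d : nat) (z : 'I_d -> T -> R) :
  (forall a, sqsumm (z a)) -> sqsumm (fun w => nrm (fun a => z a w)).
Proof.
move=> qz; split.
  by apply: measurable_nrm => a; case: (qz a).
rewrite (_ : (fun w => _) = (fun w => \sum_a z a w ^+ 2)).
  by apply: summ_sum => a _; exact: sqsumm_sqr.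
by apply/funext => w; rewrite nrm_sqr.
Qed.

Section OneStep.
Context (d : nat) (G : set_system T) (H : 'I_d -> T -> R).
Context (h lam Lam LZ : R).
Hypotheses (sG : subalg G) (h0 : 0 < h) (lam0 : 0 < lam) (lamL : lam <= Lam).
Hypotheses (LZ0 : 0 <= LZ) (wH : is_weight P G (lam / h) H).

Lemma step_lin (k : R) X Y e e' z z' : step_condexp G H X e z ->
  step_condexp G H Y e' z' ->
  step_condexp G H (fun w => X w + k * Y w) (fun w => e w + k * e' w)
    (fun a w => z a w + k * z' a w).
Proof.
move=> [qX Xe Xz] [qY Ye Yz]; split.
- by apply: sqsummD => //; exact: sqsummZ.
- exact: condexp_lin.
- move=> a; rewrite (_ : (fun w => _) = (fun w => X w * H a w + k * (Y w * H a w))).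
    exact: condexp_lin.
  by apply/funext => w; ring.
Qed.

Lemma step_sub X Y e e' z z' : step_condexp G H X e z ->
  step_condexp G H Y e' z' ->
  step_condexp G H (fun w => X w - Y w) (fun w => e w - e' w)
    (fun a w => z a w - z' a w).
Proof.
have E (x y : T -> R) : (fun w => x w - y w) = (fun w => x w + (- 1) * y w).
  by apply/funext => w; rewrite mulN1r.
have E' : (fun a w => z a w - z' a w) = (fun a w => z a w + (- 1) * z' a w).
  by apply/funext => a; exact: E.
by rewrite !E E'; exact: step_lin.
Qed.

Lemma step_exists X : sqsumm X -> exists e z, step_condexp G H X e z.
Proof.
move=> qX; have [e Xe] := condexp_exists sG (sqsumm_summ qX).
have /choice[z Xz] a : exists z, condexp G (fun w => X w * H a w) z.
  apply: condexp_exists => //; apply: sqsummM => //; exact: (weight_sq wH).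
by exists e, z.
Qed.

Lemma sqsumm_glue (s : T -> 'I_d) (X : 'I_d -> T -> R) :
  (forall l, measurable [set w | s w = l]) -> (forall l, sqsumm (X l)) ->
  sqsumm (fun w => X (s w) w).
Proof.
move=> ms qX.
rewrite glueE; apply: sqsumm_sum => l _.
have mX := sqsumm_meas (qX l).
apply: (sqsumm_dom _ (sqsumm_norm (qX l))); first exact: measurable_funM.
move=> w; rewrite normrM ger0_norm// ler_piMl// indicE.
Qed.

Lemma step_glue (s : T -> 'I_d) (X e : 'I_d -> T -> R) z :
  (forall l, G [set w | s w = l]) ->
  (forall l, step_condexp G H (X l) (e l) (z l)) ->
  step_condexp G H (fun w => X (s w) w) (fun w => e (s w) w)
    (fun a w => z (s w) a w).
Proof.
move=> Gs Xez; split.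
- by apply: sqsumm_glue => l; [exact/sG.2|case: (Xez l)].
- by apply: (condexp_glue (X := X)) => // l; case: (Xez l).
- move=> a; apply: (condexp_glue (X := fun l w => X l w * H a w) (e := fun l => z l a)) => // l.
  by case: (Xez l).
Qed.

Lemma step_sq X e z : step_condexp G H X e z ->
  sqsumm e /\ forall a, sqsumm (z a).
Proof.
have v0 : 0 < lam / h by rewrite divr_gt0.
by move=> Xez; have [] := bessel sG v0 wH Xez.
Qed.

Lemma step_pull X e z g : step_condexp G H X e z -> adapted G g -> sqsumm g ->
  mean (fun w => g w * e w) = mean (fun w => g w * X w).
Proof.
move=> Xez ag qg; have [qe _] := step_sq Xez; have [qX Xe _] := Xez.
by apply: condexp_pull Xe _ _ _ => //; exact: sqsummM.
Qed.

(** The positivity behind every comparison: testing against 1_A z/|z| gives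
    E[1_A |z|] = E[1_A X (z/|z|).H], where h LZ |H| <= 1 and X >= 0, so that
    h LZ E[1_A |z|] <= E[1_A X] for every event A of G. *)
Lemma step_ge0 X e z : {ae P, forall w, h * nrm (fun a => H a w) * LZ <= 1} ->
  {ae P, forall w, 0 <= X w} -> step_condexp G H X e z ->
  {ae P, forall w, h * LZ * nrm (fun a => z a w) <= e w}.
Proof.
move=> hH X0 Xez; have [qe qz] := step_sq Xez; have [qX Xe Xz] := Xez.
have ae : adapted G e by case: Xe.
have az a : adapted G (z a) by case: (Xz a).
pose n w := nrm (fun a => z a w).
have an : adapted G n by exact: adapted_nrm.
have qn : sqsumm n by exact: sqsumm_nrm.
have n0 w : 0 <= n w by exact: nrm_ge0.
(* The inverse of n, and 0 where n vanishes; as a power it is measurable. *)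
pose ni w := n w `^ (- 1).
have ani : adapted G ni.
  exact: (measurableT_comp (measurable_powR (R:=R) (- 1)) an).
have niE w : ni w = (n w)^-1 by rewrite /ni powR_inv1.
suff : {ae P, forall w, h * LZ * n w - e w <= 0}.
  by apply: filterS => w; rewrite subr_le0.
have hn : summ (fun w => h * LZ * n w) by apply: summZ; exact: sqsumm_summ.
apply: (adapted_le0_ae sG).
- by apply: measurable_funB => //; exact: measurable_funM.
- by apply: summB => //; exact: sqsumm_summ.
move=> A GA; have mA := sG.2 _ GA.
pose u a w := \1_A w * (z a w * ni w).
have au a : adapted G (u a).
  apply: measurable_funM; first exact: adapted_indic.
  exact: (measurable_funM (az a) ani).
have u1 a w : `|u a w| <= 1.
  rewrite /u normrM -[leRHS]mulr1 ler_pM//.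
    by rewrite ger0_norm// indicE; case: (_ \in _).
  rewrite normrM niE normfV (ger0_norm (n0 w)).
  have [->|nz] := eqVneq (n w) 0; first by rewrite invr0 mulr0.
  rewrite ler_pdivrMr ?lt0r ?nz ?n0// mul1r.
  rewrite -(@ler_pXn2r _ 2)// ?nnegrE// nrm_sqr real_normK ?num_real//.
  by rewrite (bigD1 a)//= lerDl; apply: sumr_ge0 => b _; exact: sqr_ge0.
have mu a := adapted_meas sG (au a).
have nE w : \sum_a z a w * ni w * z a w = n w.
  rewrite (eq_bigr (fun a => ni w * z a w ^+ 2)); last by move=> a _; ring.
  rewrite -mulr_sumr -nrm_sqr -/(n w) niE.
  have [->|nz] := eqVneq (n w) 0; first by rewrite expr0n mulr0.
  by rewrite expr2 mulrA mulVf ?mul1r.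
have sz a : summ (z a) by exact: sqsumm_summ.
have suz a : summ (fun w => u a w * z a w) by exact: (summ_bddM (mu a) (u1 a)).
have sXH a : summ (fun w => X w * H a w) by case: (Xz a).
have suX a : summ (fun w => u a w * (X w * H a w)).
  exact: (summ_bddM (mu a) (u1 a)).
have pz a : mean (fun w => u a w * z a w) = mean (fun w => u a w * (X w * H a w)).
  exact: condexp_pull (Xz a) _ _ _.
have E1 : (fun w => \1_A w * (h * LZ * n w - e w)) =
    (fun w => h * LZ * (\sum_a u a w * z a w) - \1_A w * e w).
  apply/funext => w; rewrite mulrBr; congr (_ - _).
  rewrite mulrCA; congr (_ * _); rewrite -[in LHS]nE mulr_sumr.
  by apply: eq_bigr => a _; rewrite /u; ring.
have s1 : summ (fun w => \sum_a u a w * z a w) by exact: summ_sum.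
have s2 : summ (fun w => \sum_a u a w * (X w * H a w)) by exact: summ_sum.
have se : summ e by exact: sqsumm_summ.
have sX : summ X by exact: sqsumm_summ.
rewrite E1 meanB; [|exact: summZ|exact: summ_indic].
rewrite meanZ// mean_sum//; under eq_bigr do rewrite pz.
rewrite -mean_sum// -meanZ//; case: Xe => _ _ _ -> //.
rewrite subr_le0; apply: ler_mean; [exact: summZ|exact: summ_indic|].
apply: filterS2 hH X0 => w hHw X0w.
rewrite (_ : \sum_a u a w * (X w * H a w) =
   \1_A w * X w * \sum_a (z a w * ni w) * H a w); last first.
  by rewrite mulr_sumr; apply: eq_bigr => a _; rewrite /u; ring.
rewrite mulrCA ler_piMr ?mulr_ge0//.
have := nrm_cs (fun a => z a w * ni w) (fun a => H a w).
have -> : nrm (fun a => z a w * ni w) = n w * ni w.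
  by rewrite nrmZ ?powR_ge0.
have nn1 : n w * ni w <= 1.
  rewrite niE; have [->|nz] := eqVneq (n w) 0; first by rewrite mul0r.
  by rewrite mulfV.
have H0 := nrm_ge0 (fun a => H a w).
move=> cs; apply: le_trans (hHw).
rewrite mulrAC ler_wpM2r// ler_wpM2l ?(ltW h0)//.
by apply: le_trans cs _; rewrite ler_piMl.
Qed.

(** The rate of growth per unit of time, large enough for Young's inequality to
    charge only half of the |z|^2 given by Bessel's inequality to the Lipschitz
    drift. *)
Definition mu_cst := 4 * LZ ^+ 2 * Lam + 1.

Lemma mu_cst_ge1 : 1 <= mu_cst.
Proof.
by rewrite /mu_cst lerDr mulr_ge0 ?mulr_ge0 ?sqr_ge0// (le_trans (ltW lam0)).
Qed.

(** Young's inequality (a + h b)^2 <= (1 + mu h) (a^2 + h b^2 / mu). *)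
Lemma energy_pointwise (e n f : R) : 0 <= n -> 0 <= f ->
  (`|e| + h * (LZ * n + f)) ^+ 2 <=
  (1 + mu_cst * h) * (e ^+ 2 + (h / (2 * Lam) * n ^+ 2 + 2 * h * f ^+ 2)).
Proof.
move=> n0 f0; have m1 := mu_cst_ge1; have m0 : 0 < mu_cst by lra.
have L0 : 0 < Lam by exact: lt_le_trans lamL.
have -> : e ^+ 2 = `|e| ^+ 2 by rewrite real_normK ?num_real.
set a := `|e|; set b := LZ * n + f.
apply: (@le_trans _ _ ((1 + mu_cst * h) * (a ^+ 2 + h / mu_cst * b ^+ 2))).
  rewrite -subr_ge0.
  rewrite (_ : _ - _ = h / mu_cst * (mu_cst * a - b) ^+ 2).
    by rewrite mulr_ge0 ?sqr_ge0// divr_ge0// ltW.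
  by field; rewrite gt_eqF.
apply: ler_wpM2l; first by rewrite addr_ge0// mulr_ge0// ltW.
rewrite lerD2l.
have b2 : b ^+ 2 <= 2 * (LZ ^+ 2 * n ^+ 2 + f ^+ 2).
  by rewrite /b -subr_ge0 (_ : _ - _ = (LZ * n - f) ^+ 2) ?sqr_ge0//; ring.
apply: (@le_trans _ _ (h / mu_cst * (2 * (LZ ^+ 2 * n ^+ 2 + f ^+ 2)))).
  by rewrite ler_wpM2l// divr_ge0// ltW.
rewrite -subr_ge0.
rewrite (_ : _ - _ = h / (2 * Lam * mu_cst) * n ^+ 2 +
  2 * h * f ^+ 2 * (mu_cst - 1) / mu_cst).
  have h0' := ltW h0; have L0' := ltW L0; have m0' := ltW m0.
  apply: addr_ge0; first by rewrite mulr_ge0 ?sqr_ge0// divr_ge0 ?mulr_ge0.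
  by rewrite divr_ge0// mulr_ge0 ?subr_ge0// mulr_ge0 ?sqr_ge0// mulr_ge0.
have E : mu_cst = 4 * LZ ^+ 2 * Lam + 1 by [].
apply: (@mulIf _ (2 * Lam * mu_cst)); first by rewrite !mulf_neq0// gt_eqF.
have -> : (h / (2 * Lam) * n ^+ 2 + 2 * h * f ^+ 2 -
    h / mu_cst * (2 * (LZ ^+ 2 * n ^+ 2 + f ^+ 2))) * (2 * Lam * mu_cst) =
   h * n ^+ 2 * mu_cst + 2 * h * f ^+ 2 * (2 * Lam * mu_cst) -
   h * 2 * (LZ ^+ 2 * n ^+ 2 + f ^+ 2) * (2 * Lam).
  by field; rewrite !gt_eqF.
have -> : (h / (2 * Lam * mu_cst) * n ^+ 2 +
    2 * h * f ^+ 2 * (mu_cst - 1) / mu_cst) * (2 * Lam * mu_cst) =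
  h * n ^+ 2 + 2 * h * f ^+ 2 * (mu_cst - 1) * (2 * Lam).
  by field; rewrite !gt_eqF.
by rewrite E; ring.
Qed.

(** Of the quantity (h / Lam) E|z|^2 controlled by Bessel's inequality, one half
    pays for the drift and the other half stays on the left-hand side. *)
Lemma one_step X e z f : step_condexp G H X e z -> sqsumm f ->
  (forall w, 0 <= f w) ->
  mean (fun w => (`|e w| + h * (LZ * nrm (fun a => z a w) + f w)) ^+ 2)
    + h / (2 * Lam) * mean (fun w => nrm (fun a => z a w) ^+ 2) <=
  (1 + mu_cst * h) * (mean (fun w => X w ^+ 2)
                      + 2 * h * mean (fun w => f w ^+ 2)).
Proof.
move=> Xez qf f0; have v0 : 0 < lam / h by rewrite divr_gt0.
have L0 : 0 < Lam by exact: lt_le_trans lamL.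
have [qe qz B] := bessel sG v0 wH Xez; have [qX _ _] := Xez.
have qn := sqsumm_nrm qz.
have m1 := mu_cst_ge1.
pose n w := nrm (fun a => z a w).
have sx : sqsumm (fun w => `|e w| + h * (LZ * n w + f w)).
  apply: sqsummD; first exact: sqsumm_norm.
  by apply: sqsummZ; apply: sqsummD => //; exact: sqsummZ.
have se2 := sqsumm_sqr qe; have sn2 := sqsumm_sqr qn.
have sf2 := sqsumm_sqr qf.
have le1 : mean (fun w => (`|e w| + h * (LZ * n w + f w)) ^+ 2) <=
   (1 + mu_cst * h) * (mean (fun w => e w ^+ 2) +
     (h / (2 * Lam) * mean (fun w => n w ^+ 2) + 2 * h * mean (fun w => f w ^+ 2))).
  have s1 : summ (fun w => h / (2 * Lam) * n w ^+ 2) by exact: summZ.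
  have s2 : summ (fun w => 2 * h * f w ^+ 2) by exact: summZ.
  have s3 := summD s1 s2.
  rewrite -!meanZ// -!meanD// -meanZ; last exact: summD.
  apply: ler_mean; first exact: sqsumm_sqr.
    by apply: summZ; exact: summD.
  by apply: aeW => w; apply: energy_pointwise => //; exact: nrm_ge0.
have B' : mean (fun w => e w ^+ 2) + h / Lam * mean (fun w => n w ^+ 2) <=
    mean (fun w => X w ^+ 2).
  apply: le_trans B; rewrite lerD2l.
  rewrite (_ : (fun w => \sum_a _) = (fun w => n w ^+ 2)); last first.
    by apply/funext => w; rewrite nrm_sqr.
  rewrite invf_div; apply: ler_wpM2r.
    by apply: mean_ge0 => w; exact: sqr_ge0.
  by rewrite ler_wpM2l ?(ltW h0)// lef_pV2.
have n2 : 0 <= mean (fun w => n w ^+ 2) by apply: mean_ge0 => w; exact: sqr_ge0.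
set En := mean (fun w => n w ^+ 2) in le1 B' n2 *.
have hm : 0 <= mu_cst * h by rewrite mulr_ge0 ?(ltW h0)//; lra.
have hL : h / Lam = 2 * (h / (2 * Lam)) by field; rewrite gt_eqF.
have hL0 : 0 <= h / (2 * Lam) * En.
  by rewrite mulr_ge0// divr_ge0 ?mulr_ge0 ?(ltW h0) ?(ltW L0).
rewrite hL -mulrA in B'.
set q := h / (2 * Lam) * En in le1 B' hL0 *.
set Ee := mean (fun w => e w ^+ 2) in le1 B'.
set Ef := mean (fun w => f w ^+ 2) in le1 *.
set EX := mean (fun w => X w ^+ 2) in B' *.
have : (1 + mu_cst * h) * (Ee + (q + 2 * h * Ef)) + q <=
       (1 + mu_cst * h) * (EX + 2 * h * Ef).
  apply: (@le_trans _ _ ((1 + mu_cst * h) * (Ee + 2 * q + 2 * h * Ef))).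
    rewrite -subr_ge0 (_ : _ - _ = mu_cst * h * q); last by ring.
    exact: mulr_ge0.
  by apply: ler_wpM2l; [lra | lra].
lra.
Qed.

End OneStep.
End Step.

(** * Discrete Gronwall inequality and sums of squares *)

Section Gronwall.
Context (R : realType).

(** The v m are the dissipated terms; they survive on the left-hand side with
    constant 1 because every factor 1 + a m is at least 1. *)
Lemma discrete_gronwall (k n : nat) (a u v f : nat -> R) : (k <= n)%N ->
  (forall m, (k <= m < n)%N -> [/\ 0 <= a m, 0 <= v m, 0 <= f m &
     u m + v m <= (1 + a m) * (u m.+1 + f m)]) ->
  0 <= u n ->
  u k + \sum_(k <= m < n) v m <=
  expR (\sum_(k <= m < n) a m) * (u n + \sum_(k <= m < n) f m).
Proof.
move=> kn; elim: {k}(n - k)%N {-2}k (erefl (n - k)%N) kn => [|N IH] k nk kn rec un.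
  have -> : k = n by apply/eqP; rewrite eqn_leq kn -subn_eq0 nk.
  by rewrite !big_geq// !addr0 expR0 mul1r.
have kn' : (k < n)%N by rewrite -subn_gt0 nk.
rewrite !(big_ltn kn').
have [a0 v0 f0 uv] : [/\ 0 <= a k, 0 <= v k, 0 <= f k &
     u k + v k <= (1 + a k) * (u k.+1 + f k)] by apply: rec; rewrite leqnn.
have rec' m : (k.+1 <= m < n)%N -> [/\ 0 <= a m, 0 <= v m, 0 <= f m &
     u m + v m <= (1 + a m) * (u m.+1 + f m)].
  by move=> /andP[/ltnW km mn]; apply: rec; rewrite km.
have Hk : u k.+1 + \sum_(k.+1 <= m < n) v m <=
  expR (\sum_(k.+1 <= m < n) a m) * (u n + \sum_(k.+1 <= m < n) f m).
  by apply: IH => //; rewrite subnS nk.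
have nn (w : nat -> R) : (forall m, (k.+1 <= m < n)%N -> 0 <= w m) ->
    0 <= \sum_(k.+1 <= m < n) w m.
  by move=> w0; rewrite big_nat_cond; apply: sumr_ge0 => m; rewrite andbT; exact: w0.
have V0 : 0 <= \sum_(k.+1 <= m < n) v m by apply: nn => m /rec'[].
have F0 : 0 <= \sum_(k.+1 <= m < n) f m by apply: nn => m /rec'[].
have A0 : 0 <= \sum_(k.+1 <= m < n) a m by apply: nn => m /rec'[].
set V := \sum_(k.+1 <= m < n) v m in Hk V0 *.
set F := \sum_(k.+1 <= m < n) f m in Hk F0 *.
set A := \sum_(k.+1 <= m < n) a m in Hk A0 *.
rewrite expRD.
have E1 : 1 + a k <= expR (a k) by exact: expR_ge1Dx.
have EA : 1 <= expR A by rewrite -expR0 ler_expR.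
apply: (@le_trans _ _ ((1 + a k) * (u k.+1 + V + f k))).
  have : 0 <= a k * V by exact: mulr_ge0.
  by move: uv; lra.
apply: (@le_trans _ _ ((1 + a k) * (expR A * (u n + F) + f k))).
  by rewrite ler_wpM2l ?lerD2r//; lra.
apply: (@le_trans _ _ ((1 + a k) * (expR A * (u n + (f k + F))))).
  rewrite ler_wpM2l//; first by lra.
  have : 0 <= (expR A - 1) * f k by rewrite mulr_ge0// subr_ge0.
  lra.
rewrite -mulrA ler_wpM2r// mulr_ge0 ?expR_ge0//; lra.
Qed.

Lemma sum_weighted_sqr (r : seq nat) (h x : nat -> R) :
  (forall m, m \in r -> 0 <= h m) ->
  (\sum_(m <- r) h m * x m) ^+ 2 <=
  (\sum_(m <- r) h m) * \sum_(m <- r) h m * x m ^+ 2.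
Proof.
move=> h0.
have E1 : (\sum_(m <- r) h m * x m) ^+ 2 =
  \sum_(m <- r) \sum_(l <- r) h m * h l * (x m * x l).
  rewrite expr2 mulr_suml; apply: eq_bigr => m _; rewrite mulr_sumr.
  by apply: eq_bigr => l _; ring.
have E2 : (\sum_(m <- r) h m) * (\sum_(m <- r) h m * x m ^+ 2) =
  \sum_(m <- r) \sum_(l <- r) h m * h l * ((x m ^+ 2 + x l ^+ 2) / 2).
  pose S := \sum_(m <- r) \sum_(l <- r) h m * h l * x l ^+ 2.
  have SE : (\sum_(m <- r) h m) * (\sum_(m <- r) h m * x m ^+ 2) = S.
    rewrite mulr_suml; apply: eq_bigr => m _; rewrite mulr_sumr.
    by apply: eq_bigr => l _; ring.
  have SE' : S = \sum_(m <- r) \sum_(l <- r) h m * h l * x m ^+ 2.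
    rewrite /S exchange_big/=; apply: eq_bigr => m _; apply: eq_bigr => l _; ring.
  rewrite SE; transitivity ((S + S) / 2); first by field.
  rewrite {1}SE' /S -big_split/= mulr_suml; apply: eq_bigr => m _.
  by rewrite -big_split/= mulr_suml; apply: eq_bigr => l _; field.
rewrite E1 E2 big_seq [leRHS]big_seq; apply: ler_sum => m mr.
rewrite big_seq [leRHS]big_seq; apply: ler_sum => l lr.
rewrite ler_wpM2l ?mulr_ge0 ?h0//.
rewrite -subr_ge0 (_ : _ - _ = (x m - x l) ^+ 2 / 2) ?divr_ge0 ?sqr_ge0//.
by field.
Qed.

Lemma sqr_add4 (a b c e : R) :
  (a + b + c + e) ^+ 2 <= 4 * (a ^+ 2 + b ^+ 2 + c ^+ 2 + e ^+ 2).
Proof.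
have := sqr_ge0 (a - b); have := sqr_ge0 (a - c); have := sqr_ge0 (a - e).
have := sqr_ge0 (b - c); have := sqr_ge0 (b - e); have := sqr_ge0 (c - e).
by rewrite !expr2; lra.
Qed.

(** Discrete form of A^2 <= 2 int (A - A_s) dA_s. *)
Lemma sqr_sum_le2 (N : nat) (k : nat) (x : nat -> R) :
  (\sum_(k <= m < N) x m) ^+ 2 <=
  2 * \sum_(k <= m < N) x m * \sum_(m <= l < N) x l.
Proof.
have [kN|Nk] := leqP k N; last by rewrite !big_geq ?(ltnW Nk)// expr0n mulr0.
elim: {k}(N - k)%N {-2}k (erefl (N - k)%N) kN => [|n IH] k nk kN.
  have -> : k = N by apply/eqP; rewrite eqn_leq kN -subn_eq0 nk.
  by rewrite !big_geq// expr0n mulr0.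
have kN' : (k < N)%N by rewrite -subn_gt0 nk.
have := IH k.+1; rewrite subnS nk => /(_ erefl kN').
rewrite [in X in _ -> X](big_ltn kN') [X in _ -> _ <= X](_ : _ =
  2 * (x k * (x k + \sum_(k.+1 <= l < N) x l) +
       \sum_(k.+1 <= m < N) x m * \sum_(m <= l < N) x l)).
  by rewrite sqrrD; have := sqr_ge0 (x k); rewrite !expr2; lra.
by rewrite (big_ltn kN') [in X in 2 * (x k * X + _)](big_ltn kN').
Qed.

End Gronwall.

(** * Backward paths over a time grid *)

Section Frame.
Context (disp : measure_display) (T : measurableType disp) (R : realType)
  (P : probability T R).
Implicit Types (X Y g : T -> R).
Local Notation mean := (mean P).
Local Notation summ := (summ P).
Local Notation sqsumm := (sqsumm P).
Local Notation step_condexp := (step_condexp P).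

(** A time grid with a filtration and weights: the estimates see the weights through
    their conditional moments of order one and two and the bound on their size. *)
Record frame (n d : nat) (Tm LZ Lam : R) (G : nat -> set_system T)
    (h lam : nat -> R) (H : nat -> 'I_d -> T -> R) : Prop := Frame {
  frame_sub : forall m, (m <= n)%N -> subalg (G m);
  frame_mono : forall m, (m < n)%N -> G m `<=` G m.+1;
  frame_step : forall m, (m < n)%N -> 0 < h m;
  frame_horizon : \sum_(0 <= m < n) h m = Tm;
  frame_lam : forall m, (m < n)%N -> 0 < lam m <= Lam;
  frame_lip : 0 <= LZ;
  frame_weight : forall m, (m < n)%N -> is_weight P (G m) (lam m / h m) (H m);
  frame_bound : forall m, (m < n)%N ->
    {ae P, forall w, h m * nrm (fun a => H m a w) * LZ <= 1}
}.

Context (n d : nat) (Tm LZ Lam : R) (G : nat -> set_system T)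
    (h lam : nat -> R) (H : nat -> 'I_d -> T -> R).
Hypothesis FR : frame n Tm LZ Lam G h lam H.

Let fsub m : (m <= n)%N -> subalg (G m). Proof. exact: (frame_sub FR). Qed.

Lemma frame_partial k : (k <= n)%N -> \sum_(k <= m < n) h m <= Tm.
Proof.
move=> kn; rewrite -(frame_horizon FR) [leRHS](big_cat_nat (n := k))//= lerDr.
rewrite big_nat_cond; apply: sumr_ge0 => m; rewrite andbT => /andP[_ mk].
by apply/ltW/(frame_step FR); exact: leq_trans kn.
Qed.

Lemma frame_step_le m : (m < n)%N -> h m <= Tm.
Proof.
move=> mn; apply: le_trans (frame_partial (ltnW mn)).
rewrite (big_ltn mn) lerDl big_nat_cond sumr_ge0// => l.
by rewrite andbT => /andP[_ ln]; exact/ltW/(frame_step FR).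
Qed.

Lemma frame_Tm_ge0 : 0 <= Tm.
Proof.
by have := frame_partial (leqnn n); rewrite big_geq.
Qed.

Lemma frame_Lam_gt0 : (0 < n)%N -> 0 < Lam.
Proof. by move=> n0; have /andP[l0 /(lt_le_trans l0)] := frame_lam FR n0. Qed.

Definition nz (z : 'I_d -> T -> R) w := nrm (fun a => z a w).

Definition steps k (y e : nat -> T -> R) (z : nat -> 'I_d -> T -> R) :=
  (forall m, (k <= m <= n)%N -> adapted (G m) (y m) /\ sqsumm (y m)) /\
  (forall m, (k <= m < n)%N ->
     step_condexp (G m) (H m) (y m.+1) (e m) (z m)).

Lemma steps_sq k y e z m : steps k y e z -> (k <= m < n)%N ->
  [/\ sqsumm (e m), forall a, sqsumm (z m a) & sqsumm (nz (z m))].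
Proof.
move=> [_ S] kmn; have /andP[km mn] := kmn.
have /andP[l0 _] := frame_lam FR mn.
have [qe qz] := step_sq (fsub (ltnW mn)) (frame_step FR mn) l0
  (frame_weight FR mn) (S m kmn).
by split => //; exact: sqsumm_nrm.
Qed.

(** Testing against an adapted nonnegative variable replaces y m by its terminal
    value plus the drifts still to come, one step at a time. *)
Lemma path_dominate k y e z (g : nat -> T -> R) m (b : T -> R) :
  steps k y e z -> (forall l, (k <= l < n)%N -> sqsumm (g l)) ->
  (forall l, (k <= l < n)%N -> {ae P, forall w, y l w <= e l w + g l w}) ->
  (k <= m <= n)%N -> adapted (G m) b -> sqsumm b -> (forall w, 0 <= b w) ->
  mean (fun w => b w * y m w) <=
  mean (fun w => b w * (y n w + \sum_(m <= l < n) g l w)).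
Proof.
move=> S qg yg; have [Sy Se] := S.
elim: {m}(n - m)%N {-2}m (erefl (n - m)%N) => [|N IH] m nm /andP[km mn] ab qb b0.
  have -> : m = n by apply/eqP; rewrite eqn_leq mn -subn_eq0 nm.
  rewrite le_eqVlt; apply/orP; left; apply/eqP; congr mean; apply/funext => w.
  by rewrite big_geq// addr0.
have mn' : (m < n)%N by rewrite -subn_gt0 nm.
have kmn : (k <= m < n)%N by rewrite km.
have km1 : (k <= m.+1 <= n)%N by rewrite mn' andbT (leq_trans km).
have [qe qz _] := steps_sq S kmn.
have [_ qy1] := Sy _ km1.
have /andP[l0 _] := frame_lam FR mn'.
have qS : sqsumm (fun w => \sum_(m.+1 <= l < n) g l w).
  apply: sqsumm_sum_nat => l /andP[ml ln]; apply: qg.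
  by rewrite ln andbT (leq_trans km)// ltnW.
have [_ qyn] : adapted (G n) (y n) /\ sqsumm (y n).
  by apply: Sy; rewrite leqnn andbT (leq_trans km).
have step1 : mean (fun w => b w * y m w) <=
    mean (fun w => b w * e m w) + mean (fun w => b w * g m w).
  have [_ qym] : adapted (G m) (y m) /\ sqsumm (y m) by apply: Sy; rewrite km mn.
  rewrite -meanD; [|exact: sqsummM..|exact: sqsummM (qg _ kmn)].
  apply: ler_mean; first exact: sqsummM.
    by apply: summD; apply: sqsummM => //; exact: qg.
  by apply: filterS (yg _ kmn) => w ygw; rewrite -mulrDr ler_wpM2l.
apply: le_trans step1 _.
rewrite (step_pull (fsub mn) (frame_step FR mn') l0 (frame_weight FR mn') (Se _ kmn) ab qb).
have H1 : mean (fun w => b w * y m.+1 w) <=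
    mean (fun w => b w * (y n w + \sum_(m.+1 <= l < n) g l w)).
  apply: IH => //; first by rewrite subnS nm.
  exact: adapted_sub (frame_mono FR mn') ab.
apply: le_trans (lerD H1 (lexx _)) _.
rewrite -meanD; [|apply: sqsummM => //; exact: sqsummD|exact: sqsummM (qg _ kmn)].
rewrite le_eqVlt; apply/orP; left; apply/eqP; congr mean; apply/funext => w.
by rewrite (big_ltn mn'); ring.
Qed.

Definition growth : R := expR (mu_cst Lam LZ * Tm).

Lemma mu_ge1 : (0 < n)%N -> 1 <= mu_cst Lam LZ.
Proof.
move=> n0; have /andP[l0 lL] := frame_lam FR n0.
exact: (mu_cst_ge1 l0 lL (frame_lip FR)).
Qed.

(** One-step inequalities chained by Gronwall's. The term g m is where a reflection
    enters: it will be the product of y m and the increment of the reflecting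
    process. *)
Lemma path_energy k y e z (f g : nat -> T -> R) : (k <= n)%N ->
  steps k y e z ->
  (forall m, (k <= m < n)%N ->
     [/\ sqsumm (f m), forall w, 0 <= f m w, summ (g m) &
         {ae P, forall w, 0 <= g m w}]) ->
  (forall m, (k <= m < n)%N -> {ae P, forall w, y m w ^+ 2 <=
     (`|e m w| + h m * (LZ * nz (z m) w + f m w)) ^+ 2 + 2 * g m w}) ->
  mean (fun w => y k w ^+ 2) +
    (2 * Lam)^-1 * \sum_(k <= m < n) h m * mean (fun w => nz (z m) w ^+ 2) <=
  growth * (mean (fun w => y n w ^+ 2) +
     2 * (\sum_(k <= m < n) h m * mean (fun w => f m w ^+ 2) +
          \sum_(k <= m < n) mean (g m))).
Proof.
move=> kn S fg yx; have [Sy Se] := S.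
pose u m := mean (fun w => y m w ^+ 2).
pose v m := (2 * Lam)^-1 * (h m * mean (fun w => nz (z m) w ^+ 2)).
pose F m := 2 * (h m * mean (fun w => f m w ^+ 2) + mean (g m)).
have sq0 X : 0 <= mean (fun w => X w ^+ 2) by apply: mean_ge0 => w; exact: sqr_ge0.
have := @discrete_gronwall _ k n (fun m => mu_cst Lam LZ * h m) u v F kn.
have Ea : \sum_(k <= m < n) mu_cst Lam LZ * h m =
          mu_cst Lam LZ * \sum_(k <= m < n) h m by rewrite mulr_sumr.
have Ev : \sum_(k <= m < n) v m = (2 * Lam)^-1 *
    \sum_(k <= m < n) h m * mean (fun w => nz (z m) w ^+ 2) by rewrite mulr_sumr.
have EF : \sum_(k <= m < n) F m =
    2 * (\sum_(k <= m < n) h m * mean (fun w => f m w ^+ 2) +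
          \sum_(k <= m < n) mean (g m)) by rewrite -big_split/= mulr_sumr.
rewrite Ea Ev EF => Gr.
apply: (le_trans (Gr _ (sq0 _))) => {Gr}; last first.
  rewrite ler_wpM2r//.
    rewrite addr_ge0 ?sq0// mulr_ge0// addr_ge0// big_nat_cond sumr_ge0// => m;
      rewrite andbT => kmn; have [_ _ ? ?] := fg _ kmn; last exact: mean_ae_ge0.
    by rewrite mulr_ge0 ?sq0//; case/andP: kmn => _ /(frame_step FR)/ltW.
  rewrite ler_expR; have [n0|n0] := posnP n.
    by rewrite -(frame_horizon FR) !big_geq ?n0.
  by rewrite ler_wpM2l ?frame_partial//; apply: le_trans (mu_ge1 n0).
move=> m kmn; have /andP[km mn] := kmn.
have n0 : (0 < n)%N by case: (n) mn.
have hm := frame_step FR mn; have /andP[l0 lL] := frame_lam FR mn.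
have L0 := lt_le_trans l0 lL.
have m1 := mu_ge1 n0.
have [qf f0 sg g0] := fg _ kmn.
have [qe qz qn] := steps_sq S kmn.
have gm0 := mean_ae_ge0 sg g0.
split.
- by rewrite mulr_ge0 ?(ltW hm)//; lra.
- by rewrite mulr_ge0 ?invr_ge0 ?mulr_ge0 ?(ltW hm) ?(ltW L0)//; exact: sq0.
- by rewrite mulr_ge0// addr_ge0// mulr_ge0 ?(ltW hm)//; exact: sq0.
have O := one_step (fsub (ltnW mn)) hm l0 lL (frame_lip FR) (frame_weight FR mn)
  (Se _ kmn) qf f0.
have [_ qy] : adapted (G m) (y m) /\ sqsumm (y m) by apply: Sy; rewrite km ltnW.
have qx : sqsumm (fun w => `|e m w| + h m * (LZ * nz (z m) w + f m w)).
  apply: sqsummD; first exact: sqsumm_norm.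
  by apply: sqsummZ; apply: sqsummD => //; exact: sqsummZ.
have le1 : u m <= mean (fun w => (`|e m w| + h m * (LZ * nz (z m) w + f m w)) ^+ 2)
     + 2 * mean (g m).
  rewrite -meanZ// -meanD; [|exact: sqsumm_sqr|exact: summZ].
  apply: ler_mean; [exact: sqsumm_sqr| |exact: yx].
  by apply: summD; [exact: sqsumm_sqr|exact: summZ].
have E : (2 * Lam)^-1 * (h m * mean (fun w => nz (z m) w ^+ 2)) =
         h m / (2 * Lam) * mean (fun w => nz (z m) w ^+ 2) by ring.
rewrite /v E; apply: le_trans (lerD le1 (lexx _)) _.
rewrite addrAC; apply: le_trans (lerD O (lexx _)) _.
have : 0 <= mu_cst Lam LZ * h m * mean (g m).
  by rewrite mulr_ge0// mulr_ge0 ?(ltW hm)//; lra.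
by rewrite /F /u; lra.
Qed.

(** Cauchy-Schwarz in time for the measure that gives mass h m to the date m. *)
Lemma mean_sum_step (k : nat) (x : nat -> T -> R) : (k <= n)%N ->
  (forall m, (k <= m < n)%N -> sqsumm (x m)) ->
  sqsumm (fun w => \sum_(k <= m < n) h m * x m w) /\
  mean (fun w => (\sum_(k <= m < n) h m * x m w) ^+ 2) <=
  Tm * \sum_(k <= m < n) h m * mean (fun w => x m w ^+ 2).
Proof.
move=> kn qx.
have s m : (k <= m < n)%N -> summ (fun w => h m * x m w ^+ 2).
  by move=> kmn; apply: summZ; exact: sqsumm_sqr (qx _ kmn).
have q : sqsumm (fun w => \sum_(k <= m < n) h m * x m w).
  by apply: sqsumm_sum_nat => m kmn; apply: sqsummZ; exact: qx.
split=> //; rewrite (_ : \sum_(k <= m < n) _ =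
    mean (fun w => \sum_(k <= m < n) h m * x m w ^+ 2)); last first.
  rewrite mean_sum_nat//; apply: eq_big_nat => m kmn.
  by rewrite meanZ//; exact: sqsumm_sqr (qx _ kmn).
have ss := summ_sum_nat s; rewrite -meanZ//.
apply: ler_mean; [exact: sqsumm_sqr|exact: summZ|].
apply: aeW => w.
have h0 m : m \in index_iota k n -> 0 <= h m.
  by rewrite mem_index_iota => /andP[_ /(frame_step FR)/ltW].
apply: le_trans (sum_weighted_sqr _ h0) _.
rewrite ler_wpM2r ?frame_partial//.
by rewrite big_seq sumr_ge0// => m /h0 hm; rewrite mulr_ge0 ?sqr_ge0.
Qed.

End Frame.

(** * Paths with a reflecting process *)

Section PathEstimates.
Context (disp : measure_display) (T : measurableType disp) (R : realType)
  (P : probability T R).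
Implicit Types (X Y g : T -> R).
Local Notation mean := (mean P).
Local Notation summ := (summ P).
Local Notation sqsumm := (sqsumm P).
Context (n d : nat) (Tm LZ Lam : R) (G : nat -> set_system T)
    (h lam : nat -> R) (H : nat -> 'I_d -> T -> R).
Hypothesis FR : frame P n Tm LZ Lam G h lam H.
Local Notation steps := (steps P n G H).
Local Notation M := (growth Tm LZ Lam).

(* With Young's parameter (W + 1)^-1, the energy of z that comes back through
   the drift is at most half of the one on the left-hand side. *)
Let W : R := 16 * M * LZ ^+ 2 * Tm * Lam.

Definition energy_cst : R := M * (5 + 4 * Tm + W).

Let fsub m : (m <= n)%N -> subalg (G m). Proof. exact: (frame_sub FR). Qed.

Lemma ae_forall_nat k N (Q : nat -> T -> Prop) :
  (forall m, (k <= m < N)%N -> {ae P, forall w, Q m w}) ->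
  {ae P, forall w, forall m, (k <= m < N)%N -> Q m w}.
Proof.
move=> q; have /ae_foralln : forall m, {ae P, forall w, (k <= m < N)%N -> Q m w}.
  move=> m; have [kmN|/negbTE kmN] := boolP (k <= m < N)%N.
    by apply: filterS (q _ kmN).
  exact: aeW.
by apply: filterS => w Hw m; exact: Hw.
Qed.

Lemma young2 (a b : R) (x y : T -> R) : 0 < a -> 1 <= a * b ->
  sqsumm x -> sqsumm y ->
  2 * mean (fun w => x w * y w) <=
  a * mean (fun w => x w ^+ 2) + b * mean (fun w => y w ^+ 2).
Proof.
move=> a0 ab qx qy.
have sx := sqsumm_sqr qx; have sy := sqsumm_sqr qy; have sxy := sqsummM qx qy.
rewrite -!meanZ// -meanD; [|exact: summZ..].
apply: ler_mean; [exact: summZ|by apply: summD; exact: summZ|].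
apply: aeW => w; rewrite -subr_ge0 -(pmulr_rge0 _ a0).
rewrite [leRHS](_ : _ = (a * x w - y w) ^+ 2 + (a * b - 1) * y w ^+ 2); last by ring.
by rewrite addr_ge0 ?sqr_ge0// mulr_ge0 ?sqr_ge0 ?subr_ge0.
Qed.

Lemma growth_gt0 : 0 < M. Proof. exact: expR_gt0. Qed.

Let LT0 : 0 <= LZ ^+ 2 * Tm.
Proof. by rewrite mulr_ge0 ?sqr_ge0 ?(frame_Tm_ge0 FR). Qed.

(** The terminal value plus all the drifts: a single variable that dominates every
    y m against adapted nonnegative tests. *)
Definition drift k (y : nat -> T -> R) (z : nat -> 'I_d -> T -> R)
    (f b : nat -> T -> R) w : R :=
  y n w + \sum_(k <= l < n) (h l * (LZ * nz (z l) w + f l w) + b l w).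

Section Reflected.
Context (k : nat) (y e : nat -> T -> R) (z : nat -> 'I_d -> T -> R)
  (f b : nat -> T -> R).
Hypotheses (kn : (k <= n)%N) (S : steps k y e z).
Hypothesis fq : forall m, (k <= m < n)%N -> sqsumm (f m) /\ forall w, 0 <= f m w.
Hypothesis bq : forall m, (k <= m < n)%N ->
  [/\ adapted (G m) (b m), sqsumm (b m) & forall w, 0 <= b m w].
Hypothesis y0 : forall m, (k <= m <= n)%N -> {ae P, forall w, 0 <= y m w}.
Hypothesis yle : forall m, (k <= m < n)%N -> {ae P, forall w,
  y m w <= e m w + h m * (LZ * nz (z m) w + f m w) + b m w}.

Let x m w := h m * (LZ * nz (z m) w + f m w) + b m w.

Let x0 m w : (k <= m < n)%N -> 0 <= x m w.
Proof.
move=> kmn; have /andP[_ mn] := kmn; have hm := ltW (frame_step FR mn).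
have [_ f0] := fq kmn; have [_ _ b0] := bq kmn.
by rewrite addr_ge0// mulr_ge0// addr_ge0// mulr_ge0 ?(frame_lip FR)// nrm_ge0.
Qed.

Let qx m : (k <= m < n)%N -> sqsumm (x m).
Proof.
move=> kmn; have [qf _] := fq kmn; have [_ qb _] := bq kmn.
have [_ _ qn] := steps_sq FR S kmn.
by apply: sqsummD => //; apply: sqsummZ; apply: sqsummD => //; exact: sqsummZ.
Qed.

Let qyn : sqsumm (y n).
Proof. by have [Sy _] := S; apply: (Sy n _).2; rewrite kn leqnn. Qed.

Lemma sqsumm_drift : sqsumm (drift k y z f b).
Proof. by apply: sqsummD => //; exact: sqsumm_sum_nat. Qed.

Lemma drift_dominates m (c : T -> R) : (k <= m <= n)%N ->
  adapted (G m) c -> sqsumm c -> (forall w, 0 <= c w) ->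
  mean (fun w => c w * y m w) <= mean (fun w => c w * drift k y z f b w).
Proof.
move=> kmn ac qc c0; have /andP[km mn] := kmn.
have yg l : (k <= l < n)%N -> {ae P, forall w, y l w <= e l w + x l w}.
  by move=> /yle; apply: filterS => w; rewrite addrA.
have mk l : (m <= l < n)%N -> (k <= l < n)%N.
  by move=> /andP[ml ->]; rewrite (leq_trans km ml).
apply: le_trans (path_dominate FR S qx yg kmn ac qc c0) _.
apply: ler_mean.
- apply: sqsummM => //; apply: sqsummD => //.
  by apply: sqsumm_sum_nat => l /mk; exact: qx.
- by apply: sqsummM => //; exact: sqsumm_drift.
- apply: aeW => w; rewrite ler_wpM2l// lerD2l.
  rewrite [leRHS](big_cat_nat (n := m))//= lerDr.
  rewrite big_nat_cond sumr_ge0// => l; rewrite andbT => /andP[kl lm].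
  by apply: x0; rewrite kl (leq_trans lm).
Qed.

Lemma drift_sqr_bound :
  mean (fun w => drift k y z f b w ^+ 2) <=
  4 * (mean (fun w => y n w ^+ 2) +
       LZ ^+ 2 * (Tm * \sum_(k <= m < n) h m * mean (fun w => nz (z m) w ^+ 2)) +
       Tm * \sum_(k <= m < n) h m * mean (fun w => f m w ^+ 2) +
       mean (fun w => (\sum_(k <= m < n) b m w) ^+ 2)).
Proof.
pose B w := \sum_(k <= m < n) b m w.
have qB : sqsumm B by apply: sqsumm_sum_nat => m /bq[].
pose zt := drift k y z f b.
have qzt : sqsumm zt := sqsumm_drift.
have qz m : (k <= m < n)%N -> sqsumm (nz (z m)) by move=> /(steps_sq FR S)[].
have [q1 m1] := mean_sum_step FR kn qz.
have [q2 m2] := mean_sum_step FR kn (fun m kmn => proj1 (fq kmn)).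
pose N1 w := \sum_(k <= m < n) h m * nz (z m) w.
pose N2 w := \sum_(k <= m < n) h m * f m w.
have ztE w : zt w = y n w + LZ * N1 w + N2 w + B w.
  rewrite /zt /drift -!addrA; congr (_ + _); rewrite /N1 mulr_sumr -!big_split/=.
  by apply: eq_bigr => m _; ring.
have zt2 : mean (fun w => zt w ^+ 2) <= 4 * (mean (fun w => y n w ^+ 2) +
   LZ ^+ 2 * mean (fun w => N1 w ^+ 2) + mean (fun w => N2 w ^+ 2) +
   mean (fun w => B w ^+ 2)).
  have s1 := sqsumm_sqr qyn; have s2 := sqsumm_sqr q1; have s3 := sqsumm_sqr q2.
  have s4 := sqsumm_sqr qB; have s2' := summZ (LZ ^+ 2) s2.
  have s12 := summD s1 s2'; have s123 := summD s12 s3; have s1234 := summD s123 s4.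
  rewrite -meanZ// -!meanD// -meanZ//.
  apply: ler_mean; [exact: sqsumm_sqr|exact: summZ|].
  by apply: aeW => w; rewrite ztE -exprMn; exact: sqr_add4.
apply: (le_trans zt2); rewrite ler_wpM2l// lerD2r lerD// lerD2l.
by rewrite ler_wpM2l ?sqr_ge0.
Qed.

(** The reflecting process b enters through the sum of E[b m * y m], and
    y m is dominated by the drift; hence only the second moment of the total of b
    matters, and not the number of its increments. *)
Lemma energy_bound :
  mean (fun w => y k w ^+ 2) +
    (4 * Lam)^-1 * \sum_(k <= m < n) h m * mean (fun w => nz (z m) w ^+ 2) <=
  energy_cst * (mean (fun w => y n w ^+ 2) +
     \sum_(k <= m < n) h m * mean (fun w => f m w ^+ 2) +
     mean (fun w => (\sum_(k <= m < n) b m w) ^+ 2)).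
Proof.
have sq0 X : 0 <= mean (fun w => X w ^+ 2) by apply: mean_ge0 => w; exact: sqr_ge0.
have [Sy Se] := S.
have qy m : (k <= m < n)%N -> sqsumm (y m).
  by case/andP => km mn; apply: (Sy m _).2; rewrite km ltnW.
have PE := path_energy FR (g := fun m w => b m w * y m w) (f := f) kn S.
have {PE} PE : mean (fun w => y k w ^+ 2) +
    (2 * Lam)^-1 * \sum_(k <= m < n) h m * mean (fun w => nz (z m) w ^+ 2) <=
  M * (mean (fun w => y n w ^+ 2) +
     2 * (\sum_(k <= m < n) h m * mean (fun w => f m w ^+ 2) +
          \sum_(k <= m < n) mean (fun w => b m w * y m w))).
  apply: PE => m kmn; have [qf f0] := fq kmn; have [_ qb b0] := bq kmn.
    have kmn' : (k <= m <= n)%N by case/andP: kmn => -> /ltnW.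
    split => //; first by apply: sqsummM => //; exact: qy.
    by apply: filterS (y0 kmn') => w yw; exact: mulr_ge0.
  have kmn' : (k <= m <= n)%N by case/andP: kmn => -> /ltnW.
  apply: filterS2 (y0 kmn') (yle kmn) => w yw0 yw.
  have /andP[_ mn] := kmn; have hm := ltW (frame_step FR mn).
  have d0 : 0 <= h m * (LZ * nz (z m) w + f m w).
    by rewrite mulr_ge0// addr_ge0// mulr_ge0 ?(frame_lip FR)// nrm_ge0.
  have := ler_norm (e m w); have := normr_ge0 (e m w).
  have := b0 w; set X := `|e m w| + _; set Yw := y m w in yw0 yw *.
  move=> bw0 e0 ee; have YX : Yw <= X + b m w by rewrite /X; lra.
  have X0 : 0 <= X by rewrite /X; lra.
  have := sqr_ge0 (Yw - X).
  have : Yw * Yw <= Yw * (X + b m w) by rewrite ler_wpM2l.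
  by rewrite !expr2; lra.
pose B w := \sum_(k <= m < n) b m w.
have qB : sqsumm B by apply: sqsumm_sum_nat => m /bq[].
pose zt := drift k y z f b.
have qzt : sqsumm zt := sqsumm_drift.
have sumb : \sum_(k <= m < n) mean (fun w => b m w * y m w) <=
            mean (fun w => B w * zt w).
  rewrite (_ : (fun w => B w * zt w) = (fun w => \sum_(k <= m < n) b m w * zt w)).
    rewrite mean_sum_nat => [|m /bq[_ qb _]]; last exact: sqsummM.
    rewrite big_nat_cond [leRHS]big_nat_cond; apply: ler_sum => m.
    rewrite andbT => kmn; have [ab qb b0] := bq kmn.
    by apply: drift_dominates => //; case/andP: kmn => -> /ltnW.
  by apply/funext => w; rewrite mulr_suml.
have Zt' := drift_sqr_bound.
pose dl : R := (W + 1)^-1.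
have Tm0 := frame_Tm_ge0 FR; have M0 := growth_gt0.
have [n0|n0] := posnP n.
  have k0 : k = 0%N by apply/eqP; rewrite -leqn0 -n0.
  rewrite k0 n0 !big_geq// mulr0 !addr0.
  have C1 : 1 <= energy_cst.
    have TmE : Tm = 0 by rewrite -(frame_horizon FR) n0 big_geq.
    rewrite /energy_cst /W TmE !(mulr0, mul0r, addr0) /growth mulr0 expR0 mul1r; lra.
  apply: le_trans (ler_peMl _ C1); first by rewrite lerDl.
  by rewrite addr_ge0.
have L0 := frame_Lam_gt0 FR n0.
have W0 : 0 <= W.
  by rewrite /W !mulr_ge0 ?(frame_lip FR) ?(ltW M0) ?(ltW L0).
have dl0 : 0 < dl by rewrite invr_gt0; lra.
have dW : dl * (W + 1) = 1 by rewrite mulVf// gt_eqF//; lra.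
have Y := @young2 (W + 1) dl B zt _ _ qB qzt.
have {Y} Y : 2 * mean (fun w => B w * zt w) <=
   (W + 1) * mean (fun w => B w ^+ 2) + dl * mean (fun w => zt w ^+ 2).
  by apply: Y; [lra|rewrite mulrC dW].
move: PE sumb Zt' Y; rewrite -/B -/zt.
set Ek := mean (fun w => y k w ^+ 2).
set V := \sum_(k <= m < n) _ * mean (fun w => nz _ w ^+ 2).
set Xi := mean (fun w => y n w ^+ 2).
set Ph := \sum_(k <= m < n) _ * mean (fun w => f _ w ^+ 2).
set B2 := mean (fun w => B w ^+ 2).
set Zt := mean (fun w => zt w ^+ 2).
set BZ := mean (fun w => B w * zt w).
set sb := \sum_(k <= m < n) mean _.
move=> PE sumb Zt' Y.
have V0 : 0 <= V.
  rewrite /V big_nat_cond sumr_ge0// => m; rewrite andbT => /andP[_ mn].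
  by rewrite mulr_ge0// ltW// (frame_step FR).
have Ph0 : 0 <= Ph.
  rewrite /Ph big_nat_cond sumr_ge0// => m; rewrite andbT => /andP[_ mn].
  by rewrite mulr_ge0// ltW// (frame_step FR).
have Xi0 : 0 <= Xi by exact: sq0.
have B20 : 0 <= B2 by exact: sq0.
have dl1 : dl <= 1 by rewrite invf_le1; lra.
have Y' : 2 * sb <= (W + 1) * B2 + 4 * (Xi + Tm * Ph + B2) +
    dl * (4 * (LZ ^+ 2 * (Tm * V))).
  have D1 : dl * Zt <= dl * (4 * (LZ ^+ 2 * (Tm * V))) + 4 * (Xi + Tm * Ph + B2).
    apply: (le_trans (ler_wpM2l (ltW dl0) Zt')).
    have P0 : 0 <= Xi + Tm * Ph + B2 by rewrite !addr_ge0// mulr_ge0.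
    have : dl * (4 * (Xi + Tm * Ph + B2)) <= 4 * (Xi + Tm * Ph + B2).
      by rewrite ler_piMl// mulr_ge0.
    by lra.
  by lra.
have key : M * (dl * (4 * (LZ ^+ 2 * (Tm * V)))) <= (4 * Lam)^-1 * V.
  have -> : M * (dl * (4 * (LZ ^+ 2 * (Tm * V)))) = (4 * Lam)^-1 * V * (W * dl).
    by rewrite /W; field; rewrite gt_eqF.
  rewrite ler_piMr ?mulr_ge0 ?invr_ge0 ?mulr_ge0 ?(ltW L0)//.
  by rewrite -dW mulrC ler_wpM2l ?(ltW dl0)//; lra.
have E2 : (2 * Lam)^-1 * V = (4 * Lam)^-1 * V + (4 * Lam)^-1 * V.
  by field; rewrite gt_eqF.
rewrite E2 in PE.
have PE' : Ek + (4 * Lam)^-1 * V <=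
   M * (Xi + 2 * Ph + ((W + 1) * B2 + 4 * (Xi + Tm * Ph + B2))).
  have : M * (2 * sb) <= M * ((W + 1) * B2 + 4 * (Xi + Tm * Ph + B2) +
    dl * (4 * (LZ ^+ 2 * (Tm * V)))) by rewrite ler_wpM2l// ltW.
  by lra.
apply: (le_trans PE'); rewrite /energy_cst -mulrA ler_wpM2l ?(ltW M0)//.
have T1 := mulr_ge0 Tm0 Xi0; have T2 := mulr_ge0 Tm0 B20.
have T3 := mulr_ge0 W0 Xi0; have T4 := mulr_ge0 W0 Ph0.
by lra.
Qed.

End Reflected.

Let W2 : R := 2 * W.
Definition cost_cst : R := 2 * (16 + 16 * Tm + 2 * W2 + W2 * (2 * W2 + 1)).

(** Garsia's argument: A^2 is at most twice the sum of a m times the remainder of A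
    from m on, and the conditional mean of that remainder is controlled by the
    values of y. Hence the total of the nonnegative increments subtracted from a
    path is bounded in L2 by the data, whatever their number. The path is bounded by
    zt against adapted tests, which is the form of domination that
    [drift_dominates] provides. *)
Lemma cost_bound (k : nat) (y e : nat -> T -> R) (z : nat -> 'I_d -> T -> R)
    (f q a yb : nat -> T -> R) (zt : T -> R) :
  (0 < n)%N -> (k <= n)%N -> steps k y e z ->
  (forall m, (k <= m < n)%N -> sqsumm (f m) /\ forall w, 0 <= f m w) ->
  (forall m, (k <= m < n)%N ->
    [/\ adapted (G m) (a m), sqsumm (a m) & forall w, 0 <= a m w]) ->
  (forall m, (k <= m < n)%N -> sqsumm (q m)) ->
  (forall m, (k <= m < n)%N ->
     {ae P, forall w, y m w = e m w + q m w - a m w}) ->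
  (forall m, (k <= m < n)%N ->
     {ae P, forall w, `|q m w| <= h m * (LZ * nz (z m) w + f m w)}) ->
  (forall m, (k <= m < n)%N -> sqsumm (yb m)) ->
  (forall m, (k <= m < n)%N -> {ae P, forall w, `|y m w| <= yb m w}) ->
  sqsumm zt ->
  (forall m (c : T -> R), (k <= m < n)%N -> adapted (G m) c -> sqsumm c ->
     (forall w, 0 <= c w) ->
     mean (fun w => c w * yb m w) <= mean (fun w => c w * zt w)) ->
  mean (fun w => (\sum_(k <= m < n) a m w) ^+ 2) <=
  cost_cst * (mean (fun w => y n w ^+ 2) +
     \sum_(k <= m < n) h m * mean (fun w => f m w ^+ 2) +
     mean (fun w => zt w ^+ 2)).
Proof.
move=> n0 kn S fq aq qq yE qle qyb yyb qzt dom.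
have sq0 X : 0 <= mean (fun w => X w ^+ 2) by apply: mean_ge0 => w; exact: sqr_ge0.
have [Sy Se] := S.
have qy m : (k <= m < n)%N -> sqsumm (y m).
  by case/andP => km mn; apply: (Sy m _).2; rewrite km ltnW.
have qyn : sqsumm (y n) by apply: (Sy n _).2; rewrite kn leqnn.
pose A w := \sum_(k <= m < n) a m w.
have qA : sqsumm A by apply: sqsumm_sum_nat => m /aq[].
have PE : mean (fun w => y k w ^+ 2) +
    (2 * Lam)^-1 * \sum_(k <= m < n) h m * mean (fun w => nz (z m) w ^+ 2) <=
  M * (mean (fun w => y n w ^+ 2) +
     2 * (\sum_(k <= m < n) h m * mean (fun w => f m w ^+ 2) +
          \sum_(k <= m < n) mean (fun w => a m w * yb m w))).
  apply: (path_energy FR kn S) => m kmn; have [qf f0] := fq _ kmn;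
      have [_ qa a0] := aq _ kmn.
    split => //; first by apply: sqsummM => //; exact: qyb.
    apply: filterS (yyb _ kmn) => w yw; apply: mulr_ge0 => //.
    exact: le_trans yw.
  apply: filterS3 (yE _ kmn) (qle _ kmn) (yyb _ kmn) => w yw qw ybw.
  set X := `|e m w| + _.
  have eqX : `|e m w + q m w| <= X.
    by apply: le_trans (ler_normD _ _) _; rewrite lerD2l.
  have e2 : (e m w + q m w) ^+ 2 <= X ^+ 2.
    rewrite -(real_normK (num_real (e m w + q m w))).
    by rewrite lerXn2r// nnegrE// (le_trans _ eqX).
  have yb1 : - yb m w <= y m w by move: ybw; rewrite ler_norml => /andP[].
  have : 0 <= a m w * (y m w + yb m w) by rewrite mulr_ge0//; lra.
  have := sqr_ge0 (a m w).
  move: e2; have -> : e m w + q m w = y m w + a m w by rewrite yw; ring.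
  by rewrite !expr2; lra.
have aA (c : T -> R) : sqsumm c ->
    \sum_(k <= m < n) mean (fun w => a m w * c w) = mean (fun w => A w * c w).
  move=> qc; rewrite (_ : (fun w => A w * c w) = (fun w => \sum_(k <= m < n) a m w * c w)).
    by rewrite mean_sum_nat => // m /aq[_ qa _]; exact: sqsummM.
  by apply/funext => w; rewrite mulr_suml.
have sumyb : \sum_(k <= m < n) mean (fun w => a m w * yb m w) <=
            mean (fun w => A w * zt w).
  rewrite -aA// big_nat_cond [leRHS]big_nat_cond; apply: ler_sum => m.
  by rewrite andbT => kmn; have [ab qb b0] := aq _ kmn; exact: dom.
have qz m : (k <= m < n)%N -> sqsumm (nz (z m)) by move=> /(steps_sq FR S)[].
have [q1 m1] := mean_sum_step FR kn qz.
have [q2 m2] := mean_sum_step FR kn (fun m kmn => proj1 (fq _ kmn)).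
pose N1 w := \sum_(k <= m < n) h m * nz (z m) w.
pose N2 w := \sum_(k <= m < n) h m * f m w.
pose th w := `|y n w| + LZ * N1 w + N2 w + zt w.
have qth : sqsumm th.
  apply: sqsummD => //; apply: sqsummD => //; apply: sqsummD.
    exact: sqsumm_norm.
  exact: sqsummZ.
have A2le : mean (fun w => A w ^+ 2) <= 2 * mean (fun w => A w * th w).
  pose r m w := \sum_(m <= l < n) a l w.
  have mk m l : (k <= m)%N -> (m <= l < n)%N -> (k <= l < n)%N.
    by move=> km /andP[ml ->]; rewrite (leq_trans km ml).
  have qr m : (k <= m)%N -> sqsumm (r m).
    by move=> km; apply: sqsumm_sum_nat => l /(mk _ _ km)/aq[].
  have sar m : (k <= m < n)%N -> summ (fun w => a m w * r m w).
    by move=> kmn; have [_ qa _] := aq _ kmn; case/andP: kmn => km _;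
      apply: sqsummM => //; exact: qr.
  apply: (@le_trans _ _ (2 * \sum_(k <= m < n) mean (fun w => a m w * r m w))).
    have ss : summ (fun w => \sum_(k <= m < n) a m w * r m w)
      by exact: summ_sum_nat.
    rewrite -mean_sum_nat// -meanZ//.
    apply: ler_mean; [exact: sqsumm_sqr|exact: summZ|].
    by apply: aeW => w; exact: sqr_sum_le2.
  rewrite ler_wpM2l// -aA// big_nat_cond [leRHS]big_nat_cond; apply: ler_sum => m.
  rewrite andbT => kmn; have [ab qb b0] := aq _ kmn; have /andP[km mn] := kmn.
  have kmn' : (k <= m <= n)%N by rewrite km ltnW.
  have PD : mean (fun w => a m w * y m w) <=
      mean (fun w => a m w * (y n w + \sum_(m <= l < n) (q l w - a l w))).
    apply: (path_dominate FR S (g := fun l w => q l w - a l w)) => //.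
      by move=> l kln; apply: sqsummB; [exact: qq|case: (aq _ kln)].
    move=> l kln; apply: filterS (yE _ kln) => w ->.
    by rewrite addrA.
  pose rq w := \sum_(m <= l < n) q l w.
  have qrq : sqsumm rq by apply: sqsumm_sum_nat => l /(mk _ _ km); exact: qq.
  have PD' : mean (fun w => a m w * r m w) <=
     mean (fun w => a m w * (y n w + rq w - y m w)).
    have s1 : summ (fun w => a m w * y m w) by apply: sqsummM => //; exact: qy.
    have s2 := sar _ kmn.
    have s3 : summ (fun w => a m w * (y n w + rq w)).
      by apply: sqsummM => //; exact: sqsummD.
    rewrite (_ : (fun w => a m w * (y n w + rq w - y m w)) =
       (fun w => a m w * (y n w + rq w) - a m w * y m w)); last first.
      by apply/funext => w; ring.
    rewrite meanB// lerBrDr addrC -lerBrDr -meanB//; apply: le_trans PD _.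
    rewrite le_eqVlt; apply/orP; left; apply/eqP; congr mean; apply/funext => w.
    by rewrite sumrB /rq /r; ring.
  apply: le_trans PD' _.
  have qyb' := qyb _ kmn.
  have s3 : summ (fun w => a m w * (`|y n w| + LZ * N1 w + N2 w)).
    apply: sqsummM => //; apply: sqsummD => //; apply: sqsummD.
      exact: sqsumm_norm.
    exact: sqsummZ.
  apply: (@le_trans _ _ (mean (fun w => a m w * (`|y n w| + LZ * N1 w + N2 w)) +
      mean (fun w => a m w * yb m w))).
    rewrite -meanD//; last exact: sqsummM.
    apply: ler_mean.
    - apply: sqsummM => //; apply: sqsummB; last exact: qy.
      exact: sqsummD.
    - by apply: summD => //; exact: sqsummM.
    have /ae_forall_nat aq' := qle.
    apply: filterS2 aq' (yyb _ kmn) => w qw ybw.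
    rewrite -mulrDr ler_wpM2l//.
    have : rq w <= LZ * N1 w + N2 w.
      rewrite /N1 mulr_sumr -big_split/= (big_cat_nat (n := m))//=; last exact: ltnW.
      rewrite ler_wpDl//.
        rewrite big_nat_cond sumr_ge0// => l; rewrite andbT => /andP[kl lm].
        have ln := ltn_trans lm mn; have hl := ltW (frame_step FR ln).
        have kln : (k <= l < n)%N by rewrite kl.
        have [_ f0] := fq _ kln.
        by rewrite addr_ge0 ?mulr_ge0 ?(frame_lip FR) ?nrm_ge0.
      apply: ler_sum_nat => l /(mk _ _ km) kln.
      apply: le_trans (ler_norm _) _; apply: le_trans (qw _ kln) _.
      by rewrite mulrDr mulrCA.
    have := ler_norm (y n w); have : - yb m w <= y m w by move: ybw; rewrite ler_norml => /andP[].
    by lra.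
  apply: le_trans (lerD (lexx _) (dom _ _ kmn ab qb b0)) _.
  rewrite -meanD//; last exact: sqsummM.
  rewrite le_eqVlt; apply/orP; left; apply/eqP; congr mean; apply/funext => w.
  by rewrite /th; ring.
have th2 : mean (fun w => th w ^+ 2) <= 4 * (mean (fun w => y n w ^+ 2) +
   LZ ^+ 2 * mean (fun w => N1 w ^+ 2) + mean (fun w => N2 w ^+ 2) +
   mean (fun w => zt w ^+ 2)).
  have s1 := sqsumm_sqr qyn; have s2 := sqsumm_sqr q1; have s3 := sqsumm_sqr q2.
  have s4 := sqsumm_sqr qzt; have s2' := summZ (LZ ^+ 2) s2.
  have s12 := summD s1 s2'; have s123 := summD s12 s3; have s1234 := summD s123 s4.
  rewrite -meanZ// -!meanD// -meanZ//.
  apply: ler_mean; [exact: sqsumm_sqr|exact: summZ|].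
  apply: aeW => w; rewrite -exprMn -(real_normK (num_real (y n w))).
  exact: sqr_add4.
have L0 := frame_Lam_gt0 FR n0.
have Tm0 := frame_Tm_ge0 FR; have M0 := growth_gt0.
have W0 : 0 <= W2.
  by rewrite /W2 /W !mulr_ge0 ?(frame_lip FR) ?(ltW M0) ?(ltW L0).
pose dl : R := (2 * W2 + 1)^-1.
have dl0 : 0 < dl by rewrite invr_gt0; lra.
have dW : dl * (2 * W2 + 1) = 1 by rewrite mulVf// gt_eqF//; lra.
have Y1 : 2 * mean (fun w => A w * zt w) <=
   dl * mean (fun w => A w ^+ 2) + (2 * W2 + 1) * mean (fun w => zt w ^+ 2).
  by apply: young2 => //; rewrite dW.
have Y2 : 2 * mean (fun w => A w * th w) <=
   2^-1 * mean (fun w => A w ^+ 2) + 2 * mean (fun w => th w ^+ 2).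
  by apply: young2 => //; rewrite mulVf.
have Ek0 := sq0 (y k).
move: PE sumyb th2 m1 m2 Y1 Y2 A2le Ek0; rewrite -/N1 -/N2 -/A.
set Ek := mean (fun w => y k w ^+ 2).
set V := \sum_(k <= m < n) _ * mean (fun w => nz _ w ^+ 2).
set Xi := mean (fun w => y n w ^+ 2).
set Ph := \sum_(k <= m < n) _ * mean (fun w => f _ w ^+ 2).
set A2 := mean (fun w => A w ^+ 2).
set Zt := mean (fun w => zt w ^+ 2).
set Th := mean (fun w => th w ^+ 2).
set AZ := mean (fun w => A w * zt w).
set AT := mean (fun w => A w * th w).
set sb := \sum_(k <= m < n) mean _.
move=> PE sumyb th2 m1 m2 Y1 Y2 A2le Ek0.
have Ph0 : 0 <= Ph.
  rewrite /Ph big_nat_cond sumr_ge0// => m; rewrite andbT => /andP[_ mn].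
  by rewrite mulr_ge0// ltW// (frame_step FR).
have Xi0 : 0 <= Xi by exact: sq0.
have A20 : 0 <= A2 by exact: sq0.
have Zt0 : 0 <= Zt by exact: sq0.
have A2Th : A2 <= 4 * Th by lra.
have Th' : Th <= 4 * (Xi + LZ ^+ 2 * (Tm * V) + Tm * Ph + Zt).
  apply: (le_trans th2); rewrite ler_wpM2l// lerD2r lerD// lerD2l.
  by rewrite ler_wpM2l ?sqr_ge0.
have V' : V <= 2 * Lam * (M * (Xi + 2 * Ph + (dl * A2 + (2 * W2 + 1) * Zt))).
  rewrite -ler_pdivrMl ?mulr_gt0//.
  have : M * (2 * sb) <= M * (dl * A2 + (2 * W2 + 1) * Zt).
    by rewrite ler_wpM2l ?(ltW M0)//; lra.
  by lra.
have W2E : 16 * (LZ ^+ 2 * (Tm * (2 * Lam * M))) = W2 by rewrite /W2 /W; ring.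
have V'' : 16 * (LZ ^+ 2 * (Tm * V)) <=
    W2 * (Xi + 2 * Ph + (dl * A2 + (2 * W2 + 1) * Zt)).
  rewrite -{1}W2E.
  have : 16 * (LZ ^+ 2 * Tm) * V <= 16 * (LZ ^+ 2 * Tm) *
    (2 * Lam * (M * (Xi + 2 * Ph + (dl * A2 + (2 * W2 + 1) * Zt)))).
    by rewrite ler_wpM2l// mulr_ge0.
  by lra.
have half : W2 * (dl * A2) <= 2^-1 * A2.
  rewrite mulrA ler_wpM2r//.
  have : dl * (2 * W2) <= 1 by move: dW dl0; lra.
  by lra.
have T1 := mulr_ge0 Tm0 Xi0; have T2 := mulr_ge0 Tm0 Zt0.
have T3 := mulr_ge0 W0 Xi0; have T4 := mulr_ge0 W0 Ph0; have T5 := mulr_ge0 W0 Zt0.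
have T6 := mulr_ge0 W0 T3; have T7 := mulr_ge0 W0 T4; have T8 := mulr_ge0 W0 T5.
rewrite /cost_cst.
by lra.
Qed.

End PathEstimates.

(** * Obliquely reflected schemes in coordinates *)

Lemma measurable_bigmax (R : realType) (disp : measure_display)
    (U : measurableType disp) (I : Type) (r : seq I) (Q : pred I) (x0 : U -> R)
    (x : I -> U -> R) :
  measurable_fun setT x0 -> (forall i, Q i -> measurable_fun setT (x i)) ->
  measurable_fun setT (fun w => \big[Num.max/x0 w]_(i <- r | Q i) x i w).
Proof.
move=> m0 mx; elim: r => [|i r IH].
  by rewrite (_ : (fun w => _) = x0)//; apply/funext => w; rewrite big_nil.
have [Qi|Qi] := boolP (Q i); last first.
  rewrite (_ : (fun w => _) = (fun w => \big[Num.max/x0 w]_(i <- r | Q i) x i w))//.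
  by apply/funext => w; rewrite big_cons (negbTE Qi).
rewrite (_ : (fun w => _) =
    (fun w => Num.max (x i w) (\big[Num.max/x0 w]_(i <- r | Q i) x i w))).
  by apply: measurable_maxr => //; exact: mx.
by apply/funext => w; rewrite big_cons Qi.
Qed.

Lemma bigmax_attained (R : realType) (I : eqType) (r : seq I) (x0 : R) (x : I -> R) :
  \big[Num.max/x0]_(i <- r) x i = x0 \/
  exists2 i, i \in r & \big[Num.max/x0]_(i <- r) x i = x i.
Proof.
elim: r => [|i r IH]; first by left; rewrite big_nil.
rewrite big_cons; have [xi|xi] := leP (x i) (\big[Num.max/x0]_(i <- r) x i).
  case: IH => [->|[l lr ->]]; first by left.
  by right; exists l; rewrite // inE lr orbT.
by right; exists i; rewrite // mem_head.
Qed.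

Section Schemes.
Context (disp : measure_display) (T : measurableType disp) (R : realType)
  (P : probability T R).
Implicit Types (X : T -> R) (GG : set_system T) (A B : set T) (b : bool).
Local Notation sqsumm := (sqsumm P).
Local Notation step_condexp := (step_condexp P).
Context (n d : nat) (Tm LZ Lam : R) (G : nat -> set_system T)
    (h lam : nat -> R) (H : nat -> 'I_d -> T -> R).
Hypothesis FR : frame P n Tm LZ Lam G h lam H.

Let fsub m : (m <= n)%N -> subalg (G m). Proof. exact: (frame_sub FR). Qed.

(** The component f m j depends on the j-th row of the matrix argument only, so it
    is a function of a vector. *)
Record generator (f : nat -> 'I_d -> T -> ('I_d -> R) -> R) : Prop := Generator {
  generator_adapted : forall m j (z : 'I_d -> T -> R), (m < n)%N ->
    (forall a, adapted (G m) (z a)) ->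
    adapted (G m) (fun w => f m j w (fun a => z a w));
  generator_lip : forall m, (m < n)%N -> {ae P, forall w, forall j x x',
    `|f m j w x - f m j w x'| <= LZ * nrm (fun a => x a - x' a)};
  generator_sq : forall m j, (m < n)%N -> sqsumm (fun w => f m j w (fun=> 0))
}.

Record costs (refl : pred nat) (eps : R) (c : nat -> 'I_d -> 'I_d -> T -> R) :
    Prop := Costs {
  costs_adapted : forall m j l, (m < n)%N -> refl m -> adapted (G m) (c m j l);
  costs_sq : forall m j l, (m < n)%N -> refl m -> sqsumm (c m j l);
  costs_diag : forall m, (m < n)%N -> refl m ->
    {ae P, forall w, forall j, c m j j w = 0};
  costs_lower : forall m, (m < n)%N -> refl m ->
    {ae P, forall w, forall j l, j != l -> eps <= c m j l w}
}.

(** The maximum in the projection is described by its two properties, being an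
    upper bound and being attained; at the dates without reflection Y is Yt. *)
Definition reflected_at (b : bool) (c : 'I_d -> 'I_d -> T -> R)
    (Y Yt : 'I_d -> T -> R) (w : T) : Prop :=
  if b then forall j, (forall l, Yt l w - c j l w <= Y j w) /\
                      exists l, Y j w = Yt l w - c j l w
  else forall j, Y j w = Yt j w.

(** The conditional means e and Z are versions, so the relations that involve them
    are almost sure ones. *)
Record scheme (refl : pred nat) (c : nat -> 'I_d -> 'I_d -> T -> R)
    (xi : 'I_d -> T -> R) (f : nat -> 'I_d -> T -> ('I_d -> R) -> R)
    (Y Yt e : nat -> 'I_d -> T -> R) (Z : nat -> 'I_d -> 'I_d -> T -> R) : Prop :=
  Scheme {
  sch_last : forall j w, Y n j w = xi j w;
  sch_adapted : forall m j, (m <= n)%N -> adapted (G m) (Y m j);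
  sch_sq : forall m j, (m <= n)%N -> sqsumm (Y m j);
  sch_tadapted : forall m j, (m < n)%N -> adapted (G m) (Yt m j);
  sch_tsq : forall m j, (m < n)%N -> sqsumm (Yt m j);
  sch_step : forall m j, (m < n)%N ->
    step_condexp (G m) (H m) (Y m.+1 j) (e m j) (Z m j);
  sch_tilde : forall m, (m < n)%N -> {ae P, forall w, forall j,
    Yt m j w = e m j w + h m * f m j w (fun a => Z m j a w)};
  sch_refl : forall m, (m < n)%N ->
    {ae P, forall w, reflected_at (refl m) (c m) (Y m) (Yt m) w}
}.

Lemma generator_sqZ f m j z : generator f -> (m < n)%N ->
  (forall a, adapted (G m) (z a)) -> (forall a, sqsumm (z a)) ->
  sqsumm (fun w => f m j w (fun a => z a w)).
Proof.
move=> gf mn az qz.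
have q0 := generator_sq gf j mn; have qn := sqsumm_nrm qz.
apply: (sqsumm_ae_dom (Y := fun w => `|f m j w (fun=> 0)| + LZ * nrm (fun a => z a w))).
- by apply: (adapted_meas (fsub (ltnW mn))); exact: generator_adapted.
- by apply: sqsummD; [exact: sqsumm_norm|exact: sqsummZ].
- apply: filterS (generator_lip gf mn) => w /(_ j (fun a => z a w) (fun=> 0)) Lw.
  rewrite -lerBlDl; apply: le_trans (lerB_dist _ _) _; apply: le_trans Lw _.
  by rewrite (_ : (fun a => z a w - 0) = (fun a => z a w))//; apply/funext => a; rewrite subr0.
Qed.

Definition projected (b : bool) (c : 'I_d -> 'I_d -> T -> R) (Yt : 'I_d -> T -> R)
    (j : 'I_d) w :=
  if b then \big[Num.max/Yt j w - c j j w]_l (Yt l w - c j l w) else Yt j w.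

Lemma projected_reflected_at b c Yt w : reflected_at b c (projected b c Yt) Yt w.
Proof.
rewrite /reflected_at /projected; case: b => // j; split.
  by move=> l; exact: (le_bigmax_cond _ (fun l => Yt l w - c j l w)).
have [->|[l _ ->]] := bigmax_attained (index_enum _) (Yt j w - c j j w)
  (fun l => Yt l w - c j l w); first by exists j.
by exists l.
Qed.

Lemma projected_adapted GG b c Yt : (forall j, adapted GG (Yt j)) ->
  (b -> forall j l, adapted GG (c j l)) -> forall j, adapted GG (projected b c Yt j).
Proof.
move=> aYt ac j; rewrite /projected; case: b ac => [/(_ isT)|_] ac /=; last exact: aYt.
apply: (@measurable_bigmax _ _ (g_sigma_algebraType GG)) => [|l _];
  apply: measurable_funB; (exact: aYt || exact: ac).
Qed.

Lemma projected_sqsumm GG b c Yt : subalg GG -> (forall j, adapted GG (Yt j)) ->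
  (b -> forall j l, adapted GG (c j l)) -> (forall j, sqsumm (Yt j)) ->
  (b -> forall j l, sqsumm (c j l)) -> forall j, sqsumm (projected b c Yt j).
Proof.
move=> sG aYt ac qYt qc j.
apply: (sqsumm_dom (Y := fun w => \sum_l `|Yt l w| +
   (if b then \sum_l `|c j l w| else 0))).
- exact: adapted_meas (projected_adapted aYt ac j).
- apply: sqsummD; first by apply: sqsumm_sum => l _; exact: sqsumm_norm.
  case: b {ac} qc => qc; last exact: sqsumm_cst.
  by apply: sqsumm_sum => l _; apply: sqsumm_norm; exact: qc.
- move=> w; have s1 l : `|Yt l w| <= \sum_l `|Yt l w|.
    by rewrite (bigD1 l)//= lerDl sumr_ge0.
  have := projected_reflected_at b c Yt w; rewrite /reflected_at.
  case: b {ac qc} => [/(_ j)[_ [l ->]]|/(_ j) ->]; last by rewrite addr0.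
  have s2 : `|c j l w| <= \sum_l `|c j l w|.
    by rewrite (bigD1 l)//= lerDl sumr_ge0.
  by apply: le_trans (ler_normB _ _) _; exact: lerD.
Qed.

Lemma scheme_exists refl eps c xi f : generator f -> costs refl eps c ->
  (forall j, adapted (G n) (xi j)) -> (forall j, sqsumm (xi j)) ->
  exists Y Yt e Z, scheme refl c xi f Y Yt e Z.
Proof.
move=> gf cc axi qxi.
pose good k (Y Yt e : nat -> 'I_d -> T -> R) (Z : nat -> 'I_d -> 'I_d -> T -> R) :=
  [/\ forall j w, Y n j w = xi j w,
   forall m j, (k <= m <= n)%N -> adapted (G m) (Y m j) /\ sqsumm (Y m j) &
   forall m, (k <= m < n)%N ->
    [/\ forall j, adapted (G m) (Yt m j) /\ sqsumm (Yt m j),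
    forall j, step_condexp (G m) (H m) (Y m.+1 j) (e m j) (Z m j),
    forall w j, Yt m j w = e m j w + h m * f m j w (fun a => Z m j a w) &
    forall w, reflected_at (refl m) (c m) (Y m) (Yt m) w]].
suff : forall N k, k = (n - N)%N -> exists Y Yt e Z, good k Y Yt e Z.
  move=> /(_ n 0%N); rewrite subnn => /(_ erefl)[Y [Yt [e [Z [Yl Ya Ys]]]]].
  exists Y, Yt, e, Z; split => //.
  - by move=> m j mn; have [] := Ya m j mn.
  - by move=> m j mn; have [] := Ya m j mn.
  - by move=> m j mn; have [/(_ j)[]] := Ys m mn.
  - by move=> m j mn; have [/(_ j)[]] := Ys m mn.
  - by move=> m j mn; have [] := Ys m mn.
  - by move=> m mn; have [] := Ys m mn; move=> _ _ E _; exact: aeW.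
  - by move=> m mn; have [] := Ys m mn; move=> _ _ _ E; exact: aeW.
elim=> [|N IH] k kE.
  exists (fun _ => xi), (fun _ => xi), (fun _ => xi), (fun _ _ => xi).
  rewrite kE subn0; split => //.
    by move=> m j; rewrite -eqn_leq => /eqP <-.
  by move=> m; rewrite ltnNge andbN.
have [nN|Nn] := leqP n N.
  by apply: (IH k); rewrite kE; apply/eqP; rewrite eqn_leq; lia.
have kn : (k < n)%N by rewrite kE; lia.
have [Y [Yt [e [Z [Yl Ya Ys]]]]] : exists Y Yt e Z, good k.+1 Y Yt e Z.
  by apply: IH; rewrite kE; lia.
have sk := fsub (ltnW kn).
have /choice[e0 /choice[Z0 st]] j : exists e0, exists Z0,
    step_condexp (G k) (H k) (Y k.+1 j) e0 Z0.
  apply: (step_exists sk (frame_weight FR kn)).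
  by apply: (Ya k.+1 j _).2; rewrite leqnn kn.
have /andP[l0 _] := frame_lam FR kn.
pose Yt0 j w := e0 j w + h k * f k j w (fun a => Z0 j a w).
have az j a : adapted (G k) (Z0 j a) by have [_ _ /(_ a)[]] := st j.
have aYt0 j : adapted (G k) (Yt0 j).
  apply: measurable_funD; first by have [_ [] ] := st j.
  apply: measurable_funM; first exact: measurable_cst.
  exact: (generator_adapted gf j kn (az j)).
have qYt0 j : sqsumm (Yt0 j).
  have [q1 q2] := step_sq sk (frame_step FR kn) l0 (frame_weight FR kn) (st j).
  apply: sqsummD => //; apply: sqsummZ.
  exact: (generator_sqZ j gf kn (az j) q2).
pose Y0 := projected (refl k) (c k) Yt0.
have Y0P w : reflected_at (refl k) (c k) Y0 Yt0 w by exact: projected_reflected_at.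
have ac : refl k -> forall j l, adapted (G k) (c k j l).
  by move=> rk j l; exact: (costs_adapted cc).
have aY0 : forall j, adapted (G k) (Y0 j) := projected_adapted aYt0 ac.
have qY0 : forall j, sqsumm (Y0 j).
  apply: (projected_sqsumm sk aYt0 ac qYt0) => rk j l; exact: (costs_sq cc).
exists (fun m => if m == k then Y0 else Y m),
  (fun m => if m == k then Yt0 else Yt m),
  (fun m => if m == k then e0 else e m),
  (fun m => if m == k then Z0 else Z m).
split.
- by rewrite gtn_eqF.
- move=> m j /andP[km mn]; case: eqP => [->|/eqP mk]; first by split.
  by apply: Ya; rewrite mn andbT ltn_neqAle eq_sym mk.
- move=> m /andP[km mn]; case: (eqVneq m k) => [->|mk].
    by rewrite gtn_eqF//; split.
  rewrite gtn_eqF; last by rewrite ltnS.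
  by apply: Ys; rewrite mn andbT ltn_neqAle eq_sym mk.
Qed.

(** * Adapted choices with finitely many values *)

(** Adaptedness of a variable with values in a finite type, without a
    sigma-algebra on that type. *)
Definition fevent (I : finType) GG (s : T -> I) := forall i, GG [set w | s w = i].

Lemma subalgU GG A B : subalg GG -> GG A -> GG B -> GG (A `|` B).
Proof.
move=> sG GA GB; have : <<s GG >> (A `|` B).
  by apply: (@measurableU _ (g_sigma_algebraType GG)); exact: sub_sigma_algebra.
by rewrite (subalgE sG).
Qed.

Lemma subalgI GG A B : subalg GG -> GG A -> GG B -> GG (A `&` B).
Proof.
move=> sG GA GB; have : <<s GG >> (A `&` B).
  by apply: (@measurableI _ (g_sigma_algebraType GG)); exact: sub_sigma_algebra.
by rewrite (subalgE sG).
Qed.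

Lemma subalg0 GG : subalg GG -> GG set0.
Proof. by move=> [[]]. Qed.

Lemma subalgC GG A : subalg GG -> GG A -> GG (~` A).
Proof.
move=> sG GA; have : <<s GG >> (~` A).
  by apply: (@measurableC _ (g_sigma_algebraType GG)); exact: sub_sigma_algebra.
by rewrite (subalgE sG).
Qed.

Lemma subalgT GG : subalg GG -> GG setT.
Proof. by move=> sG; rewrite -setC0; apply: subalgC => //; exact: subalg0. Qed.

Lemma fevent_mem (I : finType) GG (s : T -> I) (r : seq I) : subalg GG ->
  fevent GG s -> GG [set w | s w \in r].
Proof.
move=> sG Gs; elim: r => [|i r IH].
  rewrite (_ : [set w | _] = set0); first exact: subalg0.
  by apply/seteqP; split.
rewrite (_ : [set w | _] = [set w | s w = i] `|` [set w | s w \in r]).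
  exact: subalgU.
apply/seteqP; split => w /=; rewrite inE.
  by move=> /orP[/eqP|]; [left|right].
by move=> [->|->]; rewrite ?eqxx ?orbT.
Qed.

Lemma fevent_comp (I J : finType) GG (s : T -> I) (g : I -> J) : subalg GG ->
  fevent GG s -> fevent GG (fun w => g (s w)).
Proof.
move=> sG Gs j.
rewrite (_ : [set w | _] = [set w | s w \in enum [pred i | g i == j]]).
  exact: fevent_mem.
by apply/seteqP; split => w /=; rewrite mem_enum inE => /eqP.
Qed.

Lemma fevent_ffun (I : finType) GG (b : I -> T -> bool) : subalg GG ->
  (forall i, GG [set w | b i w]) ->
  fevent GG (fun w => [ffun i => b i w]).
Proof.
move=> sG Gb v.
have Gb' i : GG [set w | b i w = v i].
  case: (v i); first exact: Gb.
  rewrite (_ : [set w | _] = ~` [set w | b i w]); first exact: subalgC.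
  by apply/seteqP; split => w /=; case: (b i w).
have H1 (r : seq I) : GG [set w | all (fun i => b i w == v i) r].
  elim: r => [|i r IH].
    rewrite (_ : [set w | _] = setT); first exact: subalgT.
    by apply/seteqP; split.
  rewrite (_ : [set w | _] = [set w | b i w = v i] `&`
     [set w | all (fun i => b i w == v i) r]); first exact: subalgI.
  by apply/seteqP; split => w /=; [case/andP => /eqP|case=> -> ->; rewrite eqxx].
rewrite (_ : [set w | _] = [set w | all (fun i => b i w == v i) (enum I)])//.
apply/seteqP; split => w /=.
  by move=> <-; apply/allP => i _; rewrite ffunE.
by move=> /allP bv; apply/ffunP => i; rewrite ffunE; apply/eqP/bv; rewrite mem_enum.
Qed.

Lemma adapted_eq_event GG X X' : subalg GG -> adapted GG X -> adapted GG X' ->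
  GG [set w | X w == X' w].
Proof.
move=> sG aX aX'.
rewrite (_ : [set w | _] = (fun w => X w - X' w) @^-1` [set 0]).
  have aD : adapted GG (fun w => X w - X' w) := measurable_funB aX aX'.
  exact: (adapted_pre sG aD (measurable_set1 _)).
by apply/seteqP; split => w /=; rewrite -subr_eq0 => /eqP.
Qed.

(** At a reflection date sel m j is a component attaining the maximum that defines
    Y m j, at the other dates it is j; it is adapted because it is a function of
    finitely many events. *)
Lemma selection refl eps c xi f Y Yt e Z : scheme refl c xi f Y Yt e Z ->
  costs refl eps c ->
  exists sel : nat -> 'I_d -> T -> 'I_d,
    (forall m j, (m < n)%N -> fevent (G m) (sel m j)) /\
    (forall m, (m < n)%N -> {ae P, forall w, forall j,
       Y m j w = Yt m (sel m j w) w -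
                 (if refl m then c m j (sel m j w) w else 0) /\
       (~~ refl m -> sel m j w = j)}).
Proof.
move=> sc cc.
pose b m j l w := Y m j w == Yt m l w - c m j l w.
exists (fun m j w => if refl m then odflt j [pick l | b m j l w] else j).
split.
  move=> m j mn; have sG := fsub (ltnW mn); case: (boolP (refl m)) => rm; last first.
    move=> l; have [->|jl] := eqVneq j l.
      by rewrite (_ : [set w | _] = setT); [exact: subalgT|apply/seteqP; split].
    rewrite (_ : [set w | _] = set0); first exact: subalg0.
    by apply/seteqP; split => w //= /eqP; rewrite (negbTE jl).
  have Gb : fevent (G m) (fun w => [ffun l => b m j l w]).
    apply: fevent_ffun => // l; apply: adapted_eq_event => //.
      by apply: (sch_adapted sc); exact: ltnW.
    apply: measurable_funB; first exact: (sch_tadapted sc).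
    exact: (costs_adapted cc).
  have := fevent_comp (fun v : {ffun 'I_d -> bool} => odflt j [pick l | v l]) sG Gb.
  rewrite (_ : (fun w => _) = (fun w => odflt j [pick l | b m j l w]))//.
  apply/funext => w; congr odflt; apply: eq_pick => l.
  by rewrite ffunE.
move=> m mn; apply: filterS (sch_refl sc mn) => w; rewrite /reflected_at.
case: (boolP (refl m)) => rm Yw j; last by rewrite subr0 Yw.
split=> //; have [_ [l Yl]] := Yw j.
by case: pickP => [l'|/(_ l)]; rewrite /b ?Yl ?eqxx// => /eqP.
Qed.

(** * Switching routes *)

(** The optimal strategy started at time k in component j: at the date m it leaves
    route m for route m.+1, chosen by sel m. *)
Fixpoint route_from (sel : nat -> 'I_d -> T -> 'I_d) k j N w : 'I_d :=
  if N is N'.+1 then sel (k + N')%N (route_from sel k j N' w) w else j.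

Definition route sel k j m w := route_from sel k j (m - k) w.

Lemma route0 sel k j w : route sel k j k w = j.
Proof. by rewrite /route subnn. Qed.

Lemma routeS sel k j m w : (k <= m)%N ->
  route sel k j m.+1 w = sel m (route sel k j m w) w.
Proof. by move=> km; rewrite /route subSn//= subnKC. Qed.

Lemma fevent_cst GG (I : finType) (i : I) : subalg GG -> fevent GG (fun=> i).
Proof.
move=> sG l; have [->|jl] := eqVneq i l.
  by rewrite (_ : [set w | _] = setT); [exact: subalgT|apply/seteqP; split].
rewrite (_ : [set w | _] = set0); first exact: subalg0.
by apply/seteqP; split => w //= /eqP; rewrite (negbTE jl).
Qed.

Lemma fevent_bind (GG : set_system T) (s : T -> 'I_d) (t : 'I_d -> T -> 'I_d) :
  subalg GG ->
  fevent GG s -> (forall j, fevent GG (t j)) -> fevent GG (fun w => t (s w) w).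
Proof.
move=> sG Gs Gt l.
have H1 (r : seq 'I_d) : GG [set w | has (fun j => (s w == j) && (t j w == l)) r].
  elim: r => [|j r IH].
    rewrite (_ : [set w | _] = set0); first exact: subalg0.
    by apply/seteqP; split.
  rewrite (_ : [set w | _] = ([set w | s w = j] `&` [set w | t j w = l]) `|`
     [set w | has (fun j => (s w == j) && (t j w == l)) r]).
    by apply: subalgU => //; apply: subalgI => //; exact: Gt.
  apply/seteqP; split => w /=.
    by move=> /orP[/andP[/eqP ? /eqP ?]|]; [left|right].
  by move=> [[-> ->]|->]; rewrite ?eqxx ?orbT.
rewrite (_ : [set w | _] =
  [set w | has (fun j => (s w == j) && (t j w == l)) (enum 'I_d)])//.
apply/seteqP; split => w /=.
  by move=> tl; apply/hasP; exists (s w); rewrite ?mem_enum// eqxx tl eqxx.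
by move=> /hasP[j _ /andP[/eqP -> /eqP]].
Qed.

Lemma route_fevent sel k j m :
  (forall m j, (m < n)%N -> fevent (G m) (sel m j)) ->
  (k <= m < n)%N ->
  fevent (G m) (route sel k j m) /\ fevent (G m) (route sel k j m.+1).
Proof.
move=> Gsel.
have next m' : (k <= m' < n)%N -> fevent (G m') (route sel k j m') ->
    fevent (G m') (route sel k j m'.+1).
  move=> /andP[km mn] Gm; rewrite (_ : route sel k j m'.+1 =
     fun w => sel m' (route sel k j m' w) w); last first.
    by apply/funext => w; rewrite routeS.
  apply: fevent_bind => //; first exact: fsub (ltnW mn).
  by move=> i; exact: Gsel.
elim: m => [|m IH] kmn; have /andP[km mn] := kmn.
  have k0 : k = 0%N by apply/eqP; rewrite -leqn0.
  have GG : fevent (G 0%N) (route sel k j 0).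
    rewrite (_ : route _ _ _ _ = fun=> j); last first.
      by apply/funext => w; rewrite k0 route0.
    by apply: fevent_cst; exact: fsub.
  by split => //; exact: next.
have Gm1 : fevent (G m.+1) (route sel k j m.+1).
  move: km; rewrite leq_eqVlt => /orP[/eqP km|].
    rewrite (_ : route _ _ _ _ = fun=> j); last first.
      by apply/funext => w; rewrite km route0.
    by apply: fevent_cst; exact: fsub (ltnW mn).
  rewrite ltnS => km l; apply: (frame_mono FR (ltnW mn)).
  by apply: (IH _).2; rewrite km ltnW.
by split => //; exact: next.
Qed.

End Schemes.

(** * Comparison and domination *)

Section Comparison.
Context (disp : measure_display) (T : measurableType disp) (R : realType)
  (P : probability T R).
Implicit Types (X : T -> R).
Local Notation sqsumm := (sqsumm P).
Local Notation step_condexp := (step_condexp P).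
Context (n d : nat) (Tm LZ Lam : R) (G : nat -> set_system T)
    (h lam : nat -> R) (H : nat -> 'I_d -> T -> R).
Hypothesis FR : frame P n Tm LZ Lam G h lam H.
Local Notation generator := (generator P n LZ G).
Local Notation costs := (costs P n G).
Local Notation scheme := (scheme P n G h H).
Local Notation steps := (steps P n G H).

Let fsub m : (m <= n)%N -> subalg (G m). Proof. exact: (frame_sub FR). Qed.

Lemma step_mono m X1 X2 e1 e2 z1 z2 : (m < n)%N ->
  step_condexp (G m) (H m) X1 e1 z1 -> step_condexp (G m) (H m) X2 e2 z2 ->
  {ae P, forall w, X1 w <= X2 w} ->
  {ae P, forall w, h m * (LZ * nrm (fun a => z2 a w - z1 a w)) <= e2 w - e1 w}.
Proof.
move=> mn s1 s2 X12; have /andP[l0 _] := frame_lam FR mn.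
have X0 : {ae P, forall w, 0 <= X2 w - X1 w}.
  by apply: filterS X12 => w; rewrite subr_ge0.
have := step_ge0 (fsub (ltnW mn)) (frame_step FR mn) l0 (frame_lip FR)
  (frame_weight FR mn) (frame_bound FR mn) X0 (step_sub (fsub (ltnW mn)) s2 s1).
by apply: filterS => w; rewrite mulrA.
Qed.

Lemma down_ind (Q : nat -> Prop) : Q n ->
  (forall m, (m < n)%N -> Q m.+1 -> Q m) -> forall m, (m <= n)%N -> Q m.
Proof.
move=> Qn QS m mn; rewrite -(subKn mn); elim: (n - m)%N (leq_subr m n) => [|N IH] Nn.
  by rewrite subn0.
have E : (n - N)%N = (n - N.+1).+1 by lia.
by apply: QS; [lia|rewrite -E; apply: IH; lia].
Qed.

(** A backward step is monotone because the difference of the conditional means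
    exceeds what the Lipschitz generator can take back; a reflection is monotone
    because the projection is a maximum that decreases with the costs. *)
Theorem comparison refl c c' xi xi' f f' Y Yt e Z Y' Yt' e' Z' :
  generator f' ->
  scheme refl c xi f Y Yt e Z -> scheme refl c' xi' f' Y' Yt' e' Z' ->
  (forall m j l w, c m j l w <= c' m j l w) ->
  (forall j w, xi' j w <= xi j w) ->
  (forall m j w x, f' m j w x <= f m j w x) ->
  (forall m, (m <= n)%N -> {ae P, forall w, forall j, Y' m j w <= Y m j w}) /\
  (forall m, (m < n)%N -> {ae P, forall w, forall j, Yt' m j w <= Yt m j w}).
Proof.
move=> gf' sc sc' cc xx ff.
have tilde m : (m < n)%N -> {ae P, forall w, forall j, Y' m.+1 j w <= Y m.+1 j w} ->
    {ae P, forall w, forall j, Yt' m j w <= Yt m j w}.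
  move=> mn Ym; have hm := frame_step FR mn.
  have /filter_forall Em : forall j, {ae P, forall w,
      h m * (LZ * nrm (fun a => Z m j a w - Z' m j a w)) <= e m j w - e' m j w}.
    move=> j; apply: (step_mono mn (sch_step sc' j mn) (sch_step sc j mn)).
    by apply: filterS Ym => w.
  apply: filterS2 Em (filterI (sch_tilde sc mn) (filterI (sch_tilde sc' mn)
    (generator_lip gf' mn))) => w Ew [Ytw [Yt'w L]] j.
  rewrite Yt'w Ytw; have := L j (fun a => Z m j a w) (fun a => Z' m j a w).
  rewrite ler_norml => /andP[L1 _]; have := ff m j w (fun a => Z m j a w).
  have := Ew j; set N := nrm _ in L1 * => E1 F1.
  have : h m * (f m j w (fun a => Z m j a w) - f' m j w (fun a => Z' m j a w)) >=
     h m * - (LZ * N) by rewrite ler_wpM2l ?(ltW hm)//; lra.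
  by lra.
have main m : (m <= n)%N -> {ae P, forall w, forall j, Y' m j w <= Y m j w}.
  move: m; apply: down_ind.
    by apply: aeW => w j; rewrite (sch_last sc) (sch_last sc').
  move=> m mn IH; have := tilde m mn IH.
  apply: filterS3 (sch_refl sc mn) (sch_refl sc' mn) => w.
  rewrite /reflected_at; case: (refl m) => Yw Y'w tw j; last by rewrite Yw Y'w.
  have [_ [l ->]] := Y'w j; have [/(_ l) le _] := Yw j.
  by apply: le_trans le; apply: lerB.
by split => // m mn; apply: tilde => //; exact: main.
Qed.

(** The scheme without reflection, with generator LZ |z| + fb and terminal value xb,
    dominates the absolute value of every component: the generator is dominated,
    and a reflection moves a component between -Yt m j and the largest Yt m l. *)
Lemma dominating refl eps c xi f Y Yt e Z fb xb : (0 < d)%N -> 0 <= eps ->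
  generator f -> costs refl eps c -> scheme refl c xi f Y Yt e Z ->
  (forall m, (m < n)%N -> adapted (G m) (fb m) /\ sqsumm (fb m)) ->
  (forall m j w, `|f m j w (fun=> 0)| <= fb m w) ->
  adapted (G n) xb -> sqsumm xb -> (forall j w, `|xi j w| <= xb w) ->
  exists yb eb zb, [/\ steps 0 yb eb zb, (forall w, yb n w = xb w),
    (forall m, (m < n)%N -> {ae P, forall w,
       yb m w = eb m w + h m * (LZ * nz (zb m) w + fb m w)}) &
    (forall m, (m <= n)%N ->
       {ae P, forall w, forall j, `|Y m j w| <= yb m w})].
Proof.
move=> d0 eps0 gf co sc fbq fb0 axb qxb xib.
pose g m (j : 'I_d) w (x : 'I_d -> R) := LZ * nrm x + fb m w.
have gg : generator g.
  split.
  - move=> m j z mn az; apply: measurable_funD; last by case: (fbq m mn).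
    apply: measurable_funM; first exact: measurable_cst.
    exact: adapted_nrm.
  - move=> m mn; apply: aeW => w j x x'; rewrite /g opprD addrACA subrr addr0.
    rewrite -mulrBr normrM ger0_norm ?(frame_lip FR)// ler_wpM2l ?(frame_lip FR)//.
    have t1 := nrm_triangle (fun a => x a - x' a) x'.
    have t2 := nrm_triangle (fun a => x' a - x a) x.
    have E1 : (fun a => x a - x' a + x' a) = x by apply/funext => a; rewrite subrK.
    have E2 : (fun a => x' a - x a + x a) = x' by apply/funext => a; rewrite subrK.
    have E3 : nrm (fun a => x' a - x a) = nrm (fun a => x a - x' a).
      by rewrite /nrm; congr Num.sqrt; apply: eq_bigr => a _; rewrite -sqrrN opprB.
    rewrite E1 in t1; rewrite E2 E3 in t2.
    by rewrite ler_norml; apply/andP; split; lra.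
  - move=> m j mn; apply: sqsummD; last by case: (fbq m mn).
    exact: sqsumm_cst.
have c0 : costs xpred0 0 (fun _ (_ _ : 'I_d) _ => 0) by split.
have [Yb [Ytb [eb [Zb sb]]]] := scheme_exists FR (xi := fun=> xb) gg c0
  (fun=> axb) (fun=> qxb).
pose j0 := Ordinal d0.
exists (Yb^~ j0), (eb^~ j0), (Zb^~ j0).
have ybE m : (m < n)%N -> {ae P, forall w,
   Yb m j0 w = eb m j0 w + h m * (LZ * nz (Zb m j0) w + fb m w)}.
  move=> mn; apply: filterS2 (sch_tilde sb mn) (sch_refl sb mn) => w -/(_ j0) E.
  by rewrite /reflected_at => ->; rewrite E.
split.
- split => [m mn|m mn].
    by split; [exact: (sch_adapted sb)|exact: (sch_sq sb)].
  exact: (sch_step sb).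
- by move=> w; rewrite (sch_last sb).
- exact: ybE.
apply: down_ind; first by apply: aeW => w j; rewrite (sch_last sb) (sch_last sc).
move=> m mn IH; have hm := frame_step FR mn.
(* The positivity of a backward step is applied to Yb - Y and to Yb + Y. *)
have sbj := sch_step sb j0 mn.
have /filter_forall up : forall j, {ae P, forall w,
   h m * (LZ * nrm (fun a => Zb m j0 a w - Z m j a w)) <= eb m j0 w - e m j w}.
  move=> j; apply: (step_mono mn (sch_step sc j mn) sbj).
  by apply: filterS IH => w /(_ j); apply: le_trans; exact: ler_norm.
have /filter_forall dn : forall j, {ae P, forall w,
   h m * (LZ * nrm (fun a => Zb m j0 a w + Z m j a w)) <= eb m j0 w + e m j w}.
  move=> j; have /andP[l0 _] := frame_lam FR mn.
  have sl := step_lin (fsub (ltnW mn)) 1 sbj (sch_step sc j mn).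
  have X0 : {ae P, forall w, 0 <= Yb m.+1 j0 w + 1 * Y m.+1 j w}.
    apply: filterS IH => w /(_ j); rewrite ler_norml => /andP[+ _].
    by rewrite mul1r; lra.
  have := step_ge0 (fsub (ltnW mn)) hm l0 (frame_lip FR)
    (frame_weight FR mn) (frame_bound FR mn) X0 sl.
  apply: filterS => w; rewrite mul1r -mulrA.
  suff -> : (fun a => Zb m j0 a w + 1 * Z m j a w) = (fun a => Zb m j0 a w + Z m j a w) by [].
  by apply/funext => a; rewrite mul1r.
have tb : {ae P, forall w, forall j, `|Yt m j w| <= Yb m j0 w}.
  apply: filterS3 (filterI (sch_tilde sc mn) (generator_lip gf mn)) (filterI up dn)
    (ybE m mn) => w [Ytw L] [upw dnw] Ybw j.
  have Lj := L j (fun a => Z m j a w) (fun=> 0).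
  have E0 : (fun a => Z m j a w - 0) = (fun a => Z m j a w).
    by apply/funext => a; rewrite subr0.
  rewrite E0 in Lj; have fj := fb0 m j w.
  have fZ : `|f m j w (fun a => Z m j a w)| <= fb m w + LZ * nrm (fun a => Z m j a w).
    rewrite -(subrK (f m j w (fun=> 0)) (f m j w (fun a => Z m j a w))).
    by apply: le_trans (ler_normD _ _) _; rewrite addrC lerD.
  have t1 := nrm_triangle (fun a => Zb m j0 a w + Z m j a w) (fun a => - Zb m j0 a w).
  have t2 := nrm_triangle (fun a => Zb m j0 a w) (fun a => - (Zb m j0 a w - Z m j a w)).
  have nN (x : 'I_d -> R) : nrm (fun a => - x a) = nrm x.
    by rewrite /nrm; congr Num.sqrt; apply: eq_bigr => a _; rewrite sqrrN.
  have E1 : (fun a => Zb m j0 a w + Z m j a w - Zb m j0 a w) = (fun a => Z m j a w).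
    by apply/funext => a; ring.
  have E2 : (fun a => Zb m j0 a w + - (Zb m j0 a w - Z m j a w)) = (fun a => Z m j a w).
    by apply/funext => a; ring.
  rewrite E1 nN in t1; rewrite E2 nN in t2.
  have := upw j; have := dnw j; rewrite Ybw /nz Ytw.
  move: t1 t2 fZ; rewrite ler_norml.
  set N := nrm (fun a => Z m j a w); set Nb := nrm (fun a => Zb m j0 a w).
  set Np := nrm (fun a => Zb m j0 a w + Z m j a w).
  set Nm := nrm (fun a => Zb m j0 a w - Z m j a w).
  set F := f m j w _ => t1 t2 /andP[F1 F2] d1 u1.
  have lz := frame_lip FR.
  have p1 : LZ * N <= LZ * (Np + Nb) by rewrite ler_wpM2l.
  have p2 : LZ * N <= LZ * (Nb + Nm) by rewrite ler_wpM2l.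
  have q1 : h m * F <= h m * (fb m w + LZ * (Nb + Nm)).
    by rewrite ler_wpM2l ?(ltW hm)//; lra.
  have q2 : h m * - (fb m w + LZ * (Np + Nb)) <= h m * F.
    by rewrite ler_wpM2l ?(ltW hm)//; lra.
  by rewrite ler_norml; apply/andP; split; lra.
move: tb; case: (boolP (refl m)) => rm; last first.
  apply: filterS2 (sch_refl sc mn) => w; rewrite /reflected_at (negbTE rm).
  by move=> Yw tw j; rewrite Yw.
apply: filterS3 (sch_refl sc mn) (filterI (costs_diag co mn rm) (costs_lower co mn rm)) => w.
rewrite /reflected_at rm => Yw [c0w clw] tw j.
have [Y1 [l Yl]] := Yw j.
rewrite ler_norml; apply/andP; split.
  apply: le_trans (Y1 j); rewrite c0w subr0.
  by have := tw j; rewrite ler_norml => /andP[].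
rewrite Yl; have := tw l; rewrite ler_norml => /andP[_ t2].
suff : 0 <= c m j l w by lra.
have [->|jl] := eqVneq j l; first by rewrite c0w.
exact: le_trans (clw _ _ jl).
Qed.

End Comparison.

(** * Schemes along a switching route *)

Section PathBounds.
Context (disp : measure_display) (T : measurableType disp) (R : realType)
  (P : probability T R).
Implicit Types (X : T -> R).
Local Notation mean := (mean P).
Local Notation sqsumm := (sqsumm P).
Local Notation step_condexp := (step_condexp P).
Context (n d : nat) (Tm LZ Lam : R) (G : nat -> set_system T)
    (h lam : nat -> R) (H : nat -> 'I_d -> T -> R).
Hypothesis FR : frame P n Tm LZ Lam G h lam H.
Local Notation generator := (generator P n LZ G).
Local Notation costs := (costs P n G).
Local Notation scheme := (scheme P n G h H).
Local Notation steps := (steps P n G H).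
Local Notation Ce := (energy_cst Tm LZ Lam).

Let fsub m : (m <= n)%N -> subalg (G m). Proof. exact: (frame_sub FR). Qed.

Let sq0 X : 0 <= mean (fun w => X w ^+ 2).
Proof. by apply: mean_ge0 => w; exact: sqr_ge0. Qed.

Lemma weighted_ge0 k (x : nat -> R) : (forall m, (k <= m < n)%N -> 0 <= x m) ->
  0 <= \sum_(k <= m < n) h m * x m.
Proof.
move=> x0; rewrite big_nat_cond sumr_ge0// => m; rewrite andbT => kmn.
rewrite mulr_ge0 ?x0//; case/andP: kmn => _ mn; exact: ltW (frame_step FR mn).
Qed.

Lemma energy_cst_ge1 : (0 < n)%N -> 1 <= Ce.
Proof.
move=> n0; have L0 := frame_Lam_gt0 FR n0; have T0 := frame_Tm_ge0 FR.
have M1 : 1 <= growth Tm LZ Lam.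
  rewrite /growth -expR0 ler_expR mulr_ge0//.
  by apply: le_trans (mu_ge1 FR n0).
have M0 := growth_gt0 Tm LZ Lam.
have W0 : 0 <= 16 * growth Tm LZ Lam * LZ ^+ 2 * Tm * Lam.
  by rewrite !mulr_ge0 ?(frame_lip FR) ?(ltW M0) ?(ltW L0).
rewrite /energy_cst -[1]mulr1 ler_pM//; lra.
Qed.

Definition dom_cst : R := 4 * (1 + Tm + 4 * (LZ ^+ 2 * Tm * Lam) * Ce).

(** The dominating scheme is itself dominated, against adapted tests, by a single
    square integrable variable, its drift. *)
Lemma dominating_bound yb eb zb fb : (0 < n)%N -> steps 0 yb eb zb ->
  (forall m, (m < n)%N -> sqsumm (fb m) /\ forall w, 0 <= fb m w) ->
  (forall m, (m <= n)%N -> {ae P, forall w, 0 <= yb m w}) ->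
  (forall m, (m < n)%N -> {ae P, forall w,
       yb m w = eb m w + h m * (LZ * nz (zb m) w + fb m w)}) ->
  exists zt, [/\ sqsumm zt,
    (forall m c, (m <= n)%N -> adapted (G m) c -> sqsumm c ->
      (forall w, 0 <= c w) ->
      mean (fun w => c w * yb m w) <= mean (fun w => c w * zt w)) &
    mean (fun w => zt w ^+ 2) <= dom_cst * (mean (fun w => yb n w ^+ 2) +
      \sum_(0 <= m < n) h m * mean (fun w => fb m w ^+ 2))].
Proof.
move=> n0 S fbq yb0 ybE.
pose b (m : nat) (w : T) : R := 0.
have bq m : (0 <= m < n)%N -> [/\ adapted (G m) (b m), sqsumm (b m) & forall w, 0 <= b m w].
  by split => //; [exact: measurable_cst|exact: sqsumm_cst].
have yle m : (0 <= m < n)%N -> {ae P, forall w,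
  yb m w <= eb m w + h m * (LZ * nz (zb m) w + fb m w) + b m w}.
  by move=> mn; apply: filterS (ybE m mn) => w ->; rewrite addr0.
have EB := energy_bound FR (leq0n n) S fbq bq yb0 yle.
have DB := drift_sqr_bound FR (leq0n n) S fbq bq.
exists (drift n LZ h 0 yb zb fb b); split.
- exact: (sqsumm_drift FR (leq0n n) S fbq bq).
- move=> m c mn ac qc c0.
  exact: (drift_dominates FR (leq0n n) S fbq bq yle mn ac qc c0).
have B0 : mean (fun w => (\sum_(0 <= m < n) b m w) ^+ 2) = 0.
  rewrite -[RHS](mean_cst P 0); congr mean; apply/funext => w.
  by rewrite big1// expr0n.
rewrite B0 addr0 in EB; rewrite B0 addr0 in DB.
apply: le_trans DB _; rewrite /dom_cst.
set Xi := mean (fun w => yb n w ^+ 2) in EB *.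
set V := \sum_(0 <= m < n) _ * mean (fun w => nz _ w ^+ 2) in EB *.
set Ph := \sum_(0 <= m < n) _ * mean (fun w => fb _ w ^+ 2) in EB *.
have L0 := frame_Lam_gt0 FR n0; have T0 := frame_Tm_ge0 FR.
have Xi0 : 0 <= Xi by exact: sq0.
have Ph0 : 0 <= Ph by apply: weighted_ge0 => m _; exact: sq0.
have V1 : V <= 4 * Lam * (Ce * (Xi + Ph)).
  rewrite -ler_pdivrMl ?mulr_gt0//.
  by have := sq0 (yb 0%N); lra.
have LT : 0 <= LZ ^+ 2 * Tm by rewrite mulr_ge0 ?sqr_ge0.
have V2 : LZ ^+ 2 * Tm * V <= LZ ^+ 2 * Tm * (4 * Lam * (Ce * (Xi + Ph))).
  by rewrite ler_wpM2l.
have T1 := mulr_ge0 T0 Xi0.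
by lra.
Qed.

Lemma cost_cst_ge0 : (0 < n)%N -> 0 <= cost_cst Tm LZ Lam.
Proof.
move=> n0; have L0 := frame_Lam_gt0 FR n0; have T0 := frame_Tm_ge0 FR.
have M0 := growth_gt0 Tm LZ Lam.
have W0 : 0 <= 16 * growth Tm LZ Lam * LZ ^+ 2 * Tm * Lam.
  by rewrite !mulr_ge0 ?(frame_lip FR) ?(ltW M0) ?(ltW L0).
rewrite /cost_cst; set W := 16 * _ * _ * _ * _ in W0 *.
by have := mulr_ge0 W0 W0; lra.
Qed.

Definition switching_cst : R := cost_cst Tm LZ Lam * (1 + dom_cst).

Lemma switching_cst_ge0 : (0 < n)%N -> 0 <= switching_cst.
Proof.
move=> n0; have L0 := frame_Lam_gt0 FR n0; have T0 := frame_Tm_ge0 FR.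
have Ce0 : 0 <= Ce by exact: le_trans ler01 (energy_cst_ge1 n0).
rewrite mulr_ge0 ?cost_cst_ge0//.
have L1 : 0 <= LZ ^+ 2 * Tm * Lam * Ce.
  by rewrite mulr_ge0// mulr_ge0 ?(ltW L0)// mulr_ge0 ?sqr_ge0.
by rewrite /dom_cst; lra.
Qed.

Section Route.
Context (refl : pred nat) (eps : R) (c : nat -> 'I_d -> 'I_d -> T -> R)
  (xi : 'I_d -> T -> R) (f : nat -> 'I_d -> T -> ('I_d -> R) -> R)
  (Y Yt e : nat -> 'I_d -> T -> R) (Z : nat -> 'I_d -> 'I_d -> T -> R).
Hypotheses (gf : generator f) (co : costs refl eps c)
  (sc : scheme refl c xi f Y Yt e Z).
Context (sel : nat -> 'I_d -> T -> 'I_d).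
Hypothesis (Gsel : forall m j, (m < n)%N -> fevent (G m) (sel m j)).
Hypothesis (selP : forall m, (m < n)%N -> {ae P, forall w, forall j,
       Y m j w = Yt m (sel m j w) w -
                 (if refl m then c m j (sel m j w) w else 0) /\
       (~~ refl m -> sel m j w = j)}).
Context (k : nat) (j0 : 'I_d).
Hypothesis (kn : (k <= n)%N).
Local Notation s := (route sel k j0).

Let Gs m : (k <= m < n)%N -> fevent (G m) (s m) /\ fevent (G m) (s m.+1).
Proof. by move=> kmn; exact: (route_fevent FR j0 Gsel kmn). Qed.

Lemma route_fevent_le m : (k <= m <= n)%N -> fevent (G m) (s m).
Proof.
move=> /andP[km mn]; have [mn'|nm] := ltnP m n; first by apply: (Gs _).1; rewrite km.
have E : m = n by apply/eqP; rewrite eqn_leq mn.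
case: m km mn nm E => [|m] km mn nm E.
  rewrite (_ : s 0%N = fun=> j0); last first.
    by apply/funext => w; move: km; rewrite leqn0 => /eqP ->; rewrite route0.
  by apply: fevent_cst; exact: fsub.
move: km; rewrite leq_eqVlt => /orP[/eqP km|]; last first.
  rewrite ltnS => km l; apply: (frame_mono FR mn).
  by apply: (Gs _).2; rewrite km.
rewrite -km (_ : s k = fun=> j0); last first.
  by apply/funext => w; rewrite route0.
by apply: fevent_cst; exact: fsub.
Qed.

Lemma adapted_glue GG (t : T -> 'I_d) (X : 'I_d -> T -> R) : subalg GG ->
  fevent GG t -> (forall l, adapted GG (X l)) -> adapted GG (fun w => X (t w) w).
Proof.
move=> sG Gt aX.
rewrite glueE; apply: measurable_sum => l; apply: measurable_funM; last exact: aX.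
exact: adapted_indic (Gt l).
Qed.

Lemma sqsumm_route m (X : 'I_d -> T -> R) : (k <= m <= n)%N ->
  (forall l, sqsumm (X l)) -> sqsumm (fun w => X (s m w) w).
Proof.
move=> kmn qX; have /andP[_ mn] := kmn; apply: sqsumm_glue => // l.
by apply: (fsub mn).2; exact: route_fevent_le.
Qed.

(** Along a route a family of schemes indexed by the components is one scalar path:
    between m and m.+1 the component is route m.+1, known at time m. *)
Lemma steps_route (U v : nat -> 'I_d -> T -> R) (V : nat -> 'I_d -> 'I_d -> T -> R) :
  (forall m j, (m <= n)%N -> adapted (G m) (U m j)) ->
  (forall m j, (m <= n)%N -> sqsumm (U m j)) ->
  (forall m j, (m < n)%N -> step_condexp (G m) (H m) (U m.+1 j) (v m j) (V m j)) ->
  steps k (fun m w => U m (s m w) w) (fun m w => v m (s m.+1 w) w)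
          (fun m a w => V m (s m.+1 w) a w).
Proof.
move=> aU qU sU; split => m kmn; have /andP[km mn] := kmn.
  split; last by apply: sqsumm_route => // l; exact: qU.
  apply: adapted_glue; [exact: fsub|exact: route_fevent_le|].
  by move=> l; exact: aU.
apply: (step_glue (fsub (ltnW mn)) (X := U m.+1) (e := v m) (z := V m)).
  exact: (Gs kmn).2.
by move=> l; exact: sU.
Qed.

Definition switch m w : R := (refl m && (s m w != s m.+1 w))%:R.

(** The positive part makes the cost nonnegative everywhere, and not only almost
    surely. *)
Definition route_cost m w : R :=
  if refl m then Num.max (c m (s m w) (s m.+1 w) w) 0 else 0.

Lemma adapted_pair m (x : 'I_d -> 'I_d -> T -> R) : (k <= m < n)%N ->
  (forall j l, adapted (G m) (x j l)) ->
  adapted (G m) (fun w => x (s m w) (s m.+1 w) w).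
Proof.
move=> kmn ax; have /andP[_ mn] := kmn; have [G1 G2] := Gs kmn.
apply: (adapted_glue (X := fun j w => x j (s m.+1 w) w)) => //; first exact: fsub (ltnW mn).
by move=> j; apply: adapted_glue => //; exact: fsub (ltnW mn).
Qed.

Lemma sqsumm_pair m (x : 'I_d -> 'I_d -> T -> R) : (k <= m < n)%N ->
  (forall j l, sqsumm (x j l)) ->
  sqsumm (fun w => x (s m w) (s m.+1 w) w).
Proof.
move=> kmn qx; have /andP[km mn] := kmn.
have km1 : (k <= m.+1 <= n)%N by rewrite mn (leq_trans km).
apply: (sqsumm_route (m := m) (X := fun j w => x j (s m.+1 w) w)).
  by rewrite km ltnW.
move=> j; exact: (sqsumm_route km1).
Qed.

Lemma route_costP m : (k <= m < n)%N ->
  [/\ adapted (G m) (route_cost m), sqsumm (route_cost m) &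
      forall w, 0 <= route_cost m w].
Proof.
move=> kmn; have /andP[_ mn] := kmn; rewrite /route_cost.
case: (boolP (refl m)) => rm; last first.
  by split => //; [exact: measurable_cst|exact: sqsumm_cst].
have ac : adapted (G m) (fun w => Num.max (c m (s m w) (s m.+1 w) w) 0).
  apply: measurable_maxr => //; apply: (adapted_pair kmn) => j l.
  exact: (costs_adapted co).
have qc : sqsumm (fun w => c m (s m w) (s m.+1 w) w).
  by apply: (sqsumm_pair kmn) => j l; exact: (costs_sq co).
split=> //; last by move=> w; rewrite le_max lexx orbT.
apply: (sqsumm_dom _ (sqsumm_norm qc)).
  by apply: adapted_meas ac; exact: fsub (ltnW mn).
by move=> w; rewrite /Num.max; case: ifPn => //; rewrite normr0.
Qed.

Lemma switch_le_cost m : 0 <= eps -> (k <= m < n)%N ->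
  {ae P, forall w, eps * switch m w <= route_cost m w}.
Proof.
move=> eps0 kmn; have /andP[_ mn] := kmn; rewrite /switch /route_cost.
case: (boolP (refl m)) => rm; last by apply: aeW => w; rewrite mulr0.
apply: filterS (costs_lower co mn rm) => w clw.
have [_|ss] := eqVneq (s m w) (s m.+1 w); first by rewrite mulr0 le_max lexx orbT.
by rewrite mulr1 le_max clw.
Qed.

Lemma route_value m : (k <= m < n)%N -> 0 <= eps -> {ae P, forall w,
  Y m (s m w) w = Yt m (s m.+1 w) w - route_cost m w}.
Proof.
move=> kmn eps0; have /andP[km mn] := kmn; rewrite /route_cost.
have := selP mn; case: (boolP (refl m)) => rm; last first.
  by apply: filterS => w /(_ (s m w))[E _]; rewrite routeS// E.
apply: filterS2 (filterI (costs_diag co mn rm) (costs_lower co mn rm)) => w [c0w clw].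
move=> /(_ (s m w))[E _]; rewrite routeS// E max_l//.
set i := s m w; set l := sel m i w.
have [->|jl] := eqVneq i l; first by rewrite c0w.
exact: le_trans (clw _ _ jl).
Qed.

(** Along the route started in j0, the scheme is a path from which the switching
    costs are subtracted; the path is dominated, so the accumulated cost is bounded
    in L2 by the data, whatever the number of reflection dates. *)
Lemma route_cost_bound fb xb : (0 < n)%N -> (0 < d)%N -> 0 <= eps ->
  (forall m, (m < n)%N -> adapted (G m) (fb m) /\ sqsumm (fb m)) ->
  (forall m j w, `|f m j w (fun=> 0)| <= fb m w) ->
  adapted (G n) xb -> sqsumm xb -> (forall j w, `|xi j w| <= xb w) ->
  mean (fun w => (\sum_(k <= m < n) route_cost m w) ^+ 2) <=
  switching_cst * (mean (fun w => xb w ^+ 2) +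
     \sum_(0 <= m < n) h m * mean (fun w => fb m w ^+ 2)).
Proof.
move=> n0 d0 eps0 fbq fb0 axb qxb xib.
have [yb [eb [zb [Sb ybn ybE Yyb]]]] :=
  dominating FR d0 eps0 gf co sc fbq fb0 axb qxb xib.
have fbp m : (m < n)%N -> sqsumm (fb m) /\ forall w, 0 <= fb m w.
  move=> mn; split; first by case: (fbq m mn).
  by move=> w; apply: le_trans (fb0 m j0 w).
have yb0 m : (m <= n)%N -> {ae P, forall w, 0 <= yb m w}.
  by move=> mn; apply: filterS (Yyb m mn) => w /(_ j0); apply: le_trans.
have [zt [qzt dzt zt2]] := dominating_bound n0 Sb fbp yb0 ybE.
have S := steps_route (sch_adapted sc) (sch_sq sc) (sch_step sc).
have Cc0 := cost_cst_ge0 n0.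
pose q m w := h m * f m (s m.+1 w) w (fun a => Z m (s m.+1 w) a w).
have CB := cost_bound FR (q := q) (f := fb) (a := route_cost) (yb := yb) (zt := zt) n0 kn S.
apply: (@le_trans _ _ (cost_cst Tm LZ Lam * (mean (fun w => Y n (s n w) w ^+ 2) +
     \sum_(k <= m < n) h m * mean (fun w => fb m w ^+ 2) +
     mean (fun w => zt w ^+ 2)))).
  apply: CB => //.
  - by move=> m /andP[_ mn]; exact: fbp.
  - exact: route_costP.
  - move=> m kmn; have /andP[km mn] := kmn; apply: sqsummZ.
    have km1 : (k <= m.+1 <= n)%N by rewrite mn (leq_trans km).
    apply: (sqsumm_route km1 (X := fun l w => f m l w (fun a => Z m l a w))) => l.
    have /andP[l0 _] := frame_lam FR mn.
    apply: (generator_sqZ FR) => //.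
      by move=> a; have [_ _ /(_ a)[]] := sch_step sc l mn.
    exact: (step_sq (fsub (ltnW mn)) (frame_step FR mn) l0 (frame_weight FR mn)
       (sch_step sc l mn)).2.
  - move=> m kmn; have /andP[km mn] := kmn.
    apply: filterS2 (route_value kmn eps0) (sch_tilde sc mn) => w E Ytw.
    by rewrite E Ytw.
  - move=> m kmn; have /andP[km mn] := kmn; have hm := frame_step FR mn.
    apply: filterS (generator_lip gf mn) => w L.
    rewrite /q normrM (ger0_norm (ltW hm)) ler_wpM2l ?(ltW hm)//.
    set l := s m.+1 w; have := L l (fun a => Z m l a w) (fun=> 0).
    rewrite (_ : (fun a => _ - 0) = (fun a => Z m l a w)); last first.
      by apply/funext => a; rewrite subr0.
    have := fb0 m l w; rewrite -[X in _ -> _ -> `|X| <= _](subrK (f m l w (fun=> 0))).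
    by move=> f0 f1; apply: le_trans (ler_normD _ _) _; exact: lerD.
  - by move=> m /andP[_ mn]; apply: (proj1 Sb m _).2; exact: ltnW.
  - by move=> m /andP[_ mn]; apply: filterS (Yyb m (ltnW mn)) => w; exact.
  - by move=> m cc /andP[_ mn]; apply: dzt; exact: ltnW.
rewrite /switching_cst -mulrA ler_wpM2l//.
have E1 : mean (fun w => Y n (s n w) w ^+ 2) <= mean (fun w => xb w ^+ 2).
  apply: ler_mean; [|exact: sqsumm_sqr|].
    apply: sqsumm_sqr; apply: sqsumm_route => //; first by rewrite kn leqnn.
    by move=> l; exact: (sch_sq sc).
  apply: aeW => w; rewrite (sch_last sc) -(real_normK (num_real (xi _ w))).
  by rewrite lerXn2r ?nnegrE// (le_trans _ (xib (s n w) w)).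
have E2 : \sum_(k <= m < n) h m * mean (fun w => fb m w ^+ 2) <=
    \sum_(0 <= m < n) h m * mean (fun w => fb m w ^+ 2).
  rewrite [leRHS](big_cat_nat (n := k))//= lerDr big_nat_cond sumr_ge0// => m.
  rewrite andbT => /andP[_ mk]; rewrite mulr_ge0 ?sq0// ltW// (frame_step FR)//.
  exact: leq_trans kn.
have E3 : (fun w => yb n w ^+ 2) = (fun w => xb w ^+ 2).
  by apply/funext => w; rewrite ybn.
rewrite E3 in zt2.
by lra.
Qed.

Section Difference.
Context (c' : nat -> 'I_d -> 'I_d -> T -> R) (eps' : R)
  (xi' : 'I_d -> T -> R) (f' : nat -> 'I_d -> T -> ('I_d -> R) -> R)
  (Y' Yt' e' : nat -> 'I_d -> T -> R) (Z' : nat -> 'I_d -> 'I_d -> T -> R).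
Hypotheses (gf' : generator f') (co' : costs refl eps' c')
  (sc' : scheme refl c' xi' f' Y' Yt' e' Z').
Hypothesis cc : forall m j l w, c m j l w <= c' m j l w.
Hypothesis Yle : forall m, (m <= n)%N -> {ae P, forall w, forall j, Y' m j w <= Y m j w}.

Definition cost_gap m w : R :=
  if refl m then c' m (s m w) (s m.+1 w) w - c m (s m w) (s m.+1 w) w else 0.

Lemma cost_gapP m : (k <= m < n)%N ->
  [/\ adapted (G m) (cost_gap m), sqsumm (cost_gap m) &
      forall w, 0 <= cost_gap m w].
Proof.
move=> kmn; have /andP[_ mn] := kmn; rewrite /cost_gap.
case: (boolP (refl m)) => rm; last first.
  by split => //; [exact: measurable_cst|exact: sqsumm_cst].
split.
- apply: (adapted_pair kmn (x := fun j l w => c' m j l w - c m j l w)) => j l.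
  by apply: measurable_funB; [exact: (costs_adapted co')|exact: (costs_adapted co)].
- apply: (sqsumm_pair kmn (x := fun j l w => c' m j l w - c m j l w)) => j l.
  by apply: sqsummB; [exact: (costs_sq co')|exact: (costs_sq co)].
- by move=> w; rewrite subr_ge0.
Qed.

(** Without a change of component both costs vanish. *)
Lemma cost_gap_switch m S : (k <= m < n)%N -> (forall w, 0 <= S w) ->
  (refl m -> forall j l w, c' m j l w - c m j l w <= S w) ->
  {ae P, forall w, cost_gap m w <= switch m w * S w}.
Proof.
move=> kmn S0 cS; have /andP[_ mn] := kmn; rewrite /cost_gap /switch.
case: (boolP (refl m)) => rm; last by apply: aeW => w; rewrite mul0r.
apply: filterS2 (costs_diag co mn rm) (costs_diag co' mn rm) => w d1 d2.
have [->|ss] := eqVneq (s m w) (s m.+1 w); first by rewrite d1 d2 subrr mul0r.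
by rewrite mul1r; exact: cS.
Qed.

(** Both schemes are followed along the optimal route of the larger one. The smaller
    one is at least what the same switch would give it, so the difference is a
    nonnegative path whose reflecting process increases by the difference of the
    costs at the switches only. *)
Lemma route_difference (psi : nat -> T -> R) : 0 <= eps ->
  (forall m, (k <= m < n)%N -> sqsumm (psi m) /\ forall w, 0 <= psi m w) ->
  (forall m, (k <= m < n)%N -> {ae P, forall w, forall j,
     f m j w (fun a => Z m j a w) - f' m j w (fun a => Z m j a w) <= psi m w}) ->
  mean (fun w => (Y k j0 w - Y' k j0 w) ^+ 2) <=
  Ce * (mean (fun w => \sum_j (xi j w - xi' j w) ^+ 2) +
     \sum_(k <= m < n) h m * mean (fun w => psi m w ^+ 2) +
     mean (fun w => (\sum_(k <= m < n) cost_gap m w) ^+ 2)).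
Proof.
move=> eps0 psiq fpsi.
pose U m j w := Y m j w - Y' m j w.
pose v m j w := e m j w - e' m j w.
pose V m j a w := Z m j a w - Z' m j a w.
have aU m j : (m <= n)%N -> adapted (G m) (U m j).
  move=> mn; apply: measurable_funB; first exact: (sch_adapted sc).
  exact: (sch_adapted sc').
have qU m j : (m <= n)%N -> sqsumm (U m j).
  by move=> mn; apply: sqsummB; [exact: (sch_sq sc)|exact: (sch_sq sc')].
have sU m j : (m < n)%N -> step_condexp (G m) (H m) (U m.+1 j) (v m j) (V m j).
  move=> mn; apply: (step_sub (fsub (ltnW mn))); first exact: (sch_step sc).
  exact: (sch_step sc').
have S := steps_route aU qU sU.
have y0 m : (k <= m <= n)%N -> {ae P, forall w, 0 <= U m (s m w) w}.
  by move=> /andP[_ mn]; apply: filterS (Yle mn) => w Yw; rewrite subr_ge0.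
have yle m : (k <= m < n)%N -> {ae P, forall w,
  U m (s m w) w <= v m (s m.+1 w) w +
    h m * (LZ * nz (fun a w => V m (s m.+1 w) a w) w + psi m w) + cost_gap m w}.
  move=> kmn; have /andP[km mn] := kmn; have hm := frame_step FR mn.
  have Y'lo : {ae P, forall w, forall j l,
       Yt' m l w - (if refl m then c' m j l w else 0) <= Y' m j w \/ (~~ refl m /\ j != l)}.
    apply: filterS (sch_refl sc' mn) => w; rewrite /reflected_at.
    case: (refl m) => Y'w j l; first by left; case: (Y'w j).
    have [->|jl] := eqVneq j l; last by right.
    by left; rewrite subr0 Y'w.
  apply: filterS3 (filterI Y'lo (selP mn)) (filterI (sch_tilde sc mn) (sch_tilde sc' mn))
    (filterI (fpsi m kmn) (generator_lip gf' mn)) => w [lo selw] [Ytw Yt'w] [fw L].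
  have [Ys ns] := selw (s m w); rewrite -routeS// in Ys ns.
  set j := s m w in Ys ns *; set l := s m.+1 w in Ys ns *.
  have lo' : Yt' m l w - (if refl m then c' m j l w else 0) <= Y' m j w.
    have [//|[nr]] := lo j l; by rewrite ns// eqxx.
  have Ll := L l (fun a => Z m l a w) (fun a => Z' m l a w).
  rewrite ler_norml in Ll; move: Ll => /andP[_ L2].
  rewrite /U /v /nz /cost_gap -/l -/j Ys Ytw.
  move: lo'; rewrite Yt'w; have := fw l.
  have : h m * (f m l w (fun a => Z m l a w) - f' m l w (fun a => Z' m l a w)) <=
     h m * (LZ * nrm (fun a => V m l a w) + psi m w).
    rewrite ler_wpM2l ?(ltW hm)//.
    by have := fw l; lra.
  case: (refl m); lra.
have EB := energy_bound FR kn S psiq cost_gapP y0 yle.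
have n0Ce : 0 <= Ce.
  have [n0|n0] := posnP n; last exact: le_trans (energy_cst_ge1 n0).
  have T0 : Tm = 0 by rewrite -(frame_horizon FR) n0 big_geq.
  by rewrite /energy_cst T0 !(mulr0, mul0r, addr0) mulr_ge0// ltW// growth_gt0.
have kE : mean (fun w => (Y k j0 w - Y' k j0 w) ^+ 2) =
   mean (fun w => U k (s k w) w ^+ 2).
  by congr mean; apply/funext => w; rewrite route0.
rewrite kE; apply: le_trans; last (apply: le_trans EB _).
  rewrite lerDl; have [n0|n0] := posnP n; first by rewrite big_geq ?mulr0 ?n0.
  rewrite mulr_ge0 ?invr_ge0 ?mulr_ge0 ?(ltW (frame_Lam_gt0 FR n0))//.
  by apply: weighted_ge0 => m _; exact: sq0.
rewrite ler_wpM2l// !lerD2r.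
have nn : (k <= n <= n)%N by rewrite kn leqnn.
apply: ler_mean.
- apply: sqsumm_sqr; apply: (sqsumm_route nn) => l; exact: qU.
- apply: summ_sum => j _; apply: sqsumm_sqr.
  rewrite (_ : (fun w => _) = (fun w => U n j w)); first exact: qU.
  by apply/funext => w; rewrite /U (sch_last sc) (sch_last sc').
- apply: aeW => w; rewrite /U (sch_last sc) (sch_last sc').
  rewrite (bigD1 (s n w))//= lerDl; apply: sumr_ge0 => j _; exact: sqr_ge0.
Qed.

End Difference.
End Route.
End PathBounds.

(** * Two ordered schemes *)

Section Moment.
Context (disp : measure_display) (T : measurableType disp) (R : realType)
  (P : probability T R).
Local Notation mean := (mean P).
Local Notation summ := (summ P).
Local Notation sqsumm := (sqsumm P).

(** The number N of switches has a second moment bounded by the data, and is bounded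
    by 2 kap; the gap S has a moment of order p only. Below the level
    tau = kap^(2/p) |S|_p the former bound on N is used, above it the latter, and
    E[S^2; S > tau] <= tau^2 (E[S^p] / tau^p) balances the two terms. *)
Lemma switching_moment (N A B S : T -> R) (kap p eps : R) :
  1 <= kap -> 2 <= p -> 0 < eps ->
  measurable_fun setT N -> (forall w, 0 <= N w <= 2 * kap) ->
  sqsumm A -> {ae P, forall w, eps * N w <= A w} ->
  sqsumm B -> (forall w, 0 <= B w) -> {ae P, forall w, B w <= N w * S w} ->
  (forall w, 0 <= S w) -> summ (fun w => S w `^ p) ->
  mean (fun w => B w ^+ 2) <=
  (mean (fun w => A w ^+ 2) / eps ^+ 2 + 4) *
  (kap `^ (4 / p) * mean (fun w => S w `^ p) `^ (2 / p)).
Proof.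
move=> kap1 p2 eps0 mN Nk qA NA qB B0 BNS S0 sSp.
have p0 : 0 < p by lra.
have pn0 : p != 0 by rewrite gt_eqF.
have kap0 : 0 < kap by lra.
have qN : sqsumm N.
  apply: (sqsumm_dom mN (sqsumm_cst P (2 * kap))) => w.
  by have /andP[N0 NK] := Nk w; rewrite ger0_norm.
have sA2 := sqsumm_sqr qA; have sN2 := sqsumm_sqr qN; have sB2 := sqsumm_sqr qB.
have mN2 : mean (fun w => N w ^+ 2) <= mean (fun w => A w ^+ 2) / eps ^+ 2.
  rewrite ler_pdivlMr ?exprn_gt0// mulrC -meanZ//.
  apply: ler_mean => //; first exact: summZ.
  apply: filterS NA => w NAw; rewrite -exprMn.
  have /andP[Nw0 _] := Nk w; have eN : 0 <= eps * N w by rewrite mulr_ge0// ltW.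
  by rewrite lerXn2r// nnegrE// (le_trans eN).
set sp := mean (fun w => S w `^ p).
have sp0 : 0 <= sp by apply: mean_ge0 => w; exact: powR_ge0.
have A0 : 0 <= mean (fun w => A w ^+ 2) / eps ^+ 2.
  by rewrite divr_ge0 ?sqr_ge0//; apply: mean_ge0 => w; exact: sqr_ge0.
have [spz|spn] := eqVneq sp 0.
  have S0ae : {ae P, forall w, S w `^ p = 0}.
    apply: ge0_mean0_ae => //; first by move=> w; exact: powR_ge0.
    by rewrite -/sp spz.
  have -> : mean (fun w => B w ^+ 2) = 0.
    rewrite -[RHS](mean_cst P 0); apply: eq_mean => //; first exact: summ_cst.
    apply: filterS2 S0ae BNS => w Sw Bw.
    have S00 : S w = 0 by move/eqP: Sw; rewrite powR_eq0 pn0 andbT => /eqP.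
    have -> : B w = 0 by apply/eqP; rewrite eq_le B0 andbT; move: Bw; rewrite S00 mulr0.
    by rewrite expr0n.
  by rewrite mulr_ge0 ?mulr_ge0 ?powR_ge0//; lra.
have spp : 0 < sp by rewrite lt0r spn.
pose tau := kap `^ (2 / p) * sp `^ (1 / p).
have tau0 : 0 < tau by rewrite mulr_gt0// powR_gt0.
have tau2 : tau ^+ 2 = kap `^ (4 / p) * sp `^ (2 / p).
  rewrite /tau exprMn -!powR_mulrn ?powR_ge0// -!powRrM.
  by congr (_ `^ _ * _ `^ _); field; rewrite pn0.
have taup : tau `^ p = kap ^+ 2 * sp.
  rewrite /tau powRM ?powR_ge0// -!powRrM -powR_mulrn ?(ltW kap0)//.
  rewrite (_ : 2 / p * p = 2); last by field.
  by rewrite (_ : 1 / p * p = 1) ?powRr1//; field.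
have Sle w : B w <= N w * S w ->
   B w ^+ 2 <= tau ^+ 2 * N w ^+ 2 + 4 * tau ^+ 2 / sp * S w `^ p.
  move=> Bw; have /andP[N0 NK] := Nk w.
  have B2 : B w ^+ 2 <= N w ^+ 2 * S w ^+ 2.
    by rewrite -exprMn lerXn2r// nnegrE// mulr_ge0.
  have [St|tS] := leP (S w) tau.
    apply: le_trans B2 _; rewrite mulrC -[leLHS]addr0 lerD//.
      by rewrite ler_wpM2r ?sqr_ge0// lerXn2r ?nnegrE// ltW.
    by rewrite !(mulr_ge0, invr_ge0, powR_ge0, sp0, (ltW tau0)) ?mulr_ge0 ?(ltW tau0).
  have r1 : 1 <= S w / tau by rewrite ler_pdivlMr// mul1r ltW.
  have rp : (S w / tau) ^+ 2 <= S w `^ p / (kap ^+ 2 * sp).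
    rewrite -taup -powR_mulrn; last exact: le_trans ler01 r1.
    apply: (le_trans (ler_powR r1 p2)).
    rewrite le_eqVlt; apply/orP; left; apply/eqP.
    have -> : S w `^ p = (S w / tau) `^ p * tau `^ p.
      by rewrite -powRM ?(ltW tau0) ?(le_trans ler01 r1)// divfK// gt_eqF.
    by rewrite mulfK// gt_eqF// powR_gt0.
  apply: le_trans B2 _; rewrite -[leLHS]add0r; apply: lerD.
    by rewrite mulr_ge0 ?sqr_ge0.
  have S2 : S w ^+ 2 <= tau ^+ 2 * (S w `^ p / (kap ^+ 2 * sp)).
    apply: le_trans (ler_wpM2l (sqr_ge0 tau) rp).
    by rewrite -exprMn mulrCA mulfV ?mulr1// gt_eqF.
  have N2 : N w ^+ 2 <= (2 * kap) ^+ 2.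
    by rewrite lerXn2r// nnegrE; lra.
  apply: (le_trans (ler_pM (sqr_ge0 _) (sqr_ge0 _) N2 S2)).
  rewrite le_eqVlt; apply/orP; left; apply/eqP; field.
  by rewrite !gt_eqF.
have s1 : summ (fun w => tau ^+ 2 * N w ^+ 2) by exact: summZ.
have s2 : summ (fun w => 4 * tau ^+ 2 / sp * S w `^ p) by exact: summZ.
apply: (@le_trans _ _ (mean (fun w => tau ^+ 2 * N w ^+ 2 + 4 * tau ^+ 2 / sp * S w `^ p))).
  apply: ler_mean => //; first exact: summD.
  by apply: filterS BNS => w; exact: Sle.
rewrite meanD// !meanZ// -/sp -tau2.
have -> : 4 * tau ^+ 2 / sp * sp = tau ^+ 2 * 4 by field.
by rewrite -mulrDr mulrC ler_wpM2r ?sqr_ge0// lerD2r.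
Qed.

End Moment.

Section OneSide.
Context (disp : measure_display) (T : measurableType disp) (R : realType)
  (P : probability T R).
Implicit Types (X : T -> R).
Local Notation mean := (mean P).
Local Notation summ := (summ P).
Local Notation sqsumm := (sqsumm P).
Local Notation step_condexp := (step_condexp P).
Context (n d : nat) (Tm LZ Lam : R) (G : nat -> set_system T)
    (h lam : nat -> R) (H : nat -> 'I_d -> T -> R).
Hypothesis FR : frame P n Tm LZ Lam G h lam H.
Hypotheses (n0 : (0 < n)%N) (d0 : (0 < d)%N).
Local Notation generator := (generator P n LZ G).
Local Notation costs := (costs P n G).
Local Notation scheme := (scheme P n G h H).
Local Notation Ce := (energy_cst Tm LZ Lam).
Local Notation mu := (mu_cst Lam LZ).

Let fsub m : (m <= n)%N -> subalg (G m). Proof. exact: (frame_sub FR). Qed.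

Let sq0 X : 0 <= mean (fun w => X w ^+ 2).
Proof. by apply: mean_ge0 => w; exact: sqr_ge0. Qed.

Definition gap_cst (eps K : R) : R := switching_cst Tm LZ Lam * K / eps ^+ 2 + 4.

Definition tilde_cst : R := 2 * (1 + mu * Tm) * Ce.

Context (refl : pred nat) (eps K kap p : R) (S : T -> R).
Hypotheses (eps0 : 0 < eps) (kap1 : 1 <= kap) (p2 : 2 <= p).
Hypothesis (cnt : \sum_(0 <= m < n) (refl m)%:R <= 2 * kap).
Hypotheses (S0 : forall w, 0 <= S w) (sSp : summ (fun w => S w `^ p)).

Context (c c' : nat -> 'I_d -> 'I_d -> T -> R) (xi xi' : 'I_d -> T -> R)
  (f f' : nat -> 'I_d -> T -> ('I_d -> R) -> R)
  (Y Yt e Y' Yt' e' : nat -> 'I_d -> T -> R)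
  (Z Z' : nat -> 'I_d -> 'I_d -> T -> R).
Hypotheses (gf : generator f) (co : costs refl eps c)
  (sc : scheme refl c xi f Y Yt e Z).
Hypotheses (gf' : generator f') (co' : costs refl eps c')
  (sc' : scheme refl c' xi' f' Y' Yt' e' Z').
Hypotheses (cc : forall m j l w, c m j l w <= c' m j l w)
  (xx : forall j w, xi' j w <= xi j w)
  (ff : forall m j w x, f' m j w x <= f m j w x).
Hypothesis (cS : forall m, (m < n)%N -> refl m ->
  forall j l w, c' m j l w - c m j l w <= S w).
Context (fb : nat -> T -> R) (xb : T -> R) (psi : nat -> T -> R).
Hypotheses
  (fbq : forall m, (m < n)%N -> adapted (G m) (fb m) /\ sqsumm (fb m))
  (fb0 : forall m j w, `|f m j w (fun=> 0)| <= fb m w)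
  (axb : adapted (G n) xb) (qxb : sqsumm xb)
  (xib : forall j w, `|xi j w| <= xb w)
  (KB : mean (fun w => xb w ^+ 2) +
     \sum_(0 <= m < n) h m * mean (fun w => fb m w ^+ 2) <= K)
  (psiq : forall m, (m < n)%N -> sqsumm (psi m) /\ forall w, 0 <= psi m w)
  (fpsi : forall m, (m < n)%N -> forall w j,
     f m j w (fun a => Z m j a w) - f' m j w (fun a => Z m j a w) <= psi m w).

Let data k := mean (fun w => \sum_j (xi j w - xi' j w) ^+ 2) +
  \sum_(k <= m < n) h m * mean (fun w => psi m w ^+ 2) +
  gap_cst eps K * (kap `^ (4 / p) * mean (fun w => S w `^ p) `^ (2 / p)).

(** With costs paid at least eps per switch, the number of switches is at most the
    accumulated cost divided by eps. *)
Lemma one_side k j : (k <= n)%N ->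
  mean (fun w => (Y k j w - Y' k j w) ^+ 2) <= Ce * data k.
Proof.
move=> kn; have [Yle _] := comparison FR gf' sc sc' cc xx ff.
have [sel [Gsel selP]] := selection FR sc co.
have psik m : (k <= m < n)%N -> sqsumm (psi m) /\ forall w, 0 <= psi m w.
  by case/andP => _; exact: psiq.
have fpsik m : (k <= m < n)%N -> {ae P, forall w, forall j,
     f m j w (fun a => Z m j a w) - f' m j w (fun a => Z m j a w) <= psi m w}.
  by case/andP => _ mn; apply: aeW; exact: fpsi.
apply: le_trans (route_difference FR co sc Gsel selP j kn gf' co' sc' cc Yle
  (ltW eps0) psik fpsik) _.
rewrite ler_wpM2l ?(le_trans ler01 (energy_cst_ge1 FR n0))// lerD2l.
pose s := route sel k j.
pose N w := \sum_(k <= m < n) switch R refl sel k j m w.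
pose A w := \sum_(k <= m < n) route_cost refl c sel k j m w.
pose B w := \sum_(k <= m < n) cost_gap refl c sel k j c' m w.
have aP m : (k <= m < n)%N -> _ := route_costP FR co Gsel j kn (m := m).
have bP m : (k <= m < n)%N -> _ := cost_gapP FR co Gsel j kn co' cc (m := m).
have qA : sqsumm A by apply: sqsumm_sum_nat => m /aP[].
have qB : sqsumm B by apply: sqsumm_sum_nat => m /bP[].
have mswitch m : (k <= m < n)%N -> measurable_fun setT (switch R refl sel k j m).
  move=> kmn; have /andP[km mn] := kmn.
  have [G1 G2] := route_fevent FR j Gsel kmn.
  apply: (adapted_meas (fsub (ltnW mn))).
  pose x (i l : 'I_d) (_ : T) : R := (refl m && (i != l))%:R.
  have ax i l : adapted (G m) (x i l) by exact: measurable_cst.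
  exact (adapted_pair FR Gsel j kmn ax).
have mN : measurable_fun setT N.
  rewrite (_ : N = fun w => \sum_(k <= m < n)
      if (k <= m < n)%N then switch R refl sel k j m w else 0).
    apply: measurable_sum => m; have [kmn|_] := boolP (k <= m < n)%N; last exact: measurable_cst.
    exact: mswitch.
  by apply/funext => w; apply: eq_big_nat => m ->.
have sw01 m w : 0 <= switch R refl sel k j m w <= (refl m)%:R.
  by rewrite /switch ler0n ler_nat; case: (refl m) => /=; rewrite ?leq_b1.
have Nk w : 0 <= N w <= 2 * kap.
  rewrite /N sumr_ge0 => [|m _]; last by have /andP[] := sw01 m w.
  apply: le_trans cnt; apply: (@le_trans _ _ (\sum_(k <= m < n) (refl m)%:R)).
    by apply: ler_sum => m _; have /andP[] := sw01 m w.
  by rewrite [leRHS](big_cat_nat (n := k))//= lerDr sumr_ge0.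
have NA : {ae P, forall w, eps * N w <= A w}.
  have /ae_forall_nat H1 : forall m, (k <= m < n)%N ->
    {ae P, forall w, eps * switch R refl sel k j m w <= route_cost refl c sel k j m w}.
    move=> m kmn; exact: (switch_le_cost co sel j (ltW eps0) kmn).
  apply: filterS H1 => w Hw; rewrite /N /A mulr_sumr.
  by apply: ler_sum_nat => m kmn; exact: Hw.
have BNS : {ae P, forall w, B w <= N w * S w}.
  have /ae_forall_nat H1 : forall m, (k <= m < n)%N ->
    {ae P, forall w, cost_gap refl c sel k j c' m w <= switch R refl sel k j m w * S w}.
    move=> m kmn; have /andP[_ mn] := kmn.
    apply: (cost_gap_switch co sel j co' kmn S0); exact: cS.
  apply: filterS H1 => w Hw; rewrite /N /B mulr_suml.
  by apply: ler_sum_nat => m kmn; exact: Hw.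
have B0 w : 0 <= B w.
  by rewrite /B big_nat_cond sumr_ge0// => m; rewrite andbT => /bP[_ _].
apply: le_trans (switching_moment kap1 p2 eps0 mN Nk qA NA qB B0 BNS S0 sSp) _.
rewrite ler_wpM2r ?mulr_ge0 ?powR_ge0// /gap_cst lerD2r.
rewrite ler_wpM2r ?invr_ge0 ?sqr_ge0//.
have RB := route_cost_bound FR gf co sc Gsel selP j kn n0 d0 (ltW eps0) fbq fb0 axb qxb xib.
apply: le_trans RB _; rewrite ler_wpM2l//.
exact: (switching_cst_ge0 FR n0).
Qed.

Lemma gap_ge0 : 0 <= gap_cst eps K *
  (kap `^ (4 / p) * mean (fun w => S w `^ p) `^ (2 / p)).
Proof.
have K0 : 0 <= K.
  apply: le_trans KB; rewrite addr_ge0//.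
  by apply: (weighted_ge0 FR) => m _; exact: sq0.
rewrite mulr_ge0 ?mulr_ge0 ?powR_ge0// /gap_cst addr_ge0// divr_ge0 ?sqr_ge0//.
by rewrite mulr_ge0// (switching_cst_ge0 FR n0).
Qed.

Let data_ge0 k : 0 <= data k.
Proof.
rewrite /data !addr_ge0 ?gap_ge0//.
  by apply: mean_ge0 => w; apply: sumr_ge0 => j _; exact: sqr_ge0.
by apply: (weighted_ge0 FR) => m _; exact: sq0.
Qed.

(** Yt k is one unreflected step away from Y k.+1, and it is the larger scheme minus
    the smaller one, so that one-sided bounds on the generators are enough. *)
Lemma one_side_tilde k j : (k < n)%N ->
  mean (fun w => (Yt k j w - Yt' k j w) ^+ 2) <= tilde_cst * data k.
Proof.
move=> kn; have [Yle Ytle] := comparison FR gf' sc sc' cc xx ff.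
have hk := frame_step FR kn; have /andP[l0 lL] := frame_lam FR kn.
have sk := fsub (ltnW kn).
pose U w := Y k.+1 j w - Y' k.+1 j w.
pose v w := e k j w - e' k j w.
pose V a w := Z k j a w - Z' k j a w.
have sU : step_condexp (G k) (H k) U v V.
  by apply: (step_sub sk); [exact: (sch_step sc)|exact: (sch_step sc')].
have [qpsi psi0] := psiq kn.
have O := one_step sk hk l0 lL (frame_lip FR) (frame_weight FR kn) sU qpsi psi0.
have L0 := frame_Lam_gt0 FR n0; have T0 := frame_Tm_ge0 FR.
have m1 := mu_ge1 FR n0.
have C1 := energy_cst_ge1 FR n0.
have [qv qV] := step_sq sk hk l0 (frame_weight FR kn) sU.
have hT := frame_step_le FR kn.
have le1 : mean (fun w => (Yt k j w - Yt' k j w) ^+ 2) <=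
   mean (fun w => (`|v w| + h k * (LZ * nrm (fun a => V a w) + psi k w)) ^+ 2).
  apply: ler_mean.
  - by apply: sqsumm_sqr; apply: sqsummB; [exact: (sch_tsq sc)|exact: (sch_tsq sc')].
  - apply: sqsumm_sqr; apply: sqsummD; first exact: sqsumm_norm.
    by apply: sqsummZ; apply: sqsummD => //; apply: sqsummZ; exact: sqsumm_nrm.
  apply: filterS3 (filterI (sch_tilde sc kn) (sch_tilde sc' kn)) (Ytle k kn)
     (generator_lip gf' kn) => w [Ytw Yt'w] tw L.
  have Lj := L j (fun a => Z k j a w) (fun a => Z' k j a w).
  rewrite ler_norml in Lj; move: Lj => /andP[_ L2].
  have fw := fpsi kn w j.
  have q0 : 0 <= Yt k j w - Yt' k j w by rewrite subr_ge0.
  have le : Yt k j w - Yt' k j w <= `|v w| + h k * (LZ * nrm (fun a => V a w) + psi k w).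
    rewrite Ytw Yt'w; have := ler_norm (v w); rewrite {1}/v.
    have : h k * (f k j w (fun a => Z k j a w) - f' k j w (fun a => Z' k j a w)) <=
       h k * (LZ * nrm (fun a => V a w) + psi k w).
      by rewrite ler_wpM2l ?(ltW hk)//; lra.
    by lra.
  by rewrite lerXn2r// nnegrE// (le_trans q0).
apply: le_trans le1 _.
apply: (@le_trans _ _ ((1 + mu * h k) * (mean (fun w => U w ^+ 2) +
    2 * h k * mean (fun w => psi k w ^+ 2)))).
  apply: le_trans O; rewrite lerDl mulr_ge0 ?sq0// divr_ge0 ?(ltW hk)//.
  by rewrite mulr_ge0// ltW.
have O1 := one_side j kn.
have dE : data k = h k * mean (fun w => psi k w ^+ 2) + data k.+1.
  by rewrite /data (big_ltn kn); ring.
have d1 := data_ge0 k.+1.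
have p0 : 0 <= h k * mean (fun w => psi k w ^+ 2) by rewrite mulr_ge0 ?sq0// ltW.
rewrite -(mulrA 2) (_ : tilde_cst * data k = (1 + mu * Tm) * (2 * (Ce * data k)));
  last by rewrite /tilde_cst; ring.
apply: ler_pM.
- by rewrite addr_ge0// mulr_ge0 ?(ltW hk)//; lra.
- by rewrite addr_ge0 ?sq0// mulr_ge0.
- by rewrite lerD2l ler_wpM2l//; lra.
rewrite dE mulrDr; have C0 : 0 <= Ce by lra.
have := mulr_ge0 C0 d1.
have : h k * mean (fun w => psi k w ^+ 2) <= Ce * (h k * mean (fun w => psi k w ^+ 2)).
  by rewrite ler_peMl.
lra.
Qed.

End OneSide.

(** * Stability in coordinates *)

Section Core.
Context (disp : measure_display) (T : measurableType disp) (R : realType)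
  (P : probability T R).
Implicit Types (X : T -> R).
Local Notation mean := (mean P).
Local Notation summ := (summ P).
Local Notation sqsumm := (sqsumm P).
Local Notation step_condexp := (step_condexp P).
Context (n d : nat) (Tm LZ Lam : R) (G : nat -> set_system T)
    (h lam : nat -> R) (H : nat -> 'I_d -> T -> R).
Hypothesis FR : frame P n Tm LZ Lam G h lam H.
Hypotheses (n0 : (0 < n)%N) (d0 : (0 < d)%N).
Local Notation generator := (generator P n LZ G).
Local Notation costs := (costs P n G).
Local Notation scheme := (scheme P n G h H).
Local Notation Ce := (energy_cst Tm LZ Lam).
Local Notation mu := (mu_cst Lam LZ).

Let fsub m : (m <= n)%N -> subalg (G m). Proof. exact: (frame_sub FR). Qed.

Let sq0 X : 0 <= mean (fun w => X w ^+ 2).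
Proof. by apply: mean_ge0 => w; exact: sqr_ge0. Qed.

Lemma sum_abs_sqr (a b : 'I_d -> R) :
  (\sum_j (`|a j| + `|b j|)) ^+ 2 <= 2 * d%:R * \sum_j (a j ^+ 2 + b j ^+ 2).
Proof.
pose x j := `|a j| + `|b j|.
have x0 j : 0 <= x j by rewrite addr_ge0.
have := nrm_cs x (fun=> 1); under eq_bigr do rewrite mulr1.
move=> cs; have s0 : 0 <= \sum_j x j by exact: sumr_ge0.
have : (\sum_j x j) ^+ 2 <= (nrm x * nrm (fun _ : 'I_d => 1)) ^+ 2.
  by rewrite lerXn2r// nnegrE mulr_ge0 ?nrm_ge0.
rewrite exprMn !nrm_sqr; under [X in _ * X]eq_bigr do rewrite expr1n.
rewrite sumr_const card_ord -[1 *+ d]/(d%:R) => /le_trans; apply.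
rewrite mulrC -mulrA mulrCA ler_wpM2l// mulr_sumr; apply: ler_sum => j _.
rewrite /x -(real_normK (num_real (a j))) -(real_normK (num_real (b j))).
by rewrite -subr_ge0 (_ : _ - _ = (`|a j| - `|b j|) ^+ 2) ?sqr_ge0//; ring.
Qed.

Definition z_cst : R := 2 * Lam * (3 + mu * Tm + 2 * d%:R * (1 + mu * Tm)).

(** Summing the one-step inequality over the dates telescopes, except at the
    reflection dates, where the jump of the squared difference is bounded by Q;
    their number is where the factor kap comes from. *)
Lemma z_bound refl c1 c2 xi1 xi2 f1 f2 Y1 Yt1 e1 Z1 Y2 Yt2 e2 Z2 psi i kap Q :
  generator f2 ->
  scheme refl c1 xi1 f1 Y1 Yt1 e1 Z1 -> scheme refl c2 xi2 f2 Y2 Yt2 e2 Z2 ->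
  (forall m, (m < n)%N -> sqsumm (psi m) /\ forall w, 0 <= psi m w) ->
  (forall m, (m < n)%N -> forall w j,
     `|f1 m j w (fun a => Z1 m j a w) - f2 m j w (fun a => Z1 m j a w)| <= psi m w) ->
  1 <= kap -> \sum_(0 <= m < n) (refl m)%:R <= 2 * kap -> (i <= n)%N ->
  (forall m, (i <= m <= n)%N ->
     \sum_j mean (fun w => (Y1 m j w - Y2 m j w) ^+ 2) <= Q) ->
  \sum_(i <= m < n) h m * mean (fun w => psi m w ^+ 2) <= Q ->
  \sum_(i <= m < n) h m *
     \sum_j mean (fun w => nrm (fun a => Z1 m j a w - Z2 m j a w) ^+ 2) <=
  kap * (z_cst * Q).
Proof.
move=> gf2 s1 s2 psiq fpsi kap1 cnt iN YQ psiQ.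
have L0 := frame_Lam_gt0 FR n0; have T0 := frame_Tm_ge0 FR.
have m1 := mu_ge1 FR n0.
pose A m := \sum_j mean (fun w => (Y1 m j w - Y2 m j w) ^+ 2).
pose Z m := \sum_j mean (fun w => nrm (fun a => Z1 m j a w - Z2 m j a w) ^+ 2).
pose Ps m := mean (fun w => psi m w ^+ 2).
have A0 m : 0 <= A m by apply: sumr_ge0 => j _; exact: sq0.
have Q0 : 0 <= Q by apply: le_trans (A0 n) (YQ n _); rewrite iN leqnn.
have hT m (mn : (m < n)%N) := frame_step_le FR mn.
have step m : (i <= m < n)%N ->
    h m * Z m <= 2 * Lam * ((A m.+1 - A m) + (refl m)%:R * Q +
      mu * Q * h m + 2 * d%:R * (1 + mu * Tm) * (h m * Ps m)).
  move=> imn; have /andP[im mn] := imn.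
  have hm := frame_step FR mn; have /andP[l0 lL] := frame_lam FR mn.
  have sm := fsub (ltnW mn); have [qpsi psi0] := psiq m mn.
  have perj j : (h m / (2 * Lam)) *
       mean (fun w => nrm (fun a => Z1 m j a w - Z2 m j a w) ^+ 2) <=
     (1 + mu * h m) * (mean (fun w => (Y1 m.+1 j w - Y2 m.+1 j w) ^+ 2) + 2 * h m * Ps m)
     - mean (fun w => (Yt1 m j w - Yt2 m j w) ^+ 2).
    pose U w := Y1 m.+1 j w - Y2 m.+1 j w.
    pose v w := e1 m j w - e2 m j w.
    pose V a w := Z1 m j a w - Z2 m j a w.
    have sU : step_condexp (G m) (H m) U v V.
      by apply: (step_sub sm); [exact: (sch_step s1)|exact: (sch_step s2)].
    have O := one_step sm hm l0 lL (frame_lip FR) (frame_weight FR mn) sU qpsi psi0.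
    have [qv qV] := step_sq sm hm l0 (frame_weight FR mn) sU.
    have le1 : mean (fun w => (Yt1 m j w - Yt2 m j w) ^+ 2) <=
       mean (fun w => (`|v w| + h m * (LZ * nrm (fun a => V a w) + psi m w)) ^+ 2).
      apply: ler_mean.
      - by apply: sqsumm_sqr; apply: sqsummB; [exact: (sch_tsq s1)|exact: (sch_tsq s2)].
      - apply: sqsumm_sqr; apply: sqsummD; first exact: sqsumm_norm.
        by apply: sqsummZ; apply: sqsummD => //; apply: sqsummZ; exact: sqsumm_nrm.
      apply: filterS3 (sch_tilde s1 mn) (sch_tilde s2 mn) (generator_lip gf2 mn)
         => w Yt1w Yt2w L.
      have Lj := L j (fun a => Z1 m j a w) (fun a => Z2 m j a w).
      have fw := fpsi m mn w j.
      have le : `|Yt1 m j w - Yt2 m j w| <=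
          `|v w| + h m * (LZ * nrm (fun a => V a w) + psi m w).
        rewrite Yt1w Yt2w (_ : _ - _ = v w + h m *
          ((f2 m j w (fun a => Z1 m j a w) - f2 m j w (fun a => Z2 m j a w)) +
           (f1 m j w (fun a => Z1 m j a w) - f2 m j w (fun a => Z1 m j a w)))); last first.
          by rewrite /v; ring.
        apply: le_trans (ler_normD _ _) _; rewrite lerD2l normrM (gtr0_norm hm).
        rewrite ler_wpM2l ?(ltW hm)//; apply: le_trans (ler_normD _ _) _.
        exact: lerD.
      rewrite -(real_normK (num_real (Yt1 m j w - Yt2 m j w))) lerXn2r// nnegrE//.
      exact: le_trans le.
    rewrite lerBrDr addrC; apply: le_trans O.
    by rewrite lerD2r.
  pose At := \sum_j mean (fun w => (Yt1 m j w - Yt2 m j w) ^+ 2).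
  have tot : h m / (2 * Lam) * Z m <=
     (1 + mu * h m) * (A m.+1 + d%:R * (2 * h m * Ps m)) - At.
    rewrite /Z mulr_sumr; apply: le_trans (ler_sum _ (fun j _ => perj j)) _.
    rewrite sumrB -mulr_sumr big_split/= sumr_const card_ord -[_ *+ d]mulr_natl.
    by rewrite lexx.
  have AAt : A m <= At + (refl m)%:R * Q.
    case: (boolP (refl m)) => rm.
      rewrite mul1r -[leLHS]add0r lerD//; last by apply: YQ; rewrite im ltnW.
      by apply: sumr_ge0 => j _; exact: sq0.
    rewrite mul0r addr0 /A /At; apply: ler_sum => j _.
    have q1 := sch_sq s1 j (ltnW mn); have q2 := sch_sq s2 j (ltnW mn).
    have q1' := sch_tsq s1 j mn; have q2' := sch_tsq s2 j mn.
    apply: ler_mean; [exact: sqsumm_sqr (sqsummB q1 q2)|exact: sqsumm_sqr (sqsummB q1' q2')|].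
    apply: filterS2 (sch_refl s1 mn) (sch_refl s2 mn) => w.
    by rewrite /reflected_at (negbTE rm) => -> ->.
  have A1Q : A m.+1 <= Q by apply: YQ; rewrite mn andbT (leq_trans im).
  have Ps0 : 0 <= Ps m by exact: sq0.
  have hP0 : 0 <= h m * Ps m by rewrite mulr_ge0// ltW.
  have h2 : h m * Z m = 2 * Lam * (h m / (2 * Lam) * Z m) by field; rewrite gt_eqF.
  rewrite h2 ler_wpM2l ?mulr_ge0 ?(ltW L0)//.
  apply: (le_trans tot).
  have B1 : mu * h m * A m.+1 <= mu * h m * Q.
    by rewrite ler_wpM2l// mulr_ge0 ?(ltW hm)//; lra.
  have B2 : (1 + mu * h m) * (d%:R * (2 * h m * Ps m)) <=
            (1 + mu * Tm) * (d%:R * (2 * h m * Ps m)).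
    rewrite ler_wpM2r ?lerD2l ?ler_wpM2l ?hT//; last by lra.
    by rewrite mulr_ge0// -mulrA mulr_ge0.
  by lra.
apply: (le_trans (ler_sum_nat step)).
rewrite -mulr_sumr; set c := 2 * d%:R * (1 + mu * Tm).
have -> : \sum_(i <= m < n) (A m.+1 - A m + (refl m)%:R * Q + mu * Q * h m +
     c * (h m * Ps m)) =
   (A n - A i) + (\sum_(i <= m < n) (refl m)%:R) * Q +
     mu * Q * (\sum_(i <= m < n) h m) + c * \sum_(i <= m < n) h m * Ps m.
  by rewrite -(telescope_sumr A iN) mulr_suml !mulr_sumr -!big_split.
have r2 : \sum_(i <= m < n) (refl m)%:R <= 2 * kap.
  by apply: le_trans cnt; rewrite [leRHS](big_cat_nat (n := i))//= lerDr sumr_ge0.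
have hs : \sum_(i <= m < n) h m <= Tm := frame_partial FR iN.
have AnQ : A n <= Q by apply: YQ; rewrite iN leqnn.
have Ai := A0 i.
have c0 : 0 <= c.
  by rewrite /c mulr_ge0// addr_ge0// mulr_ge0//; lra.
have b1 : (\sum_(i <= m < n) (refl m)%:R) * Q <= 2 * kap * Q by rewrite ler_wpM2r.
have b2 : mu * Q * (\sum_(i <= m < n) h m) <= mu * Q * Tm.
  by rewrite ler_wpM2l// mulr_ge0//; lra.
have b3 : c * (\sum_(i <= m < n) h m * Ps m) <= c * Q by rewrite ler_wpM2l.
have k0 : 0 <= kap - 1 by lra.
have p1 : 0 <= (kap - 1) * Q by rewrite mulr_ge0.
have p2 : 0 <= (kap - 1) * (mu * Q * Tm) by rewrite mulr_ge0// !mulr_ge0//; lra.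
have p3 : 0 <= (kap - 1) * (c * Q) by rewrite mulr_ge0// mulr_ge0.
rewrite /z_cst -/c (_ : kap * _ = 2 * Lam * (kap * ((3 + mu * Tm + c) * Q)));
  last by ring.
rewrite ler_wpM2l ?mulr_ge0 ?(ltW L0)//.
by lra.
Qed.

Section Stability.
Context (refl : pred nat) (eps K kap p : R) (S : T -> R).
Hypotheses (eps0 : 0 < eps) (kap1 : 1 <= kap) (p2 : 2 <= p).
Hypothesis (cnt : \sum_(0 <= m < n) (refl m)%:R <= 2 * kap).
Hypotheses (S0 : forall w, 0 <= S w) (sSp : summ (fun w => S w `^ p)).
Context (c1 c2 : nat -> 'I_d -> 'I_d -> T -> R) (xi1 xi2 : 'I_d -> T -> R)
  (f1 f2 : nat -> 'I_d -> T -> ('I_d -> R) -> R)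
  (Y1 Yt1 e1 Y2 Yt2 e2 : nat -> 'I_d -> T -> R)
  (Z1 Z2 : nat -> 'I_d -> 'I_d -> T -> R).
Hypotheses (gf1 : generator f1) (co1 : costs refl eps c1)
  (sc1 : scheme refl c1 xi1 f1 Y1 Yt1 e1 Z1).
Hypotheses (gf2 : generator f2) (co2 : costs refl eps c2)
  (sc2 : scheme refl c2 xi2 f2 Y2 Yt2 e2 Z2).
Hypothesis (cS : forall m, (m < n)%N -> refl m ->
  forall j l w, `|c1 m j l w - c2 m j l w| <= S w).
Hypotheses
  (K1 : mean (fun w => \sum_j xi1 j w ^+ 2) +
     \sum_(0 <= m < n) h m * mean (fun w => \sum_j f1 m j w (fun=> 0) ^+ 2) <= K)
  (K2 : mean (fun w => \sum_j xi2 j w ^+ 2) +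
     \sum_(0 <= m < n) h m * mean (fun w => \sum_j f2 m j w (fun=> 0) ^+ 2) <= K).

Let f m j w x := Num.max (f1 m j w x) (f2 m j w x).
Let c m j l w := Num.min (c1 m j l w) (c2 m j l w).
Let xi j w := Num.max (xi1 j w) (xi2 j w).

Let max_abs (a b : R) : `|Num.max a b| <= `|a| + `|b|.
Proof.
rewrite /Num.max; case: ifP => _; first by rewrite lerDr.
by rewrite lerDl.
Qed.

Let gf : generator f.
Proof.
split.
- move=> m j z mn az; apply: (@measurable_maxr _ (g_sigma_algebraType (G m))).
    exact: (generator_adapted gf1 j mn az).
  exact: (generator_adapted gf2 j mn az).
- move=> m mn; apply: filterS2 (generator_lip gf1 mn) (generator_lip gf2 mn) => w L1 L2 j x x'.
  have := L1 j x x'; have := L2 j x x'; rewrite !ler_norml /f /Num.max.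
  move=> /andP[a1 a2] /andP[b1 b2].
  by apply/andP; split; do 2 case: ifPn; rewrite -?leNgt; lra.
- move=> m j mn.
  have q1 := generator_sq gf1 j mn; have q2 := generator_sq gf2 j mn.
  apply: (sqsumm_dom (Y := fun w => `|f1 m j w (fun=> 0)| + `|f2 m j w (fun=> 0)|)).
  + by apply: measurable_maxr; [exact: sqsumm_meas q1|exact: sqsumm_meas q2].
  + by apply: sqsummD; exact: sqsumm_norm.
  + by move=> w; exact: max_abs.
Qed.

Let co : costs refl eps c.
Proof.
split.
- move=> m j l mn rm; apply: measurable_minr.
    exact: (costs_adapted co1).
  exact: (costs_adapted co2).
- move=> m j l mn rm.
  have q1 := costs_sq co1 j l mn rm; have q2 := costs_sq co2 j l mn rm.
  apply: (sqsumm_dom (Y := fun w => `|c1 m j l w| + `|c2 m j l w|)).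
  + by apply: measurable_minr; [exact: sqsumm_meas q1|exact: sqsumm_meas q2].
  + by apply: sqsummD; exact: sqsumm_norm.
  + move=> w; rewrite /c /Num.min; case: ifP => _; first by rewrite lerDl.
    by rewrite lerDr.
- move=> m mn rm; apply: filterS2 (costs_diag co1 mn rm) (costs_diag co2 mn rm).
  by move=> w a b j; rewrite /c a b minxx.
- move=> m mn rm; apply: filterS2 (costs_lower co1 mn rm) (costs_lower co2 mn rm).
  by move=> w a b j l jl; rewrite /c le_min a// b.
Qed.

Let axi1 j : adapted (G n) (xi1 j).
Proof.
have <- : Y1 n j = xi1 j by apply/funext => w; exact: (sch_last sc1).
exact: (sch_adapted sc1).
Qed.

Let axi2 j : adapted (G n) (xi2 j).
Proof.
have <- : Y2 n j = xi2 j by apply/funext => w; exact: (sch_last sc2).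
exact: (sch_adapted sc2).
Qed.

Let qxi1 j : sqsumm (xi1 j).
Proof.
have <- : Y1 n j = xi1 j by apply/funext => w; exact: (sch_last sc1).
exact: (sch_sq sc1).
Qed.

Let qxi2 j : sqsumm (xi2 j).
Proof.
have <- : Y2 n j = xi2 j by apply/funext => w; exact: (sch_last sc2).
exact: (sch_sq sc2).
Qed.

Let axi j : adapted (G n) (xi j).
Proof. by apply: measurable_maxr; [exact: axi1|exact: axi2]. Qed.

Let qxi j : sqsumm (xi j).
Proof.
apply: (sqsumm_dom (Y := fun w => `|xi1 j w| + `|xi2 j w|)).
- by apply: measurable_maxr; [exact: sqsumm_meas (qxi1 j)|exact: sqsumm_meas (qxi2 j)].
- by apply: sqsummD; exact: sqsumm_norm.
- by move=> w; exact: max_abs.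
Qed.

Let fb m w := \sum_j (`|f1 m j w (fun=> 0)| + `|f2 m j w (fun=> 0)|).
Let xb w := \sum_j (`|xi1 j w| + `|xi2 j w|).

Let fbq m : (m < n)%N -> adapted (G m) (fb m) /\ sqsumm (fb m).
Proof.
move=> mn; split.
  apply: measurable_sum => j; apply: measurable_funD; apply: measurableT_comp => //.
    by apply: (generator_adapted gf1 j mn) => a; exact: measurable_cst.
  by apply: (generator_adapted gf2 j mn) => a; exact: measurable_cst.
apply: sqsumm_sum => j _; apply: sqsummD; apply: sqsumm_norm.
  exact: (generator_sq gf1).
exact: (generator_sq gf2).
Qed.

Let fb0 m j w : `|f m j w (fun=> 0)| <= fb m w.
Proof.
apply: le_trans (max_abs _ _) _; rewrite /fb (bigD1 j)//= lerDl.
by apply: sumr_ge0 => l _; rewrite addr_ge0.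
Qed.

Let axb : adapted (G n) xb.
Proof.
apply: measurable_sum => j; apply: measurable_funD; apply: measurableT_comp => //.
  exact: axi1.
exact: axi2.
Qed.

Let qxb : sqsumm xb.
Proof.
by apply: sqsumm_sum => j _; apply: sqsummD; apply: sqsumm_norm.
Qed.

Let xib j w : `|xi j w| <= xb w.
Proof.
apply: le_trans (max_abs _ _) _; rewrite /xb (bigD1 j)//= lerDl.
by apply: sumr_ge0 => l _; rewrite addr_ge0.
Qed.

Let sum_sq_mean (x y : 'I_d -> T -> R) : (forall j, sqsumm (x j)) ->
  (forall j, sqsumm (y j)) ->
  mean (fun w => (\sum_j (`|x j w| + `|y j w|)) ^+ 2) <=
  2 * d%:R * (mean (fun w => \sum_j x j w ^+ 2) + mean (fun w => \sum_j y j w ^+ 2)).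
Proof.
move=> qx qy.
have s1 : summ (fun w => \sum_j x j w ^+ 2).
  by apply: summ_sum => j _; exact: sqsumm_sqr.
have s2 : summ (fun w => \sum_j y j w ^+ 2).
  by apply: summ_sum => j _; exact: sqsumm_sqr.
rewrite -meanD// -meanZ; last exact: summD.
apply: ler_mean.
- apply: sqsumm_sqr; apply: sqsumm_sum => j _.
  by apply: sqsummD; exact: sqsumm_norm.
- by apply: summZ; exact: summD.
- by apply: aeW => w; rewrite -big_split/=; exact: sum_abs_sqr.
Qed.

Let KB : mean (fun w => xb w ^+ 2) +
     \sum_(0 <= m < n) h m * mean (fun w => fb m w ^+ 2) <= 4 * d%:R * K.
Proof.
have b1 := sum_sq_mean qxi1 qxi2.
have b2 : \sum_(0 <= m < n) h m * mean (fun w => fb m w ^+ 2) <=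
  2 * d%:R * (\sum_(0 <= m < n) h m * mean (fun w => \sum_j f1 m j w (fun=> 0) ^+ 2) +
  \sum_(0 <= m < n) h m * mean (fun w => \sum_j f2 m j w (fun=> 0) ^+ 2)).
  rewrite -big_split/= mulr_sumr; apply: ler_sum_nat => m /andP[_ mn].
  rewrite -mulrDr mulrCA ler_wpM2l ?(ltW (frame_step FR mn))//.
  apply: sum_sq_mean => j; first exact: (generator_sq gf1).
  exact: (generator_sq gf2).
have d2 : 0 <= 2 * d%:R :> R by rewrite mulr_ge0.
apply: (le_trans (lerD b1 b2)); rewrite -mulrDr.
apply: (@le_trans _ _ (2 * d%:R * (K + K))); last by lra.
by rewrite ler_wpM2l// addrACA; exact: lerD K1 K2.
Qed.

Definition stability_gap : R := gap_cst Tm LZ Lam eps (4 * d%:R * K).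

(** Two arbitrary schemes are compared through the one with the larger generator, the
    larger terminal value and the smaller cost, which dominates both. The random
    variables psi measure the distance of the generators at the values of z met by
    the schemes. *)
Theorem stability : exists psi : nat -> T -> R,
  (forall m, (m < n)%N -> sqsumm (psi m) /\ forall w, 0 <= psi m w) /\
  (forall m w (g : R), (forall j x, `|f1 m j w x - f2 m j w x| <= g) ->
     psi m w <= 2 * d%:R * g) /\
  (forall i, (i <= n)%N -> let Q :=
     mean (fun w => \sum_j (xi1 j w - xi2 j w) ^+ 2) +
     \sum_(i <= m < n) h m * mean (fun w => psi m w ^+ 2) +
     stability_gap * (kap `^ (4 / p) * mean (fun w => S w `^ p) `^ (2 / p)) in
   [/\ 0 <= Q,
     forall k, (i <= k <= n)%N ->
       \sum_j mean (fun w => (Y1 k j w - Y2 k j w) ^+ 2) <= 2 * d%:R * (Ce * Q),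
     forall k, (i <= k < n)%N ->
       \sum_j mean (fun w => (Yt1 k j w - Yt2 k j w) ^+ 2) <=
       2 * d%:R * (tilde_cst Tm LZ Lam * Q) &
     \sum_(i <= m < n) h m *
       \sum_j mean (fun w => nrm (fun a => Z1 m j a w - Z2 m j a w) ^+ 2) <=
     kap * (z_cst * (2 * d%:R * (Ce * Q)))]).
Proof.
have [Y [Yt [e [Z sc]]]] := scheme_exists FR gf co axi qxi.
pose df m j w x := `|f1 m j w x - f2 m j w x|.
(* The one-sided estimates evaluate the generators at Z, the bound on the
   difference of the Z-components at Z1. *)
pose psi m w := \sum_j (df m j w (fun a => Z m j a w) + df m j w (fun a => Z1 m j a w)).
have df0 m j w x : 0 <= df m j w x by exact: normr_ge0.
have qdf m j z : (m < n)%N -> (forall a, adapted (G m) (z a)) ->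
    (forall a, sqsumm (z a)) -> sqsumm (fun w => df m j w (fun a => z a w)).
  move=> mn az qz; apply: sqsumm_norm; apply: sqsummB.
    exact: (generator_sqZ FR j gf1 mn az qz).
  exact: (generator_sqZ FR j gf2 mn az qz).
have psiq m : (m < n)%N -> sqsumm (psi m) /\ forall w, 0 <= psi m w.
  move=> mn; have /andP[l0 _] := frame_lam FR mn; split; last first.
    by move=> w; apply: sumr_ge0 => j _; rewrite addr_ge0.
  apply: sqsumm_sum => j _; apply: sqsummD; apply: qdf => // a.
  - by have [_ _ /(_ a)[]] := sch_step sc j mn.
  - exact: (step_sq (fsub (ltnW mn)) (frame_step FR mn) l0 (frame_weight FR mn)
       (sch_step sc j mn)).2.
  - by have [_ _ /(_ a)[]] := sch_step sc1 j mn.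
  - exact: (step_sq (fsub (ltnW mn)) (frame_step FR mn) l0 (frame_weight FR mn)
       (sch_step sc1 j mn)).2.
have psi_ge m j w : df m j w (fun a => Z m j a w) + df m j w (fun a => Z1 m j a w) <= psi m w.
  by rewrite /psi (bigD1 j)//= lerDl; apply: sumr_ge0 => l _; rewrite addr_ge0.
exists psi; split; first exact: psiq; split.
  move=> m w g fg; apply: (@le_trans _ _ (\sum_(j < d) (g + g))).
    by apply: ler_sum => j _; apply: lerD; exact: fg.
  by rewrite sumr_const card_ord -[_ *+ d]mulr_natl le_eqVlt; apply/orP; left;
    apply/eqP; ring.
move=> i iN Q.
have xx1 j w : xi1 j w <= xi j w by rewrite /xi le_max lexx.
have xx2 j w : xi2 j w <= xi j w by rewrite /xi le_max lexx orbT.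
have ff1 m j w x : f1 m j w x <= f m j w x by rewrite /f le_max lexx.
have ff2 m j w x : f2 m j w x <= f m j w x by rewrite /f le_max lexx orbT.
have cc1 m j l w : c m j l w <= c1 m j l w by rewrite /c ge_min lexx.
have cc2 m j l w : c m j l w <= c2 m j l w by rewrite /c ge_min lexx orbT.
have cS1 m : (m < n)%N -> refl m -> forall j l w, c1 m j l w - c m j l w <= S w.
  move=> mn rm j l w; have := cS mn rm j l w; rewrite ler_norml => /andP[_].
  by rewrite /c /Num.min; case: ifP => // _ _; rewrite subrr.
have cS2 m : (m < n)%N -> refl m -> forall j l w, c2 m j l w - c m j l w <= S w.
  move=> mn rm j l w; have := cS mn rm j l w; rewrite ler_norml => /andP[+ _].
  by rewrite /c /Num.min; case: ifP => _; rewrite ?subrr//; lra.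
have fp1 m : (m < n)%N -> forall w j,
     f m j w (fun a => Z m j a w) - f1 m j w (fun a => Z m j a w) <= psi m w.
  move=> mn w j; apply: le_trans (psi_ge m j w).
  have := df0 m j w (fun a => Z1 m j a w).
  have := ler_norm (f1 m j w (fun a => Z m j a w) - f2 m j w (fun a => Z m j a w)).
  have := ler_norm (- (f1 m j w (fun a => Z m j a w) - f2 m j w (fun a => Z m j a w))).
  rewrite normrN -/(df m j w _) /f /Num.max; have := df0 m j w (fun a => Z m j a w).
  by case: ifP => _; lra.
have fp2 m : (m < n)%N -> forall w j,
     f m j w (fun a => Z m j a w) - f2 m j w (fun a => Z m j a w) <= psi m w.
  move=> mn w j; apply: le_trans (psi_ge m j w).
  have := df0 m j w (fun a => Z1 m j a w).
  have := ler_norm (f1 m j w (fun a => Z m j a w) - f2 m j w (fun a => Z m j a w)).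
  rewrite -/(df m j w _) /f /Num.max; have := df0 m j w (fun a => Z m j a w).
  by case: ifP => _; lra.
have O1 := one_side FR n0 d0 eps0 kap1 p2 cnt S0 sSp gf co sc gf1 co1 sc1 cc1 xx1 ff1
  cS1 fbq fb0 axb qxb xib KB psiq fp1.
have O2 := one_side FR n0 d0 eps0 kap1 p2 cnt S0 sSp gf co sc gf2 co2 sc2 cc2 xx2 ff2
  cS2 fbq fb0 axb qxb xib KB psiq fp2.
have T1 := one_side_tilde FR n0 d0 eps0 kap1 p2 cnt S0 sSp gf co sc gf1 co1 sc1 cc1 xx1 ff1
  cS1 fbq fb0 axb qxb xib KB psiq fp1.
have T2 := one_side_tilde FR n0 d0 eps0 kap1 p2 cnt S0 sSp gf co sc gf2 co2 sc2 cc2 xx2 ff2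
  cS2 fbq fb0 axb qxb xib KB psiq fp2.
have g0 := gap_ge0 FR n0 eps kap p S KB.
have Ce1 := energy_cst_ge1 FR n0.
have m1 := mu_ge1 FR n0; have Tm0 := frame_Tm_ge0 FR.
have [le1 lt1] := comparison FR gf1 sc sc1 cc1 xx1 ff1.
have [le2 lt2] := comparison FR gf2 sc sc2 cc2 xx2 ff2.
have psm k : (i <= k <= n)%N -> \sum_(k <= m < n) h m * mean (fun w => psi m w ^+ 2) <=
     \sum_(i <= m < n) h m * mean (fun w => psi m w ^+ 2).
  move=> /andP[ik kn]; rewrite [leRHS](big_cat_nat (n := k))//= lerDr.
  rewrite big_nat_cond sumr_ge0// => m; rewrite andbT => /andP[_ mk].
  by rewrite mulr_ge0 ?sq0// ltW// (frame_step FR)// (leq_trans mk).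
have qsx (x : 'I_d -> T -> R) : (forall j, sqsumm (x j)) -> summ (fun w => \sum_j x j w ^+ 2).
  by move=> qx; apply: summ_sum => j _; exact: sqsumm_sqr.
have dx1 : mean (fun w => \sum_j (xi j w - xi1 j w) ^+ 2) <=
           mean (fun w => \sum_j (xi1 j w - xi2 j w) ^+ 2).
  apply: ler_mean.
  - by apply: (qsx (fun j w => xi j w - xi1 j w)) => j; exact: sqsummB.
  - by apply: (qsx (fun j w => xi1 j w - xi2 j w)) => j; exact: sqsummB.
  - apply: aeW => w; apply: ler_sum => j _; rewrite /xi /Num.max; case: ifP => _.
      by rewrite -sqrrN opprB.
    by rewrite subrr expr0n sqr_ge0.
have dx2 : mean (fun w => \sum_j (xi j w - xi2 j w) ^+ 2) <=
           mean (fun w => \sum_j (xi1 j w - xi2 j w) ^+ 2).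
  apply: ler_mean.
  - by apply: (qsx (fun j w => xi j w - xi2 j w)) => j; exact: sqsummB.
  - by apply: (qsx (fun j w => xi1 j w - xi2 j w)) => j; exact: sqsummB.
  - apply: aeW => w; apply: ler_sum => j _; rewrite /xi /Num.max; case: ifP => _ //.
    by rewrite subrr expr0n sqr_ge0.
have sqdiff (a b u : T -> R) : sqsumm a -> sqsumm b -> sqsumm u ->
    {ae P, forall w, a w <= u w} -> {ae P, forall w, b w <= u w} ->
    mean (fun w => (a w - b w) ^+ 2) <=
    mean (fun w => (u w - a w) ^+ 2) + mean (fun w => (u w - b w) ^+ 2).
  move=> qa qb qc ac bc.
  have s1 := sqsumm_sqr (sqsummB qc qa); have s2 := sqsumm_sqr (sqsummB qc qb).
  rewrite -meanD//; apply: ler_mean; first exact: sqsumm_sqr (sqsummB qa qb).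
    exact: summD.
  apply: filterS2 ac bc => w ac bc.
  have : 0 <= (u w - a w) * (u w - b w) by rewrite mulr_ge0 ?subr_ge0.
  by rewrite !expr2; lra.
have dd : 2 * d%:R = \sum_(j < d) (1 + 1) :> R.
  by rewrite sumr_const card_ord -[_ *+ d]mulr_natl; ring.
have Q0 : 0 <= Q.
  rewrite /Q !addr_ge0//.
    by apply: mean_ge0 => w; apply: sumr_ge0 => j _; exact: sqr_ge0.
  by apply: (weighted_ge0 FR) => m _; exact: sq0.
have tc0 : 0 <= tilde_cst Tm LZ Lam.
  have Ce0 : 0 <= Ce by lra.
  apply: mulr_ge0 => //; apply: mulr_ge0 => //; apply: addr_ge0 => //.
  by apply: mulr_ge0 => //; lra.
have mainY k : (i <= k <= n)%N ->
   \sum_j mean (fun w => (Y1 k j w - Y2 k j w) ^+ 2) <= 2 * d%:R * (Ce * Q).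
  move=> ikn; have /andP[ik kn] := ikn; rewrite dd mulr_suml; apply: ler_sum => j _.
  apply: le_trans (sqdiff _ _ _ (sch_sq sc1 j kn) (sch_sq sc2 j kn) (sch_sq sc j kn) _ _) _.
  - by apply: filterS (le1 k kn) => w.
  - by apply: filterS (le2 k kn) => w.
  rewrite mulrDl mul1r; apply: lerD.
    apply: (le_trans (O1 k j kn)); rewrite ler_wpM2l//; first by lra.
    by rewrite lerD2r lerD// psm.
  apply: (le_trans (O2 k j kn)); rewrite ler_wpM2l//; first by lra.
  by rewrite lerD2r lerD// psm.
split => //.
- move=> k ikn; have /andP[ik kn] := ikn; rewrite dd mulr_suml; apply: ler_sum => j _.
  have ikn' : (i <= k <= n)%N by rewrite ik ltnW.
  apply: le_trans (sqdiff _ _ _ (sch_tsq sc1 j kn) (sch_tsq sc2 j kn) (sch_tsq sc j kn) _ _) _.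
  - by apply: filterS (lt1 k kn) => w.
  - by apply: filterS (lt2 k kn) => w.
  rewrite mulrDl mul1r; apply: lerD.
    apply: (le_trans (T1 k j kn)); rewrite ler_wpM2l//.
    by rewrite lerD2r lerD// psm.
  apply: (le_trans (T2 k j kn)); rewrite ler_wpM2l//.
  by rewrite lerD2r lerD// psm.
apply: (z_bound gf2 sc1 sc2 psiq _ kap1 cnt iN mainY).
- move=> m mn w j; apply: le_trans (psi_ge m j w).
  by rewrite lerDr.
- apply: (@le_trans _ _ Q).
    rewrite /Q -addrA addrCA lerDl addr_ge0//.
    by apply: mean_ge0 => w; apply: sumr_ge0 => j _; exact: sqr_ge0.
  rewrite mulrA ler_peMl//.
  have d1 : 1 <= d%:R :> R by rewrite ler1n.
  by rewrite -[leLHS]mulr1 ler_pM//; lra.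
Qed.

End Stability.
End Core.

(** * Borel sets of matrices and components *)

Lemma preimage_generated (T U : Type) (G : set_system T) (S : set_system U)
    (X : T -> U) : sigma_algebra [set: T] G ->
  (forall B, S B -> G (X @^-1` B)) -> forall B, <<s S >> B -> G (X @^-1` B).
Proof.
move=> [G0 GC GU] SG.
apply: (@smallest_sub _ (sigma_algebra [set: U]) _ [set B | G (X @^-1` B)]) => //.
split => /=.
- by rewrite preimage_set0.
- move=> B GB; rewrite (_ : X @^-1` _ = setT `\` X @^-1` B); first exact: GC.
  by apply/seteqP; split=> w /= [].
- by move=> B GB; rewrite preimage_bigcup; exact: GU.
Qed.

Section MatrixBorel.
Context (disp : measure_display) (T : measurableType disp) (R : realType).
Implicit Types (G : set_system T).

Lemma mx_measurable_component G m n (X : T -> 'M[R]_(m, n)) i j :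
  subalg G -> mx_measurable G X -> adapted G (fun w => X w i j).
Proof.
move=> sG mX; apply: (measurability _ (RGenOInfty.measurableE R)).
move=> _ [_ [x ->] <-]; apply: sub_sigma_algebra; apply: mX.
exists [set M : 'M[R]_(m, n) | x < M i j] => //; last first.
  by apply/seteqP; split=> w /=; rewrite in_itv/= andbT => -[].
apply: sub_sigma_algebra => /=.
have := @open_comp _ _ (fun M : 'M[R]_(m, n) => M i j) [set y | x < y] _ (@open_gt R x).
by apply => M _; exact: coord_continuous.
Qed.

(** The balls with rational centre and radius 1/(k+1) form a countable base of the
    topology, and the preimage of a ball is a finite intersection of events that
    concern one entry each. *)
Lemma mx_measurable_components G m n (X : T -> 'M[R]_(m, n)) : subalg G ->
  (forall i j, adapted G (fun w => X w i j)) -> mx_measurable G X.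
Proof.
move=> sG aX _ [B mB <-]; rewrite setTI.
apply: (preimage_generated sG.1 _ mB) => U /= oU.
pose b (u : 'M[rat]_(m, n) * nat) : set 'M[R]_(m, n) :=
  [set M | forall i j, `|ratr (u.1 i j) - M i j| < u.2.+1%:R^-1].
have -> : U = \bigcup_(u in [set u | b u `<=` U]) b u.
  apply/seteqP; split => [M UM|M [u /= bU]]; last exact: bU.
  have /nbhs_ballP[e /= e0 eU] : nbhs M U by exact: open_nbhs_nbhs.
  have [k ke] : exists k : nat, k.+1%:R^-1 < e / 2 :> R.
    have e2 : 0 < (e / 2)^-1 by rewrite invr_gt0 divr_gt0.
    exists (Num.truncn (e / 2)^-1).
    rewrite -[ltRHS]invrK ltf_pV2 ?posrE//. exact: truncnS_gt.
  have /choice[q0 q0P] (i : 'I_m * 'I_n) :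
      exists q : rat, `|ratr q - M i.1 i.2| < k.+1%:R^-1.
    have k0 : 0 < k.+1%:R^-1 :> R by rewrite invr_gt0.
    have /rat_in_itvoo[q] : M i.1 i.2 - k.+1%:R^-1 < M i.1 i.2 + k.+1%:R^-1.
      by rewrite ltrD2l gt0_cp.
    by rewrite in_itv/= => qM; exists q; rewrite ltr_distl.
  exists (\matrix_(i, j) q0 (i, j), k); last first.
    by move=> i j /=; rewrite mxE; exact: (q0P (i, j)).
  move=> N /= qN; apply: eU; split => // i j; rewrite /ball/=.
  have := qN i j; rewrite /= mxE; have := q0P (i, j) => /=.
  move: (k.+1%:R^-1) ke => r re.
  by rewrite !ltr_norml => /andP[? ?] /andP[? ?]; apply/andP; split; lra.
rewrite preimage_bigcup.
pose GT := g_sigma_algebraType G.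
suff : measurable (\bigcup_(u in [set u | b u `<=` U]) X @^-1` b u : set GT).
  by rewrite /measurable/= (subalgE sG).
have -> : (\bigcup_(u in [set u | b u `<=` U]) X @^-1` b u : set GT) =
  \bigcup_u (if `[< b u `<=` U >] then X @^-1` b u else set0).
  apply/seteqP; split => w [u /= bu Xw]; exists u => //; first by case: asboolP.
    by move: Xw; case: asboolP.
  by move: Xw; case: asboolP.
apply: countable_bigcupT_measurable => // u; case: asboolP => // _.
have -> : X @^-1` b u = \bigcap_i \bigcap_j
    ((fun w => `|ratr (u.1 i j) - X w i j|) @^-1` [set y | y < u.2.+1%:R^-1]).
  apply/seteqP; split => w /= bw; first by move=> i _ j _; exact: bw.
  by move=> i j; exact: (bw i I j I).
apply: fin_bigcap_measurable => [|i _]; first exact: finite_finset.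
apply: fin_bigcap_measurable => [|j _]; first exact: finite_finset.
rewrite -[X in measurable X]setTI.
have mf : adapted G (fun w => `|ratr (u.1 i j) - X w i j|).
  apply: measurableT_comp => //; apply: measurable_funB; last exact: aX.
  exact: measurable_cst.
rewrite (_ : [set y | y < _] = `]-oo, u.2.+1%:R^-1[%classic); first exact: mf.
by apply/seteqP; split => y /=; rewrite in_itv.
Qed.

(** The graph map w |-> (w, Z w) pulls measurable rectangles back to events. *)
Lemma mx_field_comp G a b m n (F : T -> 'M[R]_(a, b) -> 'M[R]_(m, n)) Z :
  subalg G -> mx_field_measurable G F -> mx_measurable G Z ->
  mx_measurable G (fun w => F w (Z w)).
Proof.
move=> sG mF mZ _ [B mB <-]; rewrite setTI.
have := mF _ (ex_intro2 _ _ B mB erefl); rewrite setTI => FB.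
apply: (preimage_generated (X := fun w => (w, Z w)) sG.1 _ FB).
move=> _ [A [C [GA mC ->]]].
rewrite (_ : _ @^-1` _ = A `&` Z @^-1` C)//.
have GZ : G (Z @^-1` C) by apply: mZ; exists C => //; rewrite setTI.
have : measurable ((A : set (g_sigma_algebraType G)) `&` Z @^-1` C).
  by apply: measurableI; exact: sub_sigma_algebra.
by rewrite /measurable/= (subalgE sG).
Qed.

End MatrixBorel.

(** * Euclidean norms of matrices *)

Section Norms.
Context (R : realType).

Lemma enorm_sqr m n (A : 'M[R]_(m, n)) : enorm A ^+ 2 = \sum_i \sum_j A i j ^+ 2.
Proof.
by rewrite sqr_sqrtr// sumr_ge0// => i _; rewrite sumr_ge0// => j _; exact: sqr_ge0.
Qed.

Lemma enorm_ge0 m n (A : 'M[R]_(m, n)) : 0 <= enorm A.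
Proof. exact: sqrtr_ge0. Qed.

Lemma enorm_col_sqr m (A : 'cV[R]_m) : enorm A ^+ 2 = \sum_i A i 0 ^+ 2.
Proof. by rewrite enorm_sqr; apply: eq_bigr => i _; rewrite big_ord1. Qed.

Lemma enorm_row m (A : 'rV[R]_m) : enorm A = nrm (fun a => A 0 a).
Proof. by rewrite /enorm /nrm big_ord1. Qed.

Lemma component_le_enorm m n (A : 'M[R]_(m, n)) i j : `|A i j| <= enorm A.
Proof.
rewrite -sqrtr_sqr ler_wsqrtr//.
rewrite (bigD1 i)//= (bigD1 j)//= -addrA lerDl addr_ge0//.
  by rewrite sumr_ge0// => l _; exact: sqr_ge0.
by rewrite sumr_ge0// => k _; rewrite sumr_ge0// => l _; exact: sqr_ge0.
Qed.

Definition only_row d (j : 'I_d) (x : 'I_d -> R) : 'M[R]_d :=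
  \matrix_(a, b) if a == j then x b else 0.

Lemma enorm_only_row d (j : 'I_d) (x x' : 'I_d -> R) :
  enorm (only_row j x - only_row j x') = nrm (fun b => x b - x' b).
Proof.
rewrite /enorm /nrm (bigD1 j)//= [X in _ + X]big1 ?addr0; last first.
  by move=> a aj; rewrite big1// => b _; rewrite !mxE (negbTE aj) subrr expr0n.
by congr Num.sqrt; apply: eq_bigr => b _; rewrite !mxE eqxx.
Qed.

Lemma row_only_row d (j : 'I_d) (z : 'M[R]_d) : row j (only_row j (z j)) = row j z.
Proof. by apply/rowP => b; rewrite !mxE eqxx. Qed.

Lemma only_row0 d (j : 'I_d) : only_row j (fun=> 0) = 0.
Proof. by apply/matrixP => a b; rewrite !mxE if_same. Qed.

End Norms.

(** * The filtration *)

Section Filtration.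
Context (disp : measure_display) (T : measurableType disp) (R : realType)
  (P : probability T R).

Lemma condexp_component G m n (X Y : T -> 'M[R]_(m, n)) i j : subalg G ->
  is_condexp P G X Y -> condexp P G (fun w => X w i j) (fun w => Y w i j).
Proof.
move=> sG [mY /(_ i j)[sX sY E]]; split => //.
  exact: mx_measurable_component.
move=> A GA; have mA : measurable A by exact: sG.2.
have indE (U : T -> R) : (\int[P]_(w in A) (U w)%:E = \int[P]_w (\1_A w * U w)%:E)%E.
  rewrite integral_mkcond epatch_indic; apply: eq_integral => w _ /=.
  by rewrite mulrC EFinM.
by have := E A GA; rewrite !indE /mean /Rintegral => ->.
Qed.

Context (d : nat) (Tm : R) (W : R -> T -> 'rV[R]_d).
Hypothesis BM : brownian_motion P Tm W.

Lemma filtration_subalg s : 0 <= s <= Tm -> subalg (brownian_filtration P W s).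
Proof.
move=> /andP[s0 sT]; split; first exact: smallest_sigma_algebra.
apply: smallest_sub; first exact: sigma_algebra_measurable.
move=> A [|[]//]; apply: smallest_sub; first exact: sigma_algebra_measurable.
move=> B [u /=]; rewrite in_itv/= => /andP[u0 us].
apply: (bm_measurable BM); by rewrite u0 (le_trans us).
Qed.

Lemma filtration_mono s s' : s <= s' ->
  brownian_filtration P W s `<=` brownian_filtration P W s'.
Proof.
move=> ss'; apply: sub_sigma_algebra2; apply: setUSS => //.
apply: sub_sigma_algebra2; apply: bigcup_subset => u /=.
by rewrite !in_itv/= => /andP[-> us]; exact: le_trans ss'.
Qed.

End Filtration.

(** * Grids and weights *)

Section Grids.
Context (R : realType) (Tm : R) (n : nat) (t : nat -> R).
Hypothesis gt : is_grid Tm n t.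

Lemma grid_lt m k : (m < k)%N -> (k <= n)%N -> t m < t k.
Proof.
have [_ _ tS] := gt; elim: k => // k IH; rewrite ltnS leq_eqVlt => /orP[/eqP ->|mk] kn.
  exact: tS.
by apply: lt_trans (tS k kn); apply: IH => //; exact: ltnW.
Qed.

Lemma grid_bounds m : (m <= n)%N -> 0 <= t m <= Tm.
Proof.
have [t0 tn _] := gt => mn; apply/andP; split.
  case: m mn => [|m] mn; first by rewrite t0.
  by rewrite -t0 ltW// grid_lt.
rewrite -tn; move: mn; rewrite leq_eqVlt => /orP[/eqP ->//|mn].
by rewrite ltW// grid_lt.
Qed.

Lemma grid_step m : (m < n)%N -> 0 < step t m.
Proof. by have [_ _ tS] := gt => mn; rewrite subr_gt0 tS. Qed.

Lemma grid_horizon : \sum_(0 <= m < n) step t m = Tm.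
Proof. by have [t0 tn _] := gt; rewrite telescope_sumr// t0 tn subr0. Qed.

(** A grid with kappa > 0 steps has kappa + 1 <= 2 kappa points. *)
Lemma grid_count kappa (r : nat -> R) : (0 < kappa)%N ->
  \sum_(0 <= m < n) (t m \in grid_points kappa r)%:R <= 2 * kappa%:R :> R.
Proof.
move=> k0; rewrite -natr_sum -natrM ler_nat.
have -> : (\sum_(0 <= m < n) (t m \in grid_points kappa r) =
           size [seq t m | m <- iota 0 n & t m \in grid_points kappa r])%N.
  rewrite size_map size_filter -sum1_count [RHS]big_mkcond/= /index_iota subn0.
  by apply: eq_bigr => m _; case: (_ \in _).
apply: (@leq_trans (size (grid_points kappa r))); last first.
  by rewrite /grid_points size_mkseq; lia.
apply: uniq_leq_size; last by move=> x /mapP[m]; rewrite mem_filter => /andP[? _] ->.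
rewrite map_inj_in_uniq ?filter_uniq ?iota_uniq// => a b.
rewrite !mem_filter !mem_iota !add0n/= => /andP[_ an] /andP[_ bn] tab.
apply/eqP; rewrite eqn_leq; apply/andP; split; rewrite leqNgt; apply/negP => ab.
  by have := grid_lt ab (ltnW an); rewrite tab ltxx.
by have := grid_lt ab (ltnW bn); rewrite tab ltxx.
Qed.

End Grids.

Section Translation.
Context (disp : measure_display) (T : measurableType disp) (R : realType)
  (P : probability T R).
Context (d : nat) (Tm LZ lambda Lambda : R) (W : R -> T -> 'rV[R]_d)
  (n : nat) (t : nat -> R) (H : nat -> T -> 'rV[R]_d).
Hypotheses (d0 : (0 < d)%N) (lambda0 : 0 < lambda) (Lambda0 : 0 < Lambda).
Hypotheses (BM : brownian_motion P Tm W) (gt : is_grid Tm n t).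
Let Ft := brownian_filtration P W.
Hypothesis wH : is_weights P Ft lambda Lambda n t H.

Let G m := Ft (t m).
Let h := step t.

Definition weight_entry m a w := H m w 0 a.
Local Notation HH := weight_entry.

Lemma grid_subalg m : (m <= n)%N -> subalg (G m).
Proof. by move=> mn; apply: (filtration_subalg BM); exact: (grid_bounds gt). Qed.

(** The covariance condition gives E[H^T H | F] = (l / h) I with l <= Lambda. The
    Lipschitz constant is replaced by its maximum with 0, as its sign is not
    prescribed. *)
Lemma weights_frame : {ae P, forall w, forall k, (k < n)%N ->
    step t k * enorm (H k w) * LZ <= 1} ->
  exists lam, frame P n Tm (Num.max LZ 0) Lambda G h lam HH.
Proof.
move=> bnd.
have d1 : 1 <= d%:R :> R by rewrite ler1n.
have /choice[lam lamP] (m : nat) : exists l : R, (m < n)%N ->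
    [/\ 0 < l <= Lambda & is_weight P (G m) (l / h m) (HH m)].
  case: (ltnP m n) => mn; last by exists 0.
  have [l [/andP[l1 l2] _ cov]] := weights_covariance wH mn.
  have hm := grid_step gt mn; have sm := grid_subalg (ltnW mn).
  exists l => _; split.
    apply/andP; split; first by apply: lt_le_trans l1; rewrite divr_gt0// ltr0n.
    apply: (le_trans l2); rewrite ler_pdivrMr ?ltr0n//.
    by rewrite ler_peMr// ltW.
  have cond a b : condexp P (G m) (fun w => HH m a w * HH m b w)
       (fun=> l / h m * (a == b)%:R).
    have Q := condexp_lin (h m)^-1 sm (condexp0 P sm) (condexp_component a b sm cov).
    rewrite [X in condexp _ _ X](_ : _ = (fun w =>
       0 + (h m)^-1 * (step t m *: ((H m w)^T *m H m w)) a b)).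
      rewrite (_ : (fun _ : T => l / h m * (a == b)%:R) =
        (fun _ : T => 0 + (h m)^-1 * (l%:M : 'M[R]_d) a b))//.
      by apply/funext => w; rewrite !mxE add0r -[in RHS]mulr_natr mulrCA mulrA.
    by apply/funext => w; rewrite !mxE big_ord1 !mxE add0r mulKf// gt_eqF.
  split.
  - move=> a; split; last by have [_] := cond a a; under eq_fun do rewrite -expr2.
    have tS : t m.+1 \in `[0, Tm] by rewrite in_itv/= (grid_bounds gt).
    apply: (adapted_meas (grid_subalg mn)).
    apply: (mx_measurable_component _ _ (grid_subalg mn)).
    exact: (weights_adapted wH).
  - move=> a; have := condexp_component 0 a sm (weights_centered wH mn).
    by under [X in condexp _ _ _ X]eq_fun do rewrite mxE.
  - exact: cond.
exists lam; split.
- exact: grid_subalg.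
- by move=> m mn; apply: filtration_mono; rewrite ltW// (grid_lt gt).
- by move=> m; exact: (grid_step gt).
- exact: (grid_horizon gt).
- by move=> m /lamP[].
- by rewrite le_max lexx orbT.
- by move=> m /lamP[].
- move=> m mn; apply: filterS bnd => w /(_ m mn); rewrite enorm_row => b.
  by rewrite /Num.max; case: ifP => // _; rewrite mulr0.
Qed.

End Translation.

(** * From matrices to coordinates *)

Section OneScheme.
Context (disp : measure_display) (T : measurableType disp) (R : realType)
  (P : probability T R).
Local Notation mean := (mean P).
Local Notation summ := (summ P).
Local Notation sqsumm := (sqsumm P).
Local Notation step_condexp := (step_condexp P).
Context (d : nat) (Tm LZ Lambda eps p K : R) (W : R -> T -> 'rV[R]_d)
  (n : nat) (t : nat -> R) (kappa : nat) (r : nat -> R)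
  (H : nat -> T -> 'rV[R]_d).
Hypotheses (p2 : 2 <= p) (gt : is_grid Tm n t).
Let Ft := brownian_filtration P W.
Let G m := Ft (t m).
Let h := step t.
Let refl m := t m \in grid_points kappa r.
Local Notation HH := (weight_entry H).
Context (lam : nat -> R).
Local Notation LZ' := (Num.max LZ 0).
Hypothesis FR : frame P n Tm LZ' Lambda G h lam HH.
Context (C : R -> T -> 'M[R]_d) (xi : T -> 'cV[R]_d)
  (F : nat -> T -> 'M[R]_d -> 'cV[R]_d).
Hypothesis SA : scheme_assumptions P Ft Tm LZ eps p K n t kappa r H C xi F.

Let gsub m : (m <= n)%N -> subalg (G m). Proof. exact: (frame_sub FR). Qed.

(** Since the j-th component depends on the j-th row only, it may be evaluated at
    the matrix that keeps this row and vanishes elsewhere. *)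
Definition row_generator m (j : 'I_d) w (x : 'I_d -> R) : R :=
  F m w (only_row j x) j 0.

Definition cost_entry m (j l : 'I_d) w := C (t m) w j l.

Lemma xi_adapted j : adapted (G n) (fun w => xi w j 0).
Proof.
have [_ tn _] := gt; apply: (mx_measurable_component _ _ (gsub (leqnn n))).
by rewrite /G tn; exact: (xi_measurable SA).
Qed.

Lemma cost_entry_adapted m j l : (m <= n)%N -> adapted (G m) (cost_entry m j l).
Proof.
move=> mn; apply: (mx_measurable_component _ _ (gsub mn)).
by apply: (cost_adapted SA); exact: (grid_bounds gt).
Qed.

Lemma row_generator_adapted m j (z : 'I_d -> T -> R) : (m < n)%N ->
  (forall a, adapted (G m) (z a)) ->
  adapted (G m) (fun w => row_generator m j w (fun a => z a w)).
Proof.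
move=> mn az; have sm := gsub (ltnW mn).
apply: (mx_measurable_component (X := fun w => F m w (only_row j (fun a => z a w))) j 0 sm).
apply: (mx_field_comp sm (gen_measurable SA mn)).
apply: (mx_measurable_components sm) => a b.
case: (eqVneq a j) => [->|aj].
  rewrite (_ : (fun w => _) = z b)//.
  by apply/funext => w; rewrite mxE eqxx.
rewrite (_ : (fun w => _) = (fun=> 0)); first exact: measurable_cst.
by apply/funext => w; rewrite mxE (negbTE aj).
Qed.

Lemma row_generator_lip m : (m < n)%N -> {ae P, forall w, forall j x x',
  `|row_generator m j w x - row_generator m j w x'| <= LZ' * nrm (fun a => x a - x' a)}.
Proof.
move=> mn; apply: filterS (gen_lipschitz SA mn) => w L j x x'.
have := component_le_enorm (F m w (only_row j x) - F m w (only_row j x')) j 0.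
rewrite !mxE => /le_trans; apply; apply: le_trans (L _ _) _.
rewrite enorm_only_row ler_wpM2r ?nrm_ge0//.
by rewrite le_max lexx.
Qed.

Lemma row_generatorE m : (m < n)%N -> {ae P, forall w, forall j (z : 'M[R]_d),
  row_generator m j w (z j) = F m w z j 0}.
Proof.
move=> mn; apply: filterS (gen_row SA mn) => w E j z.
by apply: E; rewrite row_only_row.
Qed.

Lemma row_generator0 m j w : row_generator m j w (fun=> 0) = F m w 0 j 0.
Proof. by rewrite /row_generator only_row0. Qed.

(* The integrand of the bound on the data: once it is known to be measurable, each
   of its nonnegative terms is summable. *)
Let cmax w := \big[Num.max/0]_(k < n.+1 | t k \in grid_points kappa r)
                (enorm (C (t k) w) `^ p).
Let total w := enorm (xi w) ^+ 2 + \sum_(k < n) enorm (F k w 0) ^+ 2 * step t k + cmax w.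

Let menorm m (X : T -> 'M[R]_d) : (m <= n)%N -> mx_measurable (G m) X ->
  measurable_fun setT (fun w => enorm (X w)).
Proof.
move=> mn mX; have ms : measurable_fun [set: R] (@Num.sqrt R).
  by apply: continuous_measurable_fun; exact: sqrt_continuous.
apply: measurableT_comp => //.
apply: measurable_sum => i; apply: measurable_sum => j; apply: measurable_funX.
apply: (adapted_meas (gsub mn)); exact: (mx_measurable_component _ _ (gsub mn)).
Qed.

Lemma cost_max_measurable : measurable_fun setT cmax.
Proof.
apply: measurable_bigmax => // k _.
apply: (measurableT_comp (measurable_powR p)).
have kn : (k <= n)%N by rewrite -ltnS.
by apply: (menorm kn); apply: (cost_adapted SA); exact: (grid_bounds gt).
Qed.

Lemma cost_max_ge0 w : 0 <= cmax w.
Proof.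
by apply: (big_ind (fun x => 0 <= x)) => [//|x y x0 _|k _];
  [rewrite le_max x0|exact: powR_ge0].
Qed.

Lemma gen0_adapted m j : (m < n)%N -> adapted (G m) (fun w => F m w 0 j 0).
Proof.
move=> mn; have sm := gsub (ltnW mn).
rewrite (_ : (fun w => _) = (fun w => row_generator m j w (fun a => (fun=> 0) w))).
  by apply: row_generator_adapted => // a; exact: measurable_cst.
by apply/funext => w; rewrite row_generator0.
Qed.

Let total_parts w : [/\ 0 <= enorm (xi w) ^+ 2,
  forall k : 'I_n, 0 <= enorm (F k w 0) ^+ 2 * step t k & 0 <= cmax w].
Proof.
split; [exact: sqr_ge0| |exact: cost_max_ge0].
by move=> k; rewrite mulr_ge0 ?sqr_ge0// ltW// (grid_step gt).
Qed.

Let total_ge0 w : 0 <= total w.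
Proof.
have [a b c] := total_parts w.
by rewrite !addr_ge0// sumr_ge0.
Qed.

Let total_meas : measurable_fun setT total.
Proof.
apply: measurable_funD; last exact: cost_max_measurable.
apply: measurable_funD.
  rewrite (_ : (fun w => _) = (fun w => \sum_j xi w j 0 ^+ 2)).
    apply: measurable_sum => j; apply: measurable_funX.
    exact: adapted_meas (gsub (leqnn n)) (xi_adapted j).
  by apply/funext => w; rewrite enorm_col_sqr.
apply: measurable_sum => k; apply: measurable_funM => //.
rewrite (_ : (fun w => _) = (fun w => \sum_j F k w 0 j 0 ^+ 2)).
  apply: measurable_sum => j; apply: measurable_funX.
  exact: adapted_meas (gsub (ltnW (ltn_ord k))) (gen0_adapted j (ltn_ord k)).
by apply/funext => w; rewrite enorm_col_sqr.
Qed.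

Lemma data_summ : summ total /\ mean total <= K.
Proof.
have bnd := data_bound SA; rewrite -/total in bnd.
have s : summ total.
  apply/integrableP; split; first exact/measurable_EFinP.
  apply: le_lt_trans (ltry K); apply: le_trans bnd; rewrite unlock.
  rewrite le_eqVlt; apply/orP; left; apply/eqP; apply: eq_integral => w _ /=.
  by rewrite ger0_norm.
by split => //; rewrite -lee_fin -mean_expectation.
Qed.

Lemma cost_max_summ : summ cmax.
Proof.
apply: (summ_dom cost_max_measurable data_summ.1) => w.
have [a b c] := total_parts w; rewrite ger0_norm// lerDr addr_ge0//.
by rewrite sumr_ge0.
Qed.

Lemma xi_sqsumm j : sqsumm (fun w => xi w j 0).
Proof.
have mx := adapted_meas (gsub (leqnn n)) (xi_adapted j).
split=> //; apply: (summ_dom _ data_summ.1); first exact: measurable_funX.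
move=> w; have [a b c] := total_parts w.
rewrite ger0_norm ?sqr_ge0// /total -addrA enorm_col_sqr (bigD1 j)//= -addrA lerDl.
rewrite !addr_ge0// sumr_ge0// => i _; exact: sqr_ge0.
Qed.

Lemma gen0_sqsumm m j : (m < n)%N -> sqsumm (fun w => F m w 0 j 0).
Proof.
move=> mn; have mF := adapted_meas (gsub (ltnW mn)) (gen0_adapted j mn).
have hm := grid_step gt mn.
split=> //; apply: (summ_dom _ (summZ (step t m)^-1 data_summ.1)); first exact: measurable_funX.
move=> w; have [a b c] := total_parts w.
rewrite ger0_norm ?sqr_ge0// mulrC ler_pdivlMr// /total.
have F1 : F m w 0 j 0 ^+ 2 * step t m <= \sum_(k < n) enorm (F k w 0) ^+ 2 * step t k.
  rewrite (bigD1 (Ordinal mn))//= enorm_col_sqr (bigD1 j)//= mulrDl -addrA lerDl.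
  rewrite addr_ge0// ?sumr_ge0//.
  by rewrite mulr_ge0 ?(ltW hm)// sumr_ge0// => i _; exact: sqr_ge0.
by apply: (le_trans F1); rewrite addrAC lerDr addr_ge0.
Qed.

Lemma data_mean :
  mean (fun w => \sum_j xi w j 0 ^+ 2) +
  \sum_(0 <= m < n) h m * mean (fun w => \sum_j row_generator m j w (fun=> 0) ^+ 2) <= K.
Proof.
apply: le_trans data_summ.2.
have sx : summ (fun w => \sum_j xi w j 0 ^+ 2).
  by apply: summ_sum => j _; exact: sqsumm_sqr (xi_sqsumm j).
have sF m : (m < n)%N -> summ (fun w => \sum_j row_generator m j w (fun=> 0) ^+ 2).
  move=> mn; under eq_fun do under eq_bigr do rewrite row_generator0.
  by apply: summ_sum => j _; exact: sqsumm_sqr (gen0_sqsumm j mn).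
rewrite big_mkord.
under eq_bigr => m _ do rewrite -(meanZ (h m) (sF m (ltn_ord m))).
have sF' : summ (fun w => \sum_(m < n) h m * \sum_j row_generator m j w (fun=> 0) ^+ 2).
  by apply: summ_sum => m _; apply: summZ; exact: sF.
rewrite -mean_sum; last by move=> m _; apply: summZ; exact: sF.
rewrite -meanD//; apply: ler_mean; [exact: summD|exact: data_summ.1|].
apply: aeW => w; have [_ _ c] := total_parts w.
rewrite /total -enorm_col_sqr -[leLHS]addr0 lerD// lerD2l; apply: ler_sum => m _.
rewrite mulrC enorm_col_sqr; under eq_bigr do rewrite row_generator0.
by [].
Qed.

Lemma coordinate_generator : generator P n LZ' G row_generator.
Proof.
split; [exact: row_generator_adapted|exact: row_generator_lip|].
by move=> m j mn; under eq_fun do rewrite row_generator0; exact: gen0_sqsumm.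
Qed.

Lemma cost_max_ge m w : (m <= n)%N -> refl m -> enorm (C (t m) w) `^ p <= cmax w.
Proof.
move=> mn rm; have mn' : (m < n.+1)%N by [].
exact: (@le_bigmax_cond _ _ _ _ (Ordinal mn') _ (fun k : 'I_n.+1 => enorm (C (t k) w) `^ p)).
Qed.

Lemma coordinate_costs : costs P n G refl eps cost_entry.
Proof.
split.
- by move=> m j l mn _; exact: cost_entry_adapted (ltnW mn).
- move=> m j l mn rm.
  have mc := adapted_meas (gsub (ltnW mn)) (cost_entry_adapted j l (ltnW mn)).
  split=> //; apply: (summ_dom _ (summD (summ_cst P 1) cost_max_summ)).
    exact: measurable_funX.
  move=> w; rewrite ger0_norm ?sqr_ge0//.
  have c1 := component_le_enorm (C (t m) w) j l.
  have c2 := cost_max_ge w (ltnW mn) rm; have c0 := cost_max_ge0 w.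
  have e0 := enorm_ge0 (C (t m) w).
  have : cost_entry m j l w ^+ 2 <= enorm (C (t m) w) ^+ 2.
    by rewrite -(real_normK (num_real (cost_entry m j l w))) lerXn2r// nnegrE.
  move=> /le_trans; apply.
  (* As 2 <= p, one has x^2 <= 1 + x^p for x >= 0. *)
  have [e1|e1] := leP (enorm (C (t m) w)) 1.
    apply: (@le_trans _ _ 1); last by rewrite lerDl.
    by rewrite -(expr1n _ 2) lerXn2r// nnegrE.
  rewrite -powR_mulrn//; apply: le_trans (ler_powR (ltW e1) p2) _.
  by apply: (le_trans c2); rewrite lerDr.
- move=> m mn _; apply: filterS (cost_diag SA) => w E j.
  by apply: E; exact: (grid_bounds gt (ltnW mn)).
- move=> m mn _; apply: filterS (cost_lower SA) => w E j l jl.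
  rewrite -lee_fin; apply: le_trans (E j l jl) _.
  apply: ereal_inf_lbound; exists (t m) => //=.
  by rewrite in_itv/= (grid_bounds gt (ltnW mn)).
Qed.

Context (Yt Y : nat -> T -> 'cV[R]_d) (Z : nat -> T -> 'M[R]_d).
Hypothesis RS : reflected_scheme P Ft n t kappa r H C xi F Yt Y Z.

(** The conditional mean of Y m.+1. *)
Definition cond_mean m j w := Yt m w j 0 - step t m * F m w (Z m w) j 0.

Let YE m : (m < n)%N -> forall j,
  (fun w => Y m w j 0) = projected (refl m) (cost_entry m) (fun j w => Yt m w j 0) j.
Proof.
move=> mn j; apply/funext => w; rewrite /projected /refl (scheme_Y RS mn).
by case: ifP => // _; rewrite mxE.
Qed.

Let backward m : (m < n)%N -> (forall j, sqsumm (fun w => Y m.+1 w j 0)) ->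
  [/\ forall j, step_condexp (G m) (HH m) (fun w => Y m.+1 w j 0) (cond_mean m j)
         (fun a w => Z m w j a),
      forall j, adapted (G m) (fun w => Yt m w j 0),
      forall j, sqsumm (fun w => Yt m w j 0),
      forall j, adapted (G m) (fun w => Y m w j 0) &
      forall j, sqsumm (fun w => Y m w j 0)].
Proof.
move=> mn qY; have sm := gsub (ltnW mn); have hm := grid_step gt mn.
have /andP[l0 _] := frame_lam FR mn.
have st j : step_condexp (G m) (HH m) (fun w => Y m.+1 w j 0) (cond_mean m j)
         (fun a w => Z m w j a).
  split; first exact: qY.
  - have := condexp_component j 0 sm (scheme_Yt RS mn).
    by under [X in condexp _ _ _ X]eq_fun do rewrite !mxE.
  - move=> a; have := condexp_component j a sm (scheme_Z RS mn).
    by under [X in condexp _ _ X]eq_fun do rewrite mxE big_ord1.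
have qe j := (step_sq sm hm l0 (frame_weight FR mn) (st j)).1.
have qz j := (step_sq sm hm l0 (frame_weight FR mn) (st j)).2.
have az j a : adapted (G m) (fun w => Z m w j a) by have [_ _ /(_ a)[]] := st j.
have aF j : adapted (G m) (fun w => F m w (Z m w) j 0).
  apply: (mx_measurable_component (X := fun w => F m w (Z m w)) j 0 sm).
  apply: (mx_field_comp sm (gen_measurable SA mn)).
  exact: (scheme_Z RS mn).1.
have qF j : sqsumm (fun w => F m w (Z m w) j 0).
  apply: (sqsumm_ae_dom (adapted_meas sm (aF j))
    (sqsumm_norm (generator_sqZ FR j coordinate_generator mn (az j) (qz j)))).
  by apply: filterS (row_generatorE mn) => w ->.
have YtE j : (fun w => Yt m w j 0) =
    (fun w => cond_mean m j w + step t m * F m w (Z m w) j 0).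
  by apply/funext => w; rewrite /cond_mean subrK.
have aYt j : adapted (G m) (fun w => Yt m w j 0).
  rewrite YtE; apply: measurable_funD; first by have [_ []] := st j.
  by apply: measurable_funM; [exact: measurable_cst|exact: aF].
have qYt j : sqsumm (fun w => Yt m w j 0).
  by rewrite YtE; apply: sqsummD => //; exact: sqsummZ.
split=> // j.
- rewrite YE//; apply: (projected_adapted (GG := G m)) => // _ i l.
  exact: cost_entry_adapted (ltnW mn).
- rewrite YE//; apply: (projected_sqsumm (GG := G m)) => // [_ i l|rm i l].
    exact: cost_entry_adapted (ltnW mn).
  exact: (costs_sq coordinate_costs).
Qed.

(** The scheme is only assumed to satisfy its recursion; that its variables are
    square integrable propagates backwards from the terminal value, through Bessel's
    inequality and the growth of the generator. *)
Lemma coordinate_scheme : scheme P n G h HH refl cost_entry (fun j w => xi w j 0)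
  row_generator (fun m j w => Y m w j 0) (fun m j w => Yt m w j 0) cond_mean
  (fun m j a w => Z m w j a).
Proof.
have qY m : (m <= n)%N -> forall j, sqsumm (fun w => Y m w j 0).
  apply: (down_ind (Q := fun m => forall j, sqsumm (fun w => Y m w j 0))) => [j|k kn qk].
    rewrite (_ : (fun w => _) = (fun w => xi w j 0)); first exact: xi_sqsumm.
    by apply/funext => w; rewrite (scheme_terminal RS w).1.
  by have [] := backward kn qk.
have aY m : (m <= n)%N -> forall j, adapted (G m) (fun w => Y m w j 0).
  rewrite leq_eqVlt => /orP[/eqP -> j|mn].
    rewrite (_ : (fun w => _) = (fun w => xi w j 0)); first exact: xi_adapted.
    by apply/funext => w; rewrite (scheme_terminal RS w).1.
  by have [] := backward mn (qY _ mn).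
split=> [j w|m j mn|m j mn|m j mn|m j mn|m j mn|m mn|m mn].
- by rewrite (scheme_terminal RS w).1.
- exact: aY.
- exact: qY.
- by have [] := backward mn (qY _ mn).
- by have [] := backward mn (qY _ mn).
- by have [] := backward mn (qY _ mn).
- by apply: filterS (row_generatorE mn) => w E j; rewrite E /cond_mean subrK.
- apply: aeW => w; have := projected_reflected_at (refl m) (cost_entry m) (fun j w => Yt m w j 0) w.
  rewrite /reflected_at; case: ifP => rm Q j; have := Q j;
    by rewrite -(YE mn j).
Qed.

End OneScheme.

(** * Data terms *)

(** The larger function need not be measurable: the integral of a nonnegative
    function is a supremum over the simple functions below it. This is needed for
    the distance of the generators, a supremum over uncountably many matrices. *)
Lemma mean_le_integral (disp : measure_display) (T : measurableType disp)
    (R : realType) (P : probability T R) (f : T -> R) (g : T -> \bar R) :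
  summ P f -> (forall w, 0 <= f w) -> (forall w, ((f w)%:E <= g w)%E) ->
  ((mean P f)%:E <= \int[P]_w g w)%E.
Proof.
move=> sf f0 fg.
have g0 w : (0 <= g w)%E by apply: le_trans (fg w); rewrite lee_fin.
rewrite -mean_integral// !ge0_integralTE//.
apply: le_ereal_sup => _ [u /= uf <-]; exists u => // w /=.
exact: le_trans (uf w) (fg w).
Qed.

Lemma le_bigmaxe (R : realType) (m n : nat) (x : nat -> \bar R) (b : \bar R) :
  (0 <= b)%E -> (forall k, (m <= k < n)%N -> (x k <= b)%E) ->
  (\big[maxe/0]_(m <= k < n) x k <= b)%E.
Proof.
move=> b0 xb; rewrite big_nat; apply: (big_ind (fun y => (y <= b)%E)) => //.
by move=> y z yb zb; rewrite ge_max yb.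
Qed.

Section CostDistance.
Context (R : realType) (d : nat).
Implicit Types (A B : 'M[R]_d).

Lemma cost_dist_ge A B i j : `|A i j - B i j| <= cost_dist A B.
Proof.
apply: le_trans (le_bigmax_cond _ (fun j => `|A i j - B i j|) isT) _.
exact: (le_bigmax_cond _ (fun i => \big[Num.max/0]_(j < d) `|A i j - B i j|)).
Qed.

Lemma cost_dist_ge0 A B : 0 <= cost_dist A B.
Proof.
apply: (big_ind (fun x => 0 <= x)) => // [x y x0 _|i _]; first by rewrite le_max x0.
by apply: (big_ind (fun x => 0 <= x)) => // [x y x0 _]; rewrite le_max x0.
Qed.

Lemma cost_dist_le A B : cost_dist A B <= enorm A + enorm B.
Proof.
have s0 : 0 <= enorm A + enorm B by rewrite addr_ge0 ?enorm_ge0.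
apply: (big_ind (fun x => x <= _)) => // [x y x0 y0|i _]; first by rewrite ge_max x0.
apply: (big_ind (fun x => x <= _)) => // [x y x0 y0|j _]; first by rewrite ge_max x0.
by apply: le_trans (ler_normB _ _) _; rewrite lerD// component_le_enorm.
Qed.

Lemma gen_dist_ge (F1 F2 : 'M[R]_d -> 'cV[R]_d) j z :
  ((`|F1 z j 0 - F2 z j 0|)%:E <= gen_dist F1 F2)%E.
Proof.
rewrite /gen_dist (bigD1 j)//= le_max; apply/orP; left.
by apply: ereal_sup_ubound; exists z.
Qed.

End CostDistance.

Lemma powRD_le (R : realType) (p x y : R) : 0 <= p -> 0 <= x -> 0 <= y ->
  (x + y) `^ p <= 2 `^ p * (x `^ p + y `^ p).
Proof.
move=> p0 x0 y0.
wlog xy : x y x0 y0 / x <= y.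
  move=> W; have [/W|/ltW/W] := leP x y; first exact.
  by rewrite addrC [y `^ p + _]addrC; exact.
apply: (@le_trans _ _ ((2 * y) `^ p)).
  by apply: ge0_ler_powR => //; rewrite ?nnegrE ?addr_ge0 ?mulr_ge0//; lra.
by rewrite powRM// ler_wpM2l ?powR_ge0// lerDr powR_ge0.
Qed.

(** * Stability of the obliquely reflected scheme *)

Section TwoSchemes.
Context (disp : measure_display) (T : measurableType disp) (R : realType)
  (P : probability T R).
Local Notation mean := (mean P).
Local Notation summ := (summ P).
Local Notation sqsumm := (sqsumm P).
Context (d : nat) (Tm LZ lambda Lambda eps p K : R) (W : R -> T -> 'rV[R]_d)
  (n : nat) (t : nat -> R) (kappa : nat) (r : nat -> R)
  (H : nat -> T -> 'rV[R]_d).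
Hypotheses (d0 : (0 < d)%N) (T0 : 0 < Tm) (lambda0 : 0 < lambda)
  (Lambda0 : 0 < Lambda) (eps0 : 0 < eps) (p2 : 2 <= p).
Hypotheses (BM : brownian_motion P Tm W) (gt : is_grid Tm n t)
  (gr : is_grid Tm kappa r).
Let Ft := brownian_filtration P W.
Hypothesis wH : is_weights P Ft lambda Lambda n t H.
Context (C1 C2 : R -> T -> 'M[R]_d) (xi1 xi2 : T -> 'cV[R]_d)
  (F1 F2 : nat -> T -> 'M[R]_d -> 'cV[R]_d).
Hypotheses (SA1 : scheme_assumptions P Ft Tm LZ eps p K n t kappa r H C1 xi1 F1)
  (SA2 : scheme_assumptions P Ft Tm LZ eps p K n t kappa r H C2 xi2 F2).
Context (Yt1 Y1 Yt2 Y2 : nat -> T -> 'cV[R]_d) (Z1 Z2 : nat -> T -> 'M[R]_d).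
Hypotheses (RS1 : reflected_scheme P Ft n t kappa r H C1 xi1 F1 Yt1 Y1 Z1)
  (RS2 : reflected_scheme P Ft n t kappa r H C2 xi2 F2 Yt2 Y2 Z2).
Local Notation LZ' := (Num.max LZ 0).
Let h := step t.
Let refl m := t m \in grid_points kappa r.

Definition gap_max w := \big[Num.max/0]_(k < n.+1 | t k \in grid_points kappa r)
   (cost_dist (C1 (t k) w) (C2 (t k) w) `^ p).

Let p0 : 0 < p. Proof. by apply: lt_le_trans p2. Qed.

Lemma gap_max_ge0 w : 0 <= gap_max w.
Proof.
by apply: (big_ind (fun x => 0 <= x)) => [//|x y x0 _|k _];
  [rewrite le_max x0|exact: powR_ge0].
Qed.

Lemma gap_max_ge m w : (m < n)%N -> refl m ->
  cost_dist (C1 (t m) w) (C2 (t m) w) `^ p <= gap_max w.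
Proof.
move=> mn rm; have mn' : (m < n.+1)%N by apply: ltnW.
exact: (@le_bigmax_cond _ _ _ _ (Ordinal mn') _
  (fun k : 'I_n.+1 => cost_dist (C1 (t k) w) (C2 (t k) w) `^ p)).
Qed.

Lemma gap_max_summ lam :
  frame P n Tm LZ' Lambda (fun m => Ft (t m)) h lam (weight_entry H) -> summ gap_max.
Proof.
move=> FR.
have c1 := cost_max_summ gt FR SA1; have c2 := cost_max_summ gt FR SA2.
apply: (summ_dom _ (summZ (2 `^ p) (summD c1 c2))).
  apply: measurable_bigmax => // k _.
  apply: (measurableT_comp (measurable_powR p)).
  have kn : (k <= n)%N by rewrite -ltnS.
  apply: measurable_bigmax => // i _; apply: measurable_bigmax => // j _.
  apply: measurableT_comp => //; apply: measurable_funB.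
    exact: adapted_meas (frame_sub FR kn) (cost_entry_adapted gt FR SA1 i j kn).
  exact: adapted_meas (frame_sub FR kn) (cost_entry_adapted gt FR SA2 i j kn).
move=> w; rewrite ger0_norm ?gap_max_ge0//.
have M0 (C : R -> T -> 'M[R]_d) : 0 <= \big[Num.max/0]_(k < n.+1 | t k \in grid_points kappa r)
    (enorm (C (t k) w) `^ p).
  by apply: (big_ind (fun x => 0 <= x)) => [//|x y x0 _|k _];
    [rewrite le_max x0|exact: powR_ge0].
apply: (big_ind (fun x => x <= _)) => [|x y xb yb|k rk].
- by rewrite mulr_ge0 ?powR_ge0// addr_ge0.
- by rewrite ge_max xb.
- apply: (@le_trans _ _ ((enorm (C1 (t k) w) + enorm (C2 (t k) w)) `^ p)).
    apply: ge0_ler_powR; rewrite ?nnegrE ?cost_dist_ge0 ?addr_ge0 ?enorm_ge0 ?(ltW p0)//.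
    exact: cost_dist_le.
  apply: le_trans (powRD_le (ltW p0) (enorm_ge0 _) (enorm_ge0 _)) _.
  rewrite ler_wpM2l ?powR_ge0// lerD//.
    exact: (le_bigmax_cond _ (fun k : 'I_n.+1 => enorm (C1 (t k) w) `^ p)).
  exact: (le_bigmax_cond _ (fun k : 'I_n.+1 => enorm (C2 (t k) w) `^ p)).
Qed.

Definition total_cst : R :=
  4 * d%:R * energy_cst Tm LZ' Lambda + 2 * d%:R * tilde_cst Tm LZ' Lambda +
  z_cst d Tm LZ' Lambda * (2 * d%:R * energy_cst Tm LZ' Lambda).

Definition gap_total_cst : R := total_cst * stability_gap d Tm LZ' Lambda eps K.

(** The coordinate estimate, applied with S the p-th root of the largest p-th power
    of the cost distance over the reflection dates. *)
Lemma scheme_stability i : (i <= n)%N ->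
  (\big[maxe/0]_(i <= k < n.+1)
      'E_P[fun w => (enorm (Y1 k w - Y2 k w) ^+ 2
                     + enorm (Yt1 k w - Yt2 k w) ^+ 2)%R]
   + (kappa%:R^-1)%R%:E
     * 'E_P[fun w => (\sum_(i <= k < n)
                        step t k * enorm (Z1 k w - Z2 k w) ^+ 2)%R]
   <= (4 * d%:R ^+ 2 * `|total_cst| + 1)%:E
      * \int[P]_w (\sum_(i <= k < n)
                     gen_dist (F1 k w) (F2 k w) ^+ 2 * (step t k)%:E
                   + (enorm (xi1 w - xi2 w) ^+ 2)%R%:E)
      + ((`|gap_total_cst| + 1) * kappa%:R `^ (4 / p))%R%:E
        * 'E_P[gap_max] `^ (2 / p)%R)%E.
Proof.
move=> iN.
have [lam FR] := weights_frame d0 lambda0 Lambda0 BM gt wH (weights_bound SA1).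
have [t0 tn _] := gt; have [r0 rk _] := gr.
have n0 : (0 < n)%N.
  by rewrite lt0n; apply/eqP => nE; move: T0; rewrite -tn nE t0 ltxx.
have k0 : (0 < kappa)%N.
  by rewrite lt0n; apply/eqP => kE; move: T0; rewrite -rk kE r0 ltxx.
have kap1 : 1 <= kappa%:R :> R by rewrite ler1n.
have sM := gap_max_summ FR.
pose S w := gap_max w `^ p^-1.
have SE : (fun w => S w `^ p) = gap_max.
  apply/funext => w; rewrite -powRrM mulVf ?gt_eqF// powRr1// gap_max_ge0//.
have sSp : summ (fun w => S w `^ p) by rewrite SE.
have S0 w : 0 <= S w by exact: powR_ge0.
have cS m : (m < n)%N -> refl m -> forall j l w,
    `|cost_entry t C1 m j l w - cost_entry t C2 m j l w| <= S w.
  move=> mn rm j l w; apply: le_trans (cost_dist_ge _ _ j l) _.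
  rewrite -[leLHS]powRr1 ?cost_dist_ge0// -(mulfV (lt0r_neq0 p0)) powRrM.
  apply: ge0_ler_powR; rewrite ?invr_ge0 ?(ltW p0)// ?nnegrE ?powR_ge0 ?gap_max_ge0//.
  exact: gap_max_ge.
have sc1 := coordinate_scheme p2 gt FR SA1 RS1; have sc2 := coordinate_scheme p2 gt FR SA2 RS2.
have [psi [psiq [psi_le main]]] := stability FR n0 d0 eps0 kap1 p2
  (grid_count gt r k0) S0 sSp (coordinate_generator gt FR SA1) (coordinate_costs p2 gt FR SA1)
  sc1 (coordinate_generator gt FR SA2) (coordinate_costs p2 gt FR SA2) sc2 cS
  (data_mean gt FR SA1) (data_mean gt FR SA2).
have [] := main i iN; rewrite SE.
set A := _ + \sum_(i <= m < n) _; set Q := A + _ => Q0 YQ YtQ ZQ.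
have d1 : 1 <= d%:R :> R by rewrite ler1n.
have qY1 m j : (m <= n)%N -> sqsumm (fun w => Y1 m w j 0) by exact: (sch_sq sc1).
have qY2 m j : (m <= n)%N -> sqsumm (fun w => Y2 m w j 0) by exact: (sch_sq sc2).
have qYt1 m j : (m < n)%N -> sqsumm (fun w => Yt1 m w j 0) by exact: (sch_tsq sc1).
have qYt2 m j : (m < n)%N -> sqsumm (fun w => Yt2 m w j 0) by exact: (sch_tsq sc2).
have colE (X Y : T -> 'cV[R]_d) : (fun w => enorm (X w - Y w) ^+ 2) =
    (fun w => \sum_j (X w j 0 - Y w j 0) ^+ 2).
  apply/funext => w; rewrite enorm_col_sqr; apply: eq_bigr => j _.
  by rewrite !mxE.
have sdiff (X Y : T -> 'cV[R]_d) : (forall j, sqsumm (fun w => X w j 0)) ->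
    (forall j, sqsumm (fun w => Y w j 0)) ->
    summ (fun w => enorm (X w - Y w) ^+ 2) /\
    mean (fun w => enorm (X w - Y w) ^+ 2) =
    \sum_j mean (fun w => (X w j 0 - Y w j 0) ^+ 2).
  move=> qX qY; rewrite colE.
  have q j : summ (fun w => (X w j 0 - Y w j 0) ^+ 2).
    by apply: sqsumm_sqr; exact: sqsummB.
  by split; [exact: summ_sum|exact: mean_sum].
(* The integrand need not be measurable; 4 d^2 comes from psi <= 2 d g, where g is
   the distance of the generators. *)
have dataQ : (A%:E <= (4 * d%:R ^+ 2)%:E *
    \int[P]_w (\sum_(i <= k < n) gen_dist (F1 k w) (F2 k w) ^+ 2 * (step t k)%:E
                   + (enorm (xi1 w - xi2 w) ^+ 2)%R%:E))%E.
  have qx1 j : sqsumm (fun w => xi1 w j 0) := xi_sqsumm gt FR SA1 j.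
  have qx2 j : sqsumm (fun w => xi2 w j 0) := xi_sqsumm gt FR SA2 j.
  have [sx mx] := sdiff _ _ qx1 qx2.
  pose c : R := (4 * d%:R ^+ 2)^-1.
  have c0 : 0 < 4 * d%:R ^+ 2 :> R by rewrite mulr_gt0// exprn_gt0//; lra.
  pose f w := \sum_(i <= k < n) (c * h k) * psi k w ^+ 2 + enorm (xi1 w - xi2 w) ^+ 2.
  have spsi : summ (fun w => \sum_(i <= k < n) (c * h k) * psi k w ^+ 2).
    apply: summ_sum_nat => k /andP[_ kn].
    by apply: summZ; apply: sqsumm_sqr; exact: (psiq k kn).1.
  have sf : summ f by exact: summD.
  have mf : A <= 4 * d%:R ^+ 2 * mean f.
    rewrite meanD// /A mulrDr addrC; apply: lerD.
      rewrite (_ : mean _ = c * \sum_(i <= m < n) h m * mean (fun w => psi m w ^+ 2)).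
        by rewrite mulrA /c mulfV ?gt_eqF// mul1r.
      rewrite mean_sum_nat => [|k /andP[_ kn]]; last first.
        by apply: summZ; apply: sqsumm_sqr; exact: (psiq k kn).1.
      rewrite mulr_sumr; apply: eq_big_nat => k /andP[_ kn]; rewrite mulrA meanZ//.
      by apply: sqsumm_sqr; exact: (psiq k kn).1.
    rewrite -colE ler_peMl//; first by apply: mean_ge0 => w; exact: sqr_ge0.
    have : 1 <= d%:R ^+ 2 :> R by exact: exprn_ege1.
    by lra.
  apply: (@le_trans _ _ (4 * d%:R ^+ 2 * mean f)%:E); first by rewrite lee_fin.
  rewrite [X in (X <= _)%E]EFinM; apply: lee_wpmul2l; first by rewrite lee_fin ltW.
  apply: mean_le_integral => // w.
    rewrite /f addr_ge0 ?sqr_ge0// big_nat_cond sumr_ge0// => k; rewrite andbT => /andP[_ kn].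
    by rewrite mulr_ge0 ?sqr_ge0// mulr_ge0 ?invr_ge0 ?(ltW c0)// ltW// (grid_step gt).
  rewrite /f EFinD leeD2r// -sumEFin big_nat_cond [leRHS]big_nat_cond.
  apply: lee_sum => k; rewrite andbT => /andP[_ kn].
  have hk := grid_step gt kn; have [_ psi0] := psiq k kn.
  rewrite -mulrA [h k * _]mulrC mulrA [X in (X <= _)%E]EFinM.
  apply: lee_wpmul2r; first by rewrite lee_fin ltW.
  have g0 : (0 <= gen_dist (F1 k w) (F2 k w))%E.
    by apply: le_trans (gen_dist_ge _ _ (Ordinal d0) 0); rewrite lee_fin.
  case E : (gen_dist (F1 k w) (F2 k w)) g0 => [g| |] // g0.
    rewrite -EFin_expe lee_fin /c mulrC ler_pdivrMr//.
    have -> : g ^+ 2 * (4 * d%:R ^+ 2) = (2 * d%:R * g) ^+ 2 by ring.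
    rewrite lerXn2r// ?nnegrE//.
      by rewrite mulr_ge0// mulr_ge0//.
    apply: psi_le => j x; rewrite -lee_fin -E.
    exact: gen_dist_ge.
  by rewrite expe2 mulyy leey.
set X := (\int[P]_w _)%E in dataQ *.
have A0 : 0 <= A.
  rewrite /A addr_ge0//.
    by apply: mean_ge0 => w; apply: sumr_ge0 => j _; exact: sqr_ge0.
  rewrite big_nat_cond sumr_ge0// => k; rewrite andbT => /andP[_ kn].
  by rewrite mulr_ge0 ?(ltW (grid_step gt kn))// mean_ge0// => w; exact: sqr_ge0.
have dd0 : 0 < 4 * d%:R ^+ 2 :> R by rewrite mulr_gt0// exprn_gt0//; lra.
have X0 : (0 <= X)%E.
  rewrite -(@pmule_rge0 _ (4 * d%:R ^+ 2)%:E) ?lte_fin//.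
  by apply: le_trans dataQ; rewrite lee_fin.
rewrite (mean_expectation sM) poweR_EFin -EFinM.
set gapQ := kappa%:R `^ (4 / p) * _ in Q Q0 YQ YtQ ZQ.
have gapQ0 : 0 <= gapQ by rewrite /gapQ mulr_ge0 ?powR_ge0.
have Ce0 : 0 <= energy_cst Tm LZ' Lambda.
  by apply: le_trans (energy_cst_ge1 FR n0); exact: ler01.
have m1 := mu_ge1 FR n0; have Tm0 := ltW T0.
have tc0 : 0 <= tilde_cst Tm LZ' Lambda.
  by rewrite mulr_ge0// mulr_ge0// addr_ge0// mulr_ge0//; lra.
have Ypart : (\big[maxe/0]_(i <= k < n.+1)
      'E_P[fun w => (enorm (Y1 k w - Y2 k w) ^+ 2
                     + enorm (Yt1 k w - Yt2 k w) ^+ 2)%R] <=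
    ((4 * d%:R * energy_cst Tm LZ' Lambda + 2 * d%:R * tilde_cst Tm LZ' Lambda) * Q)%:E)%E.
  apply: le_bigmaxe => [|k /andP[ik kn]].
    by rewrite lee_fin mulr_ge0// addr_ge0// mulr_ge0// mulr_ge0.
  have {}kn : (k <= n)%N by [].
  have [sY mY] := sdiff _ _ (qY1 k ^~ kn) (qY2 k ^~ kn).
  have ikn : (i <= k <= n)%N by rewrite ik.
  have bY := YQ k ikn; move: kn; rewrite leq_eqVlt => /orP[/eqP kE|kn].
    have YtE : (fun w => enorm (Yt1 k w - Yt2 k w) ^+ 2) =
               (fun w => enorm (Y1 k w - Y2 k w) ^+ 2).
      apply/funext => w; rewrite kE (scheme_terminal RS1 w).1 (scheme_terminal RS1 w).2.
      by rewrite (scheme_terminal RS2 w).1 (scheme_terminal RS2 w).2.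
    have sYt : summ (fun w => enorm (Yt1 k w - Yt2 k w) ^+ 2) by rewrite YtE.
    rewrite mean_expectation ?lee_fin; last exact: summD.
    rewrite meanD// YtE mY.
    have : 0 <= 2 * d%:R * tilde_cst Tm LZ' Lambda * Q by rewrite mulr_ge0// mulr_ge0// mulr_ge0.
    by lra.
  have [sYt mYt] := sdiff _ _ (qYt1 k ^~ kn) (qYt2 k ^~ kn).
  rewrite mean_expectation ?lee_fin; last exact: summD.
  rewrite meanD// mY mYt; have bYt := YtQ k (introT andP (conj ik kn)).
  have : 0 <= 2 * d%:R * energy_cst Tm LZ' Lambda * Q.
    by rewrite mulr_ge0// mulr_ge0// mulr_ge0.
  by lra.
have Zpart : ((kappa%:R^-1)%R%:E
     * 'E_P[fun w => (\sum_(i <= k < n)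
                        step t k * enorm (Z1 k w - Z2 k w) ^+ 2)%R] <=
    (z_cst d Tm LZ' Lambda * (2 * d%:R * energy_cst Tm LZ' Lambda) * Q)%:E)%E.
  have qZ k j : (k < n)%N -> summ (fun w => nrm (fun a => Z1 k w j a - Z2 k w j a) ^+ 2).
    move=> kn; have /andP[l0 _] := frame_lam FR kn.
    have [_ q1] := step_sq (frame_sub FR (ltnW kn)) (frame_step FR kn) l0
      (frame_weight FR kn) (sch_step sc1 j kn).
    have [_ q2] := step_sq (frame_sub FR (ltnW kn)) (frame_step FR kn) l0
      (frame_weight FR kn) (sch_step sc2 j kn).
    by apply: sqsumm_sqr; apply: sqsumm_nrm => a; exact: sqsummB.
  have ZE k : (fun w => enorm (Z1 k w - Z2 k w) ^+ 2) =
      (fun w => \sum_j nrm (fun a => Z1 k w j a - Z2 k w j a) ^+ 2).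
    apply/funext => w; rewrite enorm_sqr; apply: eq_bigr => j _.
    by rewrite nrm_sqr; apply: eq_bigr => a _; rewrite !mxE.
  have sZ k : (k < n)%N -> summ (fun w => enorm (Z1 k w - Z2 k w) ^+ 2).
    by move=> kn; rewrite ZE; apply: summ_sum => j _; exact: qZ.
  have sZh k : (i <= k < n)%N ->
      summ (fun w => step t k * enorm (Z1 k w - Z2 k w) ^+ 2).
    by move=> /andP[_ kn]; exact: summZ (sZ k kn).
  rewrite mean_expectation; last exact: summ_sum_nat.
  rewrite mean_sum_nat// -EFinM lee_fin ler_pdivrMl ?ltr0n// -mulrA -[2 * d%:R * _ * Q]mulrA.
  apply: le_trans ZQ; apply: ler_sum_nat => k /andP[_ kn].
  rewrite meanZ; last exact: sZ.
  by rewrite ZE mean_sum// => j _; exact: qZ.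
apply: (le_trans (leeD Ypart Zpart)).
rewrite -EFinD -mulrDl -/total_cst.
have -> : total_cst * Q = total_cst * A + gap_total_cst * gapQ.
  by rewrite /Q /gap_total_cst; ring.
rewrite EFinD; apply: leeD.
  apply: (@le_trans _ _ (`|total_cst| * A)%:E).
    by rewrite lee_fin ler_wpM2r// ler_norm.
  rewrite EFinM; apply: le_trans (lee_wpmul2l _ dataQ) _; first by rewrite lee_fin.
  rewrite muleA -EFinM; apply: lee_wpmul2r => //.
  by rewrite lee_fin mulrC lerDl.
rewrite lee_fin -[leRHS]mulrA -/gapQ ler_wpM2r//.
by apply: le_trans (ler_norm _) _; rewrite lerDl.
Qed.

End TwoSchemes.

Theorem proposition3p5 (R : realType) (d : nat) (T LZ lambda Lambda eps K : R)
    (d_gt0 : (0 < d)%N) (T_gt0 : 0 < T)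
    (lambda_gt0 : 0 < lambda) (Lambda_gt0 : 0 < Lambda) (eps_gt0 : 0 < eps) :
  exists2 Cst : R, 0 < Cst &
  forall p : R, 2 <= p ->
  exists2 Cp : R, 0 < Cp &
  forall (disp : measure_display) (Omega : measurableType disp)
    (P : probability Omega R) (W : R -> Omega -> 'rV[R]_d)
    (n : nat) (t : nat -> R) (kappa : nat) (r : nat -> R)
    (H : nat -> Omega -> 'rV[R]_d)
    (C1 C2 : R -> Omega -> 'M[R]_d)
    (xi1 xi2 : Omega -> 'cV[R]_d)
    (F1 F2 : nat -> Omega -> 'M[R]_d -> 'cV[R]_d)
    (Yt1 Y1 Yt2 Y2 : nat -> Omega -> 'cV[R]_d)
    (Z1 Z2 : nat -> Omega -> 'M[R]_d),
  brownian_motion P T W ->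
  let Ft := brownian_filtration P W in
  is_grid T n t -> is_grid T kappa r ->
  {subset grid_points kappa r <= grid_points n t} ->
  is_weights P Ft lambda Lambda n t H ->
  scheme_assumptions P Ft T LZ eps p K n t kappa r H C1 xi1 F1 ->
  scheme_assumptions P Ft T LZ eps p K n t kappa r H C2 xi2 F2 ->
  reflected_scheme P Ft n t kappa r H C1 xi1 F1 Yt1 Y1 Z1 ->
  reflected_scheme P Ft n t kappa r H C2 xi2 F2 Yt2 Y2 Z2 ->
  forall i : nat, (i <= n)%N ->
  (\big[maxe/0]_(i <= k < n.+1)
      'E_P[fun w => (enorm (Y1 k w - Y2 k w) ^+ 2
                     + enorm (Yt1 k w - Yt2 k w) ^+ 2)%R]
   + (kappa%:R^-1)%R%:E
     * 'E_P[fun w => (\sum_(i <= k < n)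
                        step t k * enorm (Z1 k w - Z2 k w) ^+ 2)%R]
   <= Cst%:E
      * \int[P]_w (\sum_(i <= k < n)
                     gen_dist (F1 k w) (F2 k w) ^+ 2 * (step t k)%:E
                   + (enorm (xi1 w - xi2 w) ^+ 2)%R%:E)
      + (Cp * kappa%:R `^ (4 / p))%R%:E
        * 'E_P[fun w => (\big[Num.max/0]_(k < n.+1 | t k \in grid_points kappa r)
                          (cost_dist (C1 (t k) w) (C2 (t k) w) `^ p))%R]
            `^ (2 / p)%R)%E.
Proof.
exists (4 * d%:R ^+ 2 * `|total_cst d T LZ Lambda| + 1).
  by rewrite ltr_wpDl// mulr_ge0// mulr_ge0// exprn_ge0.
move=> p p2; exists (`|gap_total_cst d T LZ Lambda eps K| + 1).
  by rewrite ltr_wpDl.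
move=> disp Omega P W n t kappa r H C1 C2 xi1 xi2 F1 F2 Yt1 Y1 Yt2 Y2 Z1 Z2.
move=> BM Ft gt gr _ wH SA1 SA2 RS1 RS2 i iN.
exact: (scheme_stability d_gt0 T_gt0 lambda_gt0 Lambda_gt0 eps_gt0 p2 BM gt gr wH
  SA1 SA2 RS1 RS2 iN).
Qed.
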